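(* Let $(M,F)$ be a forward complete connected $C^0$-Finsler manifold. If there exists a non-isometric self-similarity $f:M\to M$ of class $C^1$, then $(M,F)$ is a Minkowski space, that is, it is isometric to any one of its tangent spaces $(T_xM,F_x)$.
   Context: A ($C^0$-)Finsler metric on a smooth manifold $M$ is a continuous function $F:TM\to[0,\infty)$ such that for every $x$ the restriction $F_x=F|_{T_xM}$ is a Minkowski norm: $F_x(\lambda\xi)=\lambda F_x(\xi)$ for $\lambda\ge0$, $F_x(\xi+\eta)\le F_x(\xi)+F_x(\eta)$, and $F_x(\xi)=0\Rightarrow\xi=0$ (no symmetry, further smoothness or strong convexity is assumed). Each $(T_xM,F_x)$ is regarded as a Finsler manifold with the constant Minkowski norm $F_x$. The distance $d(x,y)$ is the infimum of $\int_0^1F(\gamma(t),\dot\gamma(t))\,dt$ over smooth curves $\gamma:[0,1]\to M$ with $\gamma(0)=x$, $\gamma(1)=y$; it need not be symmetric. A sequence $\{x_i\}$ is forward Cauchy if for every $\varepsilon>0$ there is an integer $N$ with $d(x_i,x_{i+k})<\varepsilon$ for all $i\ge N$, $k\ge0$; $(M,F)$ is forward complete if every forward Cauchy sequence converges. A $C^1$-map $f:(M,F)\to(M',F')$ is a similarity if there exists a constant $a>0$ (called the dilation constant) such that $F'(f(x),df_x(\xi))=a\cdot F(x,\xi)$ for all $(x,\xi)\in TM$. It is an isometry if $a=1$. A self-similarity is a similarity from $(M,F)$ to itself; ''non-isometric'' means $a\ne1$.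
   Formalization: The self-similarity is assumed injective when its dilation constant exceeds 1 (else doubling the circle is a counterexample), and ''isometric'' means a distance-preserving bijection, since for C^0-Finsler metrics a C^1 isometry need not exist. *)

(* Defs.v *)
From HB Require Import structures.
From mathcomp Require Import all_boot all_order all_algebra.
From mathcomp Require Import all_classical all_reals all_analysis.

Set Implicit Arguments.
Unset Strict Implicit.
Unset Printing Implicit Defensive.

Import Order.TTheory GRing.Theory Num.Theory.
Import numFieldNormedType.Exports.

Local Open Scope classical_set_scope.
Local Open Scope ring_scope.

(* Meant for an open [U] and a finite-dimensional [V], where it is the usual
   class C^k: there, continuity of [x |-> 'd f x] can be tested on each vector
   separately. *)
Fixpoint Ck (R : realType) (V W : normedModType R) (k : nat) (U : set V)
    (f : V -> W) : Prop :=
  match k with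
  | 0 => forall x, U x -> {for x, continuous f}
  | k'.+1 => (forall x, U x -> differentiable f x) /\
             (forall v : V, Ck k' U (fun x => 'd f x v))
  end.

Definition smooth_on (R : realType) (V W : normedModType R) (U : set V)
    (f : V -> W) : Prop := forall k, Ck k U f.

(* Smooth n-manifold given by an atlas. [param i] is the inverse of the chart
   [coord i]; its values off the image of the chart are irrelevant. [chart_at]
   singles out one chart around each point. It serves to represent the tangent
   space at [x] by 'rV_n, a tangent vector being its components in the chart
   [chart_at x]; no other choice is built in. *)
Record manifold (R : realType) (n : nat) := Manifold {
  carrier :> topologicalType;
  atlas : Type;
  dom : atlas -> set carrier;
  coord : atlas -> carrier -> 'rV[R]_n;
  param : atlas -> 'rV[R]_n -> carrier;
  chart_at : carrier -> atlas;
  chart_atP : forall x, dom (chart_at x) x;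
  dom_open : forall i, open (dom i);
  img_open : forall i, open (coord i @` dom i);
  coordK : forall i x, dom i x -> param i (coord i x) = x;
  coord_continuous : forall i x, dom i x -> {for x, continuous (coord i)};
  param_continuous : forall i u,
    (coord i @` dom i) u -> {for u, continuous (param i)};
  transition_smooth : forall i j,
    smooth_on (coord i @` (dom i `&` dom j)) (coord j \o param i);
  manifold_hausdorff : hausdorff_space carrier;
  manifold_second_countable : @second_countable carrier }.

Section Maps.
Context (R : realType) (n m : nat) (M : manifold R n) (N : manifold R m).

Definition C1_map (f : M -> N) : Prop :=
  continuous f /\
  forall i j, Ck 1 (coord i @` (dom i `&` f @^-1` dom j))
                   (coord j \o f \o param i).

(* df_x : T_xM -> T_{f(x)}N *)
Definition differential (f : M -> N) (x : M) : 'rV[R]_n -> 'rV[R]_m :=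
  'd (coord (chart_at (f x)) \o f \o param (chart_at x))
     (coord (chart_at x) x).

End Maps.

Section Curves.
Context (R : realType) (n : nat) (M : manifold R n).

(* Smooth curves on [0, 1] are exactly the restrictions to [0, 1] of smooth
   curves defined on the whole line. *)
Definition smooth_curve (c : R -> M) : Prop :=
  continuous c /\
  forall j, smooth_on ((c : R^o -> M) @^-1` dom j) (coord j \o c).

Definition velocity (c : R -> M) (t : R) : 'rV[R]_n :=
  derive1 (coord (chart_at (c t)) \o c) t.

(* The tangent vector at [param i u] with components [v] in the chart [i]. *)
Definition tangent_of (i : atlas M) (u v : 'rV[R]_n) : 'rV[R]_n :=
  'd (coord (chart_at (param i u)) \o param i) u v.

End Curves.

(* [finsler_continuous] is continuity on TM, read in the charts of TM induced
   by those of M. *)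
Record finslerManifold (R : realType) (n : nat) := FinslerManifold {
  base :> manifold R n;
  finsler : base -> 'rV[R]_n -> R;
  finsler_ge0 : forall x v, 0 <= finsler x v;
  finsler_homo : forall x (l : R) v,
    0 <= l -> finsler x (l *: v) = l * finsler x v;
  finsler_triangle : forall x v w,
    finsler x (v + w) <= finsler x v + finsler x w;
  finsler_eq0 : forall x v, finsler x v = 0 -> v = 0;
  finsler_continuous : forall (i : atlas base) (p : 'rV[R]_n * 'rV[R]_n),
    (coord i @` dom i) p.1 ->
    {for p, continuous (fun q : 'rV[R]_n * 'rV[R]_n =>
       finsler (param i q.1) (tangent_of i q.1 q.2))} }.

Section FinslerDistance.
Context (R : realType) (n : nat) (M : finslerManifold R n).

Definition flength (c : R -> M) : \bar R :=
  (\int[lebesgue_measure]_(t in `[0%R, 1%R])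
     (finsler (c t) (velocity c t))%:E)%E.

Definition fdist (x y : M) : \bar R :=
  ereal_inf [set flength c | c in
    [set c : R -> M | [/\ smooth_curve c, c 0 = x & c 1 = y]]].

Definition forward_cauchy (x : nat -> M) : Prop :=
  forall e : R, 0 < e -> exists N : nat, forall i k : nat, (N <= i)%N ->
    (fdist (x i) (x (i + k)%N) < e%:E)%E.

Definition forward_complete : Prop :=
  forall x : nat -> M, forward_cauchy x -> exists l : M, x @ \oo --> l.

End FinslerDistance.

Definition similarity (R : realType) (n m : nat) (M : finslerManifold R n)
    (N : finslerManifold R m) (a : R) (f : M -> N) : Prop :=
  [/\ 0 < a, C1_map f &
      forall (x : M) (v : 'rV[R]_n),
        finsler (f x) (differential f x v) = a * finsler x v].

(* Isometry for the distances. A bijective similarity with a = 1 preserves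
   distances, but a distance-preserving bijection between C^0-Finsler manifolds
   need not be of class C^1: the pull-back of the Euclidean metric of the plane
   by the homeomorphism (r, t) |-> (r, t + p(r)) in polar coordinates, where
   p(r) = ln (1 + ln (1 + 1/r)), is a continuous Riemannian metric, but this
   homeomorphism is not differentiable at 0. *)
Definition isometric (R : realType) (n m : nat) (M : finslerManifold R n)
    (N : finslerManifold R m) : Prop :=
  exists h : M -> N, bijective h /\
    forall x y : M, fdist (h x) (h y) = fdist x y.

Section ModelSpace.
Context (R : realType) (n : nat).

Lemma Ck_cst (V W : normedModType R) k (U : set V) (w : W) :
  Ck k U (fun=> w).
Proof.
elim: k w => [|k IH] w /=; first by move=> x _; exact: cst_continuous.
split=> [x _|v]; first exact: differentiable_cst.
suff -> : (fun x : V => 'd (fun=> w) x v) = (fun=> 0) by exact: IH.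
by apply/funext => x; rewrite diff_cst.
Qed.

Lemma smooth_on_id (V : normedModType R) (U : set V) :
  smooth_on U (id : V -> V).
Proof.
case=> [|k] /=; first by move=> x _; exact: cvg_id.
split=> [x _|v]; first by case: (is_diff_id x).
suff -> : (fun x : V => 'd (id : V -> V) x v) = (fun=> v) by exact: Ck_cst.
by apply/funext => x; case: (is_diff_id x) => _ ->.
Qed.

Lemma rV_second_countable : @second_countable 'rV[R]_n.
Proof.
pose B (p : 'rV[rat]_n * nat) : set 'rV[R]_n :=
  ball (map_mx ratr p.1 : 'rV[R]_n) p.2.+1%:R^-1.
exists (range B); first exact: sub_countable (card_image_le _ _) (countableP _).
split=> [_ [p _ <-]|x A]; first exact: ball_open.
move=> /nbhs_ballP[e /= e0 eA].
have [k ke] : exists k : nat, k.+1%:R^-1 < e / 2 :> R.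
  have /cvgr_lt := @cvg_harmonic R.
  move=> /(_ (e / 2)) []; first by rewrite divr_gt0.
  by move=> N _ /(_ N (leqnn _)) /= h; exists N.
have qP i : {q : rat | `|x ord0 i - ratr q| < k.+1%:R^-1}.
  apply: cid; have k0 : (0 : R) < k.+1%:R^-1 by rewrite invr_gt0.
  have : x ord0 i - k.+1%:R^-1 < x ord0 i + k.+1%:R^-1.
    by rewrite (lt_trans (y := x ord0 i)) ?ltrDl// gtrBl.
  move=> /rat_in_itvoo[q]; rewrite in_itv/= => /andP[q1 q2].
  by exists q; rewrite distrC ltr_distl q1 q2.
pose q : 'rV[rat]_n := \row_i projT1 (qP i).
have Bx : ball (map_mx ratr q : 'rV[R]_n) k.+1%:R^-1 x.
  split=> [|i j]; first by rewrite invr_gt0.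
  by rewrite !mxE (ord1 i) /ball/= distrC; exact: projT2 (qP j).
exists (B (q, k)); first by split=> //; exists (q, k).
move=> y /= By; apply: eA; rewrite [e]splitr.
apply: (@ball_triangle _ _ (map_mx ratr q : 'rV[R]_n)).
  by apply: ball_sym; apply: le_ball Bx; exact: ltW.
by apply: le_ball By; exact: ltW.
Qed.

Lemma model_open (u : unit) : open ((fun _ : unit => @id 'rV[R]_n) u @` setT).
Proof. by rewrite image_id; exact: openT. Qed.

Lemma model_id_continuous (u : unit) (x : 'rV[R]_n) (A : set 'rV[R]_n) :
  A x -> {for x, continuous (@id 'rV[R]_n)}.
Proof. by move=> _; exact: cvg_id. Qed.

Definition model_manifold : manifold R n :=
  @Manifold R n 'rV[R]_n unit (fun=> setT) (fun=> id) (fun=> id) (fun=> tt)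
    (fun=> I) (fun=> openT) model_open (fun _ _ _ => erefl)
    (fun i x => @model_id_continuous i x _)
    (fun i x => @model_id_continuous i x _)
    (fun _ _ => @smooth_on_id _ _)
    (@norm_hausdorff _ _) rV_second_countable.

End ModelSpace.

Section TangentSpace.
Context (R : realType) (n : nat) (M : finslerManifold R n) (x : M).

Let i := chart_at x.
Let u := coord i x.

Lemma tangent_of_chart_at v : tangent_of i u v = v.
Proof.
have ix : dom i x by exact: chart_atP.
have ux : param i u = x by rewrite /u coordK.
have Uu : (coord i @` dom i) u by exists x.
rewrite /tangent_of ux -/i.
have df : differentiable (coord i \o param i) u.
  have [+ _] := @transition_smooth _ _ M i i 1; apply.
  by rewrite setIid.
have eqf : \forall w \near u, (coord i \o param i) w = id w.
  have : nbhs u (coord i @` dom i) by apply: open_nbhs_nbhs; split=> //; exact: img_open.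
  by apply: filterS => w [y iy <-] /=; rewrite coordK.
rewrite -deriveE//.
by rewrite (near_eq_derive _ eqf) derive_id.
Qed.

Lemma finsler_fibre_continuous : continuous (finsler x).
Proof.
have ix : dom i x by exact: chart_atP.
have ux : param i u = x by rewrite /u coordK.
move=> v.
have -> : finsler x = (fun q : 'rV[R]_n * 'rV[R]_n =>
    finsler (param i q.1) (tangent_of i q.1 q.2)) \o (fun w => (u, w)).
  by apply/funext => w /=; rewrite tangent_of_chart_at ux.
apply: (@continuous_comp _ _ _ (fun w : 'rV[R]_n => (u, w))).
  have cu : (fun _ : 'rV[R]_n => u) @ v --> u by exact: cst_continuous.
  have cv : (fun w : 'rV[R]_n => w) @ v --> v by exact: cvg_id.
  exact: (cvg_pair cu cv).
by apply: (@finsler_continuous _ _ M i (u, v)) => /=; exists x.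
Qed.

Lemma tangent_finsler_continuous (j : atlas (model_manifold R n))
    (p : 'rV[R]_n * 'rV[R]_n) : (coord j @` dom j) p.1 ->
  {for p, continuous (fun q : 'rV[R]_n * 'rV[R]_n =>
    finsler x (@tangent_of _ _ (model_manifold R n) j q.1 q.2))}.
Proof.
move=> _.
have -> : (fun q : 'rV[R]_n * 'rV[R]_n =>
    finsler x (@tangent_of _ _ (model_manifold R n) j q.1 q.2)) =
    finsler x \o snd.
  apply/funext => q /=; congr finsler.
  by rewrite /tangent_of/=; case: (is_diff_id q.1) => _ ->.
apply: continuous_comp; first exact: cvg_snd.
exact: finsler_fibre_continuous.
Qed.

(* (T_xM, F_x), the vector space T_xM with the constant norm F_x *)
Definition tangent_finsler : finslerManifold R n :=
  @FinslerManifold R n (model_manifold R n) (fun=> finsler x)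
    (fun=> finsler_ge0 x) (fun=> finsler_homo x) (fun=> finsler_triangle x)
    (fun _ v => @finsler_eq0 _ _ M x v) tangent_finsler_continuous.

End TangentSpace.

(* Main.v *)
(* It suffices to treat a bijection g of M multiplying the Finsler distance d by
   q < 1: a contracting similarity is injective, because for large k the map f^k
   sends a curve joining two points of a fibre to a loop in a chart ball, and
   contracting this loop lifts, rel endpoints, to a homotopy to a constant curve;
   completeness gives the lifts, hence also surjectivity. By completeness g has a
   fixed point p. For u, v near the coordinates of p, d(u, v) = F_p(v - u) +
   o(|v - u|) since F is continuous, so the rescaled charts g^-k (p + q^k v) of
   M tend, along an ultrafilter, to a surjective map T_pM -> M preserving
   distances. Then M has dilations of every ratio around every point x, and the
   same argument applied to those gives M = T_xM. Only infinitesimal properties of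
   f are used: two functions on a curve are compared by their right Dini
   derivatives, so that no C^1 curve ever has to be approximated by smooth ones. *)

From HB Require Import structures.
From mathcomp Require Import all_boot all_order all_algebra.
From mathcomp Require Import all_classical all_reals all_analysis.
From mathcomp Require Import ring lra.
Require Import Defs.

Set Implicit Arguments.
Unset Strict Implicit.
Unset Printing Implicit Defensive.

Import Order.TTheory GRing.Theory Num.Theory.
Import numFieldNormedType.Exports.

Local Open Scope classical_set_scope.
Local Open Scope ring_scope.

(** * Functions of class C^k *)

(** For a ratio [a > 1] injectivity has to be assumed: doubling on the circle R/Z is a similarity of
    ratio 2, and the circle is not a Minkowski space. For [a < 1] iteration shrinks any given curve
    into a chart ball, where loops contract; that is what makes injectivity provable there.

    Three obstacles shape the details. [fdist] is an infimum over smooth curves, a class that a C^1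
    map does not preserve. The norms F_x are only continuous, so the triangle inequality and
    homogeneity do the work of derivatives. The distance is not symmetric, so every Cauchy or
    convergence argument is arranged to use forward distances, whose balls turn out to form
    neighbourhood bases.

    The blow-up at the fixed point yields only a distance-preserving bijection, with no
    differentiability. Since the second blow-up, at an arbitrary point, uses dilations transported
    by that bijection, the tangent cone argument is formulated for maps that merely scale the
    distance. *)

Section DiffLocal.
Context (R : realType) (V W : normedModType R).
Implicit Types (f g : V -> W) (x : V).

Lemma diff_epsP f x (df : {linear V -> W}) : continuous df ->
  (forall e : R, 0 < e ->
    \forall h \near (0 : V), `|f (h + x) - f x - df h| <= e * `|h|) ->
  differentiable f x /\ 'd f x = df :> (V -> W).
Proof.
move=> cdf ef.
have fE : f \o shift x = cst (f x) + df +o_ (0 : V) id.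
  apply/eqaddoP => e e0 /=; have := ef e e0; apply: filterS => h.
  by rewrite /= opprD addrA.
have dfE := diff_unique cdf fE.
by split=> //; apply/diff_locallyP; rewrite dfE.
Qed.

Lemma diff_eps f x : differentiable f x -> forall e : R, 0 < e ->
  \forall h \near (0 : V), `|f (h + x) - f x - 'd f x h| <= e * `|h|.
Proof.
move=> /diff_locally/eqaddoP fE e e0; have := fE e e0; apply: filterS => h.
by rewrite /= opprD addrA.
Qed.

Lemma near_diff f g x : (\near x, f x = g x) -> differentiable f x ->
  differentiable g x /\ 'd g x = 'd f x :> (V -> W).
Proof.
move=> fg df; apply: diff_epsP => [|e e0]; first exact: diff_continuous.
have fgh : \forall h \near (0 : V), f (h + x) = g (h + x).
  by move: fg; rewrite (near_shift 0 x); apply: filterS => h; rewrite /= subr0.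
near=> h; rewrite -(near fgh h)// -(nbhs_singleton fg).
by near: h; exact: diff_eps.
Unshelve. all: by end_near. Qed.

Lemma diff_scale (f : V -> R) g x : differentiable f x -> differentiable g x ->
  differentiable (fun y => f y *: g y) x /\
  'd (fun y => f y *: g y) x =
    (fun v => f x *: 'd g x v + 'd f x v *: g x) :> (V -> W).
Proof.
move=> df dg.
have bil : bilinear_for (GRing.Scale.Law.clone _ _ *:%R _)
    (GRing.Scale.Law.clone _ _ *:%R _) (@GRing.scale R W).
  split=> [u' a u v|u' a u v] /=; first by rewrite scalerDl scalerA.
  by rewrite scalerDr !scalerA (mulrC u').
pose bM := bilinear_isBilinear.Build R R W W _ _ _ bil.
pose b : {bilinear R -> W -> W} := HB.pack (@GRing.scale R W) bM.
have bc : continuous (fun p : R * W => b p.1 p.2) by exact: scale_continuous.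
have dp : differentiable (fun y => (f y, g y)) x by exact: differentiable_pair.
have db := @differentiable_bilin _ _ _ _ b (f x, g x) bc.
rewrite (_ : (fun y => _) = (fun p : R * W => b p.1 p.2) \o (fun y => (f y, g y)))//.
split; first exact: differentiable_comp.
by rewrite diff_comp// diff_bilin// diff_pair.
Qed.

End DiffLocal.

Section CkClosure.
Context (R : realType).
Implicit Types (V W : normedModType R).

Lemma Ck_sub V W k (U U' : set V) (f : V -> W) :
  U' `<=` U -> Ck k U f -> Ck k U' f.
Proof.
move=> UU; elim: k f => [|k IH] f /=; first by move=> h x /UU; exact: h.
by case=> df dk; split=> [x /UU|v]; [exact: df|exact: IH].
Qed.

Lemma Ck_eq V W k (U : set V) (f g : V -> W) : open U ->
  (forall x, U x -> f x = g x) -> Ck k U f -> Ck k U g.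
Proof.
move=> oU; have near_eq (h1 h2 : V -> W) : (forall x, U x -> h1 x = h2 x) ->
    forall x, U x -> \near x, h1 x = h2 x.
  move=> h12 x Ux; have : nbhs x U by exact: open_nbhs_nbhs.
  by apply: filterS => y; exact: h12.
elim: k f g => [|k IH] f g fg /=.
  move=> cf x Ux; rewrite /prop_for /continuous_at -(fg _ Ux).
  by apply: cvg_trans (cf _ Ux); apply: near_eq_cvg; exact: near_eq Ux.
have dfg x : U x -> differentiable f x ->
    differentiable g x /\ 'd g x = 'd f x :> (V -> W).
  by move=> Ux; apply: near_diff; exact: near_eq Ux.
case=> df dk; split=> [x Ux|v].
  by have [] := dfg x Ux (df x Ux).
by apply: (IH _ _ _ (dk v)) => x Ux; have [_ ->] := dfg x Ux (df x Ux).
Qed.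

Lemma Ck_local V W k (U : set V) (f : V -> W) :
  (forall x, U x -> exists U', [/\ open U', U' x & Ck k U' f]) -> Ck k U f.
Proof.
elim: k f => [|k IH] f /= h.
  by move=> x /h[U' [_ U'x]]; exact.
split=> [x /h[U' [_ U'x [+ _]]]|v]; first exact.
by apply: IH => x /h[U' [oU' U'x [_ dk]]]; exists U'.
Qed.

Lemma Ck_continuous V W k (U : set V) (f : V -> W) : Ck k U f ->
  forall x, U x -> {for x, continuous f}.
Proof.
case: k => [|k] /=; first by [].
by case=> df _ x Ux; apply: differentiable_continuous; exact: df.
Qed.

Lemma Ck_pred V W k (U : set V) (f : V -> W) : Ck k.+1 U f -> Ck k U f.
Proof.
elim: k f => [|k IH] f; first exact: Ck_continuous.
by case=> df dk; split=> // v; exact: IH.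
Qed.

Lemma Ck_add V W k (U : set V) (f g : V -> W) : open U ->
  Ck k U f -> Ck k U g -> Ck k U (fun x => f x + g x).
Proof.
move=> oU; elim: k f g => [|k IH] f g /=.
  by move=> cf cg x Ux; apply: cvgD; [exact: cf|exact: cg].
case=> df dkf [dg dkg]; split=> [x Ux|v].
  by apply: differentiableD; [exact: df|exact: dg].
apply: (Ck_eq oU _ (IH _ _ (dkf v) (dkg v))) => x Ux.
by rewrite diffD//; [exact: df|exact: dg].
Qed.

Lemma Ck_scale V W k (U : set V) (f : V -> R) (g : V -> W) : open U ->
  Ck k U (f : V -> R^o) -> Ck k U g -> Ck k U (fun x => f x *: g x).
Proof.
move=> oU; elim: k f g => [|k IH] f g.
  by move=> cf cg x Ux; apply: cvgZ; [exact: cf|exact: cg].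
move=> kf kg; have [df dkf] := kf; have [dg dkg] := kg.
split=> [x Ux|v]; first by have [] := diff_scale (df _ Ux) (dg _ Ux).
apply: (Ck_eq oU _ (Ck_add oU (IH _ _ (Ck_pred kf) (dkg v))
  (IH _ _ (dkf v) (Ck_pred kg)))) => x Ux.
by have [_ ->] := diff_scale (df _ Ux) (dg _ Ux).
Qed.

Lemma continuous_line V (u w : V) : continuous (fun t : R^o => u + t *: w).
Proof.
by move=> t; apply: cvgD; [exact: cvg_cst|apply: cvgZr_tmp; exact: cvg_id].
Qed.

Lemma diff_line V (u w : V) (t : R^o) :
  differentiable (fun t : R^o => u + t *: w) t /\
  'd (fun t : R^o => u + t *: w) t = (fun v => v *: w) :> (R^o -> V).
Proof.
have dl : differentiable (fun t : R^o => t *: w) t.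
  by apply: differentiableZl; case: (is_diff_id t).
split; first by apply: differentiableD.
apply/funext => v; rewrite diffD//= diff_cst (@diffZl R R^o V id)//= add0r.
by case: (is_diff_id t) => _ ->.
Qed.

(** The derivative is a directional derivative of [g] composed with the same line, so the induction
    closes without a C^k chain rule for general inner maps. *)
Lemma Ck_comp_line V W k (U : set V) (g : V -> W) (u w : V) : open U ->
  Ck k U g ->
  Ck k [set t : R^o | U (u + t *: w)] (fun t : R^o => g (u + t *: w)).
Proof.
move=> oU; have oU' : open [set t : R^o | U (u + t *: w)].
  by apply: (open_comp _ oU) => t _; exact: continuous_line.
elim: k g => [|k IH] g.
  move=> cg t Ut; apply: (@continuous_comp _ _ _ (fun t : R^o => u + t *: w)).
    exact: continuous_line.
  exact: cg.
case=> dg dkg; have dc t (Ut : U (u + t *: w)) :=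
  differentiable_comp (diff_line u w t).1 (dg _ Ut).
split=> [t Ut|v]; first exact: dc.
apply: (Ck_eq oU' _ (Ck_scale oU' (Ck_cst k _ (v : R^o)) (IH _ (dkg w)))).
move=> t Ut; have -> : (fun t : R^o => g (u + t *: w)) = g \o (fun t => u + t *: w) by [].
rewrite (diff_comp (diff_line u w t).1 (dg _ Ut)).
by rewrite /= (diff_line u w t).2 linearZ.
Qed.

(** Since the inner map is scalar, the derivative in the direction [v] is ['d h x v] times ['d g 1]
    composed with [h]; both factors fall under the induction hypothesis or [Ck_pred]. *)
Lemma Ck_comp_scalar V W k (U : set V) (U' : set R^o) (g : R^o -> W)
    (h : V -> R^o) : open U -> (forall x, U x -> U' (h x)) ->
  Ck k U' g -> Ck k U h -> Ck k U (g \o h).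
Proof.
move=> oU UU; elim: k g => [|k IH] g.
  move=> cg ch x Ux; apply: continuous_comp; first exact: ch.
  by apply: cg; exact: UU.
move=> kg kh; have [dg dkg] := kg; have [dh dkh] := kh.
split=> [x Ux|v].
  by apply: differentiable_comp; [exact: dh|apply: dg; exact: UU].
apply: (Ck_eq oU _ (Ck_scale oU (dkh v) (IH _ (dkg 1) (Ck_pred kh)))).
move=> x Ux; rewrite (diff_comp (dh _ Ux) (dg _ (UU _ Ux))).
by rewrite /= -linearZ /= /GRing.scale /= mulr1.
Qed.

End CkClosure.

(** * A smooth step function, and right Dini derivatives *)

Section ScalarCalculus.
Context (R : realType).
Implicit Types (f g : R -> R) (x t : R).

Lemma is_derive1_comp f g x (df dg : R) :
  is_derive (g x) 1 f df -> is_derive x 1 g dg ->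
  is_derive x 1 (f \o g) (df * dg).
Proof.
move=> [fd fE] [gd gE]; apply: DeriveDef.
  apply/derivable1_diffP/differentiable_comp; first exact/derivable1_diffP.
  exact/derivable1_diffP.
by rewrite -derive1E derive1_comp// !derive1E fE gE.
Qed.

Lemma is_derive_diff f x (df : R) : is_derive x 1 f df ->
  differentiable (f : R^o -> R^o) x /\
  'd (f : R^o -> R^o) x = (fun v => v * df) :> (R -> R).
Proof.
move=> [fd fE]; split; first exact/derivable1_diffP.
by rewrite deriv1E// derive1E fE.
Qed.

Lemma diff_is_derive f x (df : R) : differentiable (f : R^o -> R^o) x ->
  'd (f : R^o -> R^o) x = (fun v => v * df) :> (R -> R) -> is_derive x 1 f df.
Proof.
move=> fd fE; apply: DeriveDef; first exact/derivable1_diffP.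
by rewrite -derive1E derive1E'// fE mul1r.
Qed.

Lemma is_derive_continuous f x (df : R) : is_derive x 1 f df ->
  {for x, continuous f}.
Proof. by move=> [fd _]; apply/differentiable_continuous/derivable1_diffP. Qed.

(* The index [m] makes the family stable under differentiation. *)
Definition flat (m : nat) t : R :=
  if 0 < t then t^-1 ^+ m * expR (- t^-1) else 0.

Lemma flat_ge0 m t : 0 <= flat m t.
Proof.
rewrite /flat; case: ifPn => // t0.
by rewrite mulr_ge0 ?expR_ge0// exprn_ge0// invr_ge0 ltW.
Qed.

(** The term of degree m+2 of the exponential series beats [t^-1 ^+ m] with a factor [t ^+ 2] to
    spare. The quadratic bound makes the derivative of [flat m] vanish at 0. *)
Lemma flat_le_sqr m t : flat m t <= (m.+2)`!%:R * t ^+ 2.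
Proof.
rewrite /flat; case: ifPn => [t0|_]; last by rewrite mulr_ge0 ?sqr_ge0.
have u0 : 0 < t^-1 by rewrite invr_gt0.
have := @expR_ge1Dxn R t^-1 m.+1 (ltW u0).
move=> /(le_trans (ler_wpDl ler01 (lexx _))).
rewrite ler_pdivrMr ?ltr0n ?fact_gt0// => h.
rewrite expRN ler_pdivrMr ?expR_gt0//.
have -> : t^-1 ^+ m = t^-1 ^+ m.+2 * t ^+ 2.
  by rewrite -addn2 exprD -mulrA -exprMn mulVf ?expr1n ?mulr1// gt_eqF.
rewrite [leRHS]mulrAC ler_wpM2r ?sqr_ge0//.
by rewrite mulrC.
Qed.

Lemma is_derive_flat m t :
  is_derive t 1 (flat m) (flat m.+2 t - m%:R * flat m.+1 t).
Proof.
have [t0|t0|->] := ltgtP t 0.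
- have -> : flat m.+2 t - m%:R * flat m.+1 t = 0.
    by rewrite /flat ltNge (ltW t0)/= mulr0 subr0.
  have d0 : is_derive t 1 (cst 0 : R -> R) 0 by exact: is_derive_cst.
  apply: near_eq_is_derive d0.
  near=> s; rewrite /flat ltNge ltW//.
  by near: s; exact: lt_nbhsl.
- pose h (u : R) := u ^+ m * expR (- u).
  have t1 : t != 0 by rewrite gt_eqF.
  have dh (u : R) : is_derive u 1 h (m%:R * u ^+ m.-1 * expR (- u) - u ^+ m * expR (- u)).
    have dN : is_derive u 1 (fun u : R => - u) (- 1).
      exact: is_deriveNid.
    have dE : is_derive u 1 (expR \o (fun u : R => - u)) (expR (- u) * - 1).
      exact: is_derive1_comp.
    have dX : is_derive u 1 (fun u : R => u ^+ m) (m%:R * u ^+ m.-1).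
      apply: DeriveDef; first exact: exprn_derivable.
      by rewrite -derive1E exp_derive1.
    apply: is_derive_eq (is_deriveM dX dE) _.
    by rewrite /GRing.scale /=; ring.
  have dV : is_derive t 1 (fun s : R => s^-1) (- t^-1 ^+ 2).
    apply: is_derive_eq (@is_deriveV R id t 1 1 t1 (is_derive_id _ _)) _.
    by rewrite /GRing.scale /= mulr1 exprVn.
  have dF : is_derive t 1 (h \o (fun s : R => s^-1))
      (flat m.+2 t - m%:R * flat m.+1 t).
    apply: is_derive_eq (is_derive1_comp (dh t^-1) dV) _.
    by rewrite /flat t0; case: (m) => [|k]; rewrite /= ?exprS; ring.
  apply: near_eq_is_derive dF.
  near=> s; rewrite /flat /h /= ifT//.
  by near: s; exact: lt_nbhsr.
- have -> : flat m.+2 0 - m%:R * flat m.+1 0 = 0.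
    by rewrite /flat ltxx mulr0 subr0.
  have f0 : flat m 0 = 0 by rewrite /flat ltxx.
  have [||df dE] := @diff_epsP R R^o R^o (flat m) 0 (\0 : {linear R^o -> R^o}).
  + exact: cst_continuous.
  + move=> e e0; near=> s; rewrite /= addr0 f0 !subr0.
    rewrite ger0_norm ?flat_ge0//; apply: (le_trans (flat_le_sqr _ _)).
    rewrite -real_normK ?num_real// expr2 mulrA ler_wpM2r//.
    rewrite -ler_pdivlMl ?ltr0n ?fact_gt0//.
    near: s; have := @nbhs0_le R R^o ((m.+2)`!%:R^-1 * e); apply.
    by rewrite mulr_gt0// invr_gt0 ltr0n fact_gt0.
  + apply: diff_is_derive => //; rewrite dE; apply/funext => v.
    by rewrite mulr0.
Unshelve. all: by end_near. Qed.

Lemma Ck_is_derive (k : nat) f g :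
  (forall t, is_derive t 1 f (g t)) -> Ck k setT (g : R^o -> R^o) ->
  Ck k.+1 setT (f : R^o -> R^o).
Proof.
move=> df kg; split=> [t _|v]; first by have [] := is_derive_diff (df t).
have kv : Ck k setT (fun t : R^o => (v : R) *: (g t : R^o)).
  exact: (Ck_scale openT (Ck_cst k setT (v : R^o)) kg).
apply: Ck_eq kv; first exact: openT.
by move=> t _; have [_ ->] := is_derive_diff (df t).
Qed.

Lemma smooth_flat m : smooth_on setT (flat m : R^o -> R^o).
Proof.
move=> k; elim: k m => [|k IH] m.
  by move=> t _; exact: (is_derive_continuous (is_derive_flat m t)).
apply: (Ck_is_derive (is_derive_flat m)).
apply: (Ck_eq openT _ (Ck_add openT (IH m.+2)
  (Ck_scale openT (Ck_cst k setT (- m%:R : R^o)) (IH m.+1)))) => t _.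
by rewrite /GRing.scale /= mulNr.
Qed.

(** Normalizes [flat 0] to the value 1 at 1. Then t |-> 1 - e1 * flat 0 t is decreasing, equals 1
    for t <= 0 and is at most 0 for t >= 1; applied twice it gives an increasing step from 0 to
    1. *)
Let e1 : R := expR 1.

Lemma e1_flat1 : e1 * flat 0 1 = 1.
Proof. by rewrite /flat ltr01 expr0 mul1r invr1 expRN mulfV// gt_eqF ?expR_gt0. Qed.

Lemma flat0_le s t : s <= t -> flat 0 s <= flat 0 t.
Proof.
move=> st; rewrite {1}/flat; case: ifPn => [s0|_]; last exact: flat_ge0.
have t0 : 0 < t by exact: lt_le_trans st.
by rewrite /flat t0 !expr0 !mul1r ler_expR lerN2 lef_pV2.
Qed.

(* Reparametrizing by [step], which is locally constant outside [[0, 1]], makes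
   smooth curves concatenable. *)
Definition step t : R := 1 - e1 * flat 0 (1 - e1 * flat 0 t).

Definition dstep t : R := e1 * flat 2 (1 - e1 * flat 0 t) * (e1 * flat 2 t).

Lemma step_le0 t : t <= 0 -> step t = 0.
Proof.
move=> t0; rewrite /step {2}/flat ltNge t0/= mulr0 subr0.
by rewrite e1_flat1 subrr.
Qed.

Lemma step_ge1 t : 1 <= t -> step t = 1.
Proof.
move=> t1; rewrite /step {1}/flat ltNge.
suff -> : 1 - e1 * flat 0 t <= 0 by rewrite mulr0 subr0.
by rewrite subr_le0 -e1_flat1 ler_wpM2l ?expR_ge0// flat0_le.
Qed.

Lemma step_itv t : 0 <= step t <= 1.
Proof.
rewrite /step subr_ge0 gerBl mulr_ge0 ?expR_ge0 ?flat_ge0// andbT.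
rewrite -e1_flat1 ler_wpM2l ?expR_ge0// flat0_le// e1_flat1 gerBl.
by rewrite mulr_ge0 ?expR_ge0 ?flat_ge0.
Qed.

Lemma dstep_ge0 t : 0 <= dstep t.
Proof. by rewrite /dstep !mulr_ge0 ?expR_ge0 ?flat_ge0. Qed.

Let is_derive_flat0 t : is_derive t 1 (fun s => 1 - e1 * flat 0 s) (- (e1 * flat 2 t)).
Proof.
have d0 : is_derive t 1 (flat 0) (flat 2 t).
  by apply: is_derive_eq (is_derive_flat 0 t) _; rewrite mul0r subr0.
have dz : is_derive t 1 (e1 \*: flat 0) (e1 *: flat 2 t).
  exact: is_deriveZ.
have dc : is_derive t 1 (cst 1 : R -> R) 0 by exact: is_derive_cst.
by apply: is_derive_eq (is_deriveB dc dz) _; rewrite sub0r.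
Qed.

Lemma is_derive_step t : is_derive t 1 step (dstep t).
Proof.
apply: is_derive_eq (is_derive1_comp (is_derive_flat0 _) (is_derive_flat0 t)) _.
by rewrite /dstep mulrNN.
Qed.

Lemma smooth_step : smooth_on setT (step : R^o -> R^o).
Proof.
move=> k.
have kf : Ck k setT ((fun s => 1 - e1 * flat 0 s) : R^o -> R^o).
  apply: (Ck_eq openT _ (Ck_add openT (Ck_cst k setT (1 : R^o))
    (Ck_scale openT (Ck_cst k setT (- e1 : R^o)) (smooth_flat 0 k)))) => t _.
  by rewrite /GRing.scale /= mulNr.
exact: (Ck_comp_scalar openT _ kf kf).
Qed.

Lemma FTC2_unit (s S : R -> R) : continuous s ->
  (forall t, 0 <= t <= 1 -> is_derive t 1 S (s t)) ->
  (\int[lebesgue_measure]_(t in `[0%R, 1%R]) (s t)%:E = (S 1 - S 0)%:E)%E.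
Proof.
move=> cs dS; rewrite EFinB; apply: continuous_FTC2 => //.
- exact: continuous_subspaceT.
- split.
  + move=> t; rewrite in_itv/= => /andP[t0 t1].
    by have [] := dS t; rewrite ?ltW.
  + apply: cvg_at_right_filter; apply: (is_derive_continuous (dS 0 _)).
    by rewrite lexx ler01.
  + apply: cvg_at_left_filter; apply: (is_derive_continuous (dS 1 _)).
    by rewrite lexx ler01.
- move=> t; rewrite in_itv/= => /andP[t0 t1].
  by rewrite derive1E; have [|_ ->] := dS t; rewrite ?ltW.
Qed.

Lemma primitive (s : R -> R) : continuous s ->
  exists S : R -> R, forall t, -1 < t -> is_derive t 1 S (s t).
Proof.
move=> cs; exists (fun x => (\int[lebesgue_measure]_(t in `[-1, x]) (s t))%R).
move=> t t1; have tt1 : t < t + 1 by rewrite ltrDl.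
have [||d E] := @continuous_FTC1_closed R s (-1) t (t + 1) tt1 _ t1.
- apply: continuous_compact_integrable; first exact: segment_compact.
  exact: continuous_subspaceT.
- exact: cs.
- by apply: DeriveDef => //; rewrite -derive1E.
Qed.

(** For each [e > 0] consider the times at which g t <= g 0 + e * t. The first hypothesis puts their
    supremum in the set, and the second one would push the set beyond a supremum smaller than 1. *)
Lemma dini_le g :
  (forall t, 0 < t <= 1 -> forall e, 0 < e ->
    \forall s \near t^'-, g t <= g s + e) ->
  (forall t, 0 <= t < 1 -> forall e, 0 < e ->
    \forall h \near 0^'+, g (t + h) <= g t + e * h) ->
  g 1 <= g 0.
Proof.
move=> gl gr; apply/ler_addgt0Pr => e e0.
pose A := [set t | 0 <= t <= 1 /\ g t <= g 0 + e * t].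
have A0 : A 0 by rewrite /A /= lexx ler01 mulr0 addr0.
have A1 : ubound A 1 by move=> t [/andP[]].
have hsA : has_sup A by split; [exists 0|exists 1].
have s0 : 0 <= sup A by exact: sup_upper_bound.
have s1 : sup A <= 1 by apply: ge_sup => //; exists 0.
have As : A (sup A).
  have [//|nA] := pselect (A (sup A)).
  have sp : 0 < sup A.
    by rewrite lt_neqAle s0 andbT; apply/eqP => s0E; apply: nA; rewrite -s0E.
  split; first by rewrite s0.
  apply/ler_addgt0Pr => r r0; have := gl (sup A).
  rewrite sp s1 => /(_ isT r r0) [d /= d0 hd].
  have [t At td] := sup_adherent d0 hsA.
  have ts : t < sup A.
    rewrite lt_neqAle sup_upper_bound// andbT.
    by apply/eqP => tE; apply: nA; rewrite -tE.
  have := hd t; rewrite /= distrC ltr0_norm ?subr_lt0// opprB ltrBlDl -ltrBlDr.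
  move=> /(_ td ts); have [_ gt] := At; move/le_trans; apply.
  by rewrite lerD2r (le_trans gt)// lerD2l ler_wpM2l// ltW.
have [sE|s1'] := eqVneq (sup A) 1.
  by move: As; rewrite sE => -[_]; rewrite mulr1.
have {}s1 : sup A < 1 by rewrite lt_neqAle s1' s1.
have := gr (sup A); rewrite s0 s1 => /(_ isT e e0) [d /= d0 hd].
pose h := Num.min (d / 2) (1 - sup A).
have h0 : 0 < h by rewrite lt_min divr_gt0//= subr_gt0.
have hd' : `|0 - h| < d.
  rewrite sub0r normrN gtr0_norm// gt_min; apply/orP; left.
  by rewrite ltr_pdivrMr// ltr_pMr// ltr1n.
have := hd h hd' h0 => gh.
have : A (sup A + h).
  split.
    apply/andP; split; first exact: addr_ge0 s0 (ltW h0).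
    by rewrite -lerBrDl ge_min lexx orbT.
  apply: (le_trans gh); have [_] := As; rewrite mulrDr addrA.
  by rewrite -(lerD2r (e * h)).
by move/(sup_upper_bound hsA); rewrite gerDl leNgt h0.
Qed.

Lemma dini_le_int g (s : R -> R) : continuous s ->
  (forall t, 0 < t <= 1 -> forall e, 0 < e ->
    \forall r \near t^'-, g t <= g r + e) ->
  (forall t, 0 <= t < 1 -> forall e, 0 < e ->
    \forall h \near 0^'+, g (t + h) <= g t + (s t + e) * h) ->
  ((g 1 - g 0)%:E <= \int[lebesgue_measure]_(t in `[0%R, 1%R]) (s t)%:E)%E.
Proof.
move=> cs gl gr; have [S dS] := primitive cs.
have dS01 t : 0 <= t <= 1 -> is_derive t 1 S (s t).
  by case/andP=> t0 _; apply: dS; apply: lt_le_trans t0; rewrite ltrN10.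
rewrite (FTC2_unit cs dS01).
have cS t : 0 <= t -> {for t, continuous S}.
  by move=> t0; apply: is_derive_continuous (dS t _); apply: lt_le_trans t0; rewrite ltrN10.
suff : g 1 - S 1 <= g 0 - S 0 by rewrite lee_fin; lra.
apply: (@dini_le (fun t => g t - S t)).
  move=> t t01 e e0; have e20 : 0 < e / 2 by rewrite divr_gt0.
  have t0 : 0 <= t by case/andP: t01 => /ltW.
  have cl : S r @[r --> t^'-] --> S t by apply: cvg_at_left_filter; exact: cS.
  near=> r; have gtr : g t <= g r + e / 2 by near: r; exact: gl.
  have : `|S t - S r| < e / 2.
    by near: r; move/cvgrPdist_lt: cl; exact.
  by rewrite ltr_norml => /andP[h1 h2]; lra.
move=> t t01 e e0; have e20 : 0 < e / 2 by rewrite divr_gt0.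
have t0 : -1 < t by case/andP: t01 => t0 _; apply: lt_le_trans t0; rewrite ltrN10.
have [ds dsE] := is_derive_diff (dS t t0).
have := diff_eps ds e20; rewrite dsE /= => dS0.
near=> h; have gh : g (t + h) <= g t + (s t + e / 2) * h.
  by near: h; exact: gr.
have h0 : 0 < h by [].
have : `|S (h + t) - S t - h * s t| <= e / 2 * `|h|.
  by near: h; move: dS0; apply: filterS => h Hh _.
rewrite (gtr0_norm h0) (addrC h) ler_norml => /andP[h1 h2].
have := mulr_gt0 e0 h0; lra.
Unshelve. all: by end_near. Qed.

End ScalarCalculus.

(** * Curves in a manifold *)

Section ManifoldCharts.
Context (R : realType) (n : nat) (M : manifold R n).
Implicit Types (i j : atlas M) (A : set M).

Lemma paramK i (u : 'rV[R]_n) : (coord i @` dom i) u -> coord i (param i u) = u.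
Proof. by move=> [x ix <-]; rewrite coordK. Qed.

Lemma param_dom i (u : 'rV[R]_n) : (coord i @` dom i) u -> dom i (param i u).
Proof. by move=> [x ix <-]; rewrite coordK. Qed.

Lemma img_coord i (x : M) : dom i x -> (coord i @` dom i) (coord i x).
Proof. by move=> ix; exists x. Qed.

Lemma open_coord_image i A : open A -> open (coord i @` (dom i `&` A)).
Proof.
move=> oA; rewrite openE => _ [x [ix Ax] <-].
have ui := img_coord ix.
have nA : nbhs (param i (coord i x)) A by rewrite coordK//; exact: open_nbhs_nbhs.
have nI : nbhs (coord i x) (coord i @` dom i).
  by apply: open_nbhs_nbhs; split=> //; exact: img_open.
have := param_continuous ui nA; rewrite /interior; move: nI.
apply: filterS2 => w [y iy <-]; rewrite /= coordK// => Ay.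
by exists y.
Qed.

Lemma nbhs_dom i (x : M) : dom i x -> nbhs x (dom i).
Proof. by move=> ix; apply: open_nbhs_nbhs; split=> //; exact: dom_open. Qed.

Lemma nbhs_img i (u : 'rV[R]_n) : (coord i @` dom i) u ->
  nbhs u (coord i @` dom i).
Proof. by move=> ui; apply: open_nbhs_nbhs; split=> //; exact: img_open. Qed.

Lemma diff_transition i j (x : M) : dom i x -> dom j x ->
  differentiable (coord j \o param i) (coord i x).
Proof.
move=> ix jx; have [+ _] := @transition_smooth _ _ M i j 1%N; apply.
by exists x.
Qed.

End ManifoldCharts.

Section SmoothCurves.
Context (R : realType) (n : nat) (M : manifold R n).
Implicit Types (c : R -> M) (i j : atlas M).

Lemma open_curve_dom c j : continuous c -> open ((c : R^o -> M) @^-1` dom j).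
Proof. by move=> cc; apply: open_comp => [t _|]; [exact: cc|exact: dom_open]. Qed.

Lemma smooth_curve_diff c i (t : R) : smooth_curve c -> dom i (c t) ->
  differentiable ((coord i \o c) : R^o -> 'rV[R]_n) t.
Proof. by move=> [_ sc] it; have [+ _] := sc i 1%N; apply. Qed.

Lemma smooth_curve_local c :
  (forall t : R, exists c', [/\ smooth_curve c' & \forall s \near t, c s = c' s]) ->
  smooth_curve c.
Proof.
move=> h; have cc : continuous c.
  move=> t; have [c' [[cc' _] cE]] := h t.
  rewrite /continuous_at (nbhs_singleton cE); apply: cvg_trans (cc' t).
  by apply: near_eq_cvg; apply: filterS cE.
split=> // j k; apply: Ck_local => t jt.
have [c' [[cc' sc'] cE]] := h t.
exists ([set s | c s = c' s]^° `&` ((c' : R^o -> M) @^-1` dom j)); split.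
- by apply: openI; [exact: open_interior|exact: open_curve_dom].
- by split; [exact: cE|rewrite /= -(nbhs_singleton cE)].
- apply: (@Ck_eq _ _ _ _ _ (coord j \o c')).
  + by apply: openI; [exact: open_interior|exact: open_curve_dom].
  + by move=> s [/interior_subset /= -> _].
  + by apply: Ck_sub (sc' j k) => s [].
Qed.

Lemma smooth_curve_comp c (h : R -> R) : smooth_curve c ->
  smooth_on setT (h : R^o -> R^o) -> smooth_curve (c \o h).
Proof.
move=> [cc sc] sh; have ch : continuous h by move=> t; exact: (sh 0%N).
have cch : continuous (c \o h).
  by move=> t; apply: continuous_comp; [exact: ch|exact: cc].
split=> // j k.
have oU := open_curve_dom (j := j) cch.
apply: (Ck_comp_scalar oU _ (sc j k)) => //.
by apply: Ck_sub (sh k) => t _.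
Qed.

Lemma smooth_curve_cst (x : M) : smooth_curve (fun=> x).
Proof.
split=> [t|j k]; first exact: cvg_cst.
exact: Ck_cst.
Qed.

Lemma velocity_near c c' (t : R) : (\forall s \near t, c s = c' s) ->
  velocity c t = velocity c' t.
Proof.
move=> cc; rewrite /velocity (nbhs_singleton cc) !derive1E.
by apply: near_eq_derive; apply: filterS cc => s /= ->.
Qed.

Lemma velocity_comp c (h : R -> R) (t dh : R) : smooth_curve c ->
  is_derive t 1 h dh -> velocity (c \o h) t = dh *: velocity c (h t).
Proof.
move=> sc h'; have [dh' hE] := is_derive_diff h'.
have dc := smooth_curve_diff sc (chart_atP (c (h t))).
pose g : R^o -> 'rV[R]_n := coord (chart_at (c (h t))) \o c.
have dg : differentiable g (h t) by [].
have dgh := differentiable_comp dh' dg.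
have E1 := derive1E' dgh.
have E2 := derive1E' dg.
have E3 := congr1 (@^~ (1 : R^o)) (diff_comp dh' dg).
transitivity ('d (g \o (h : R^o -> R^o)) t 1); first exact: E1.
rewrite [LHS]E3 /= hE mul1r.
transitivity (dh *: 'd g (h t) 1); last by congr (_ *: _); rewrite -[LHS]E2.
by rewrite -linearZ /= /GRing.scale /= mulr1.
Qed.

Lemma velocity_chart c i (t : R) : smooth_curve c -> dom i (c t) ->
  velocity c t = tangent_of i (coord i (c t)) (derive1 (coord i \o c) t).
Proof.
move=> sc it; have di := smooth_curve_diff sc it.
set j := chart_at (c t); have jt : dom j (c t) by exact: chart_atP.
have dT := diff_transition it jt.
rewrite /tangent_of coordK// -/j (derive1E' di) /velocity -/j.
have E : \forall s \near t, ((coord j \o param i) \o (coord i \o c)) s = (coord j \o c) s.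
  have := @open_nbhs_nbhs _ (t : R^o) ((c : R^o -> M) @^-1` dom i).
  move=> /(_ _)/filterS; apply; last by split=> //; apply: open_curve_dom; case: sc.
  by move=> s /= is'; rewrite coordK.
have dcomp := differentiable_comp di dT.
have [dj djE] := near_diff E dcomp.
have E3 := congr1 (@^~ (1 : R^o)) djE.
have E4 := congr1 (@^~ (1 : R^o)) (diff_comp di dT).
exact: etrans (derive1E' dj) (etrans E3 E4).
Qed.

End SmoothCurves.

(** * Speed, length, concatenation of curves and the triangle inequality *)

Section Speed.
Context (R : realType) (n : nat) (M : finslerManifold R n).
Implicit Types (c : R -> M) (i j : atlas M) (x y z : M).

Definition speed c (t : R) : R := finsler (c t) (velocity c t).

Definition chart_finsler i (u v : 'rV[R]_n) : R :=
  finsler (param i u) (tangent_of i u v).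

Lemma finsler0 x : finsler x 0 = 0.
Proof. by rewrite -(scale0r (0 : 'rV[R]_n)) finsler_homo// mul0r. Qed.

Lemma chart_finslerZ i u (l : R) v : 0 <= l ->
  chart_finsler i u (l *: v) = l * chart_finsler i u v.
Proof. by move=> l0; rewrite /chart_finsler /tangent_of linearZ finsler_homo. Qed.

Lemma chart_finsler_at x v :
  chart_finsler (chart_at x) (coord (chart_at x) x) v = finsler x v.
Proof. by rewrite /chart_finsler tangent_of_chart_at coordK//; exact: chart_atP. Qed.

Lemma continuous_chart_finsler i (p : 'rV[R]_n * 'rV[R]_n) :
  (coord i @` dom i) p.1 ->
  {for p, continuous (fun q : 'rV[R]_n * 'rV[R]_n => chart_finsler i q.1 q.2)}.
Proof. exact: finsler_continuous. Qed.

Lemma speed_ge0 c t : 0 <= speed c t.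
Proof. exact: finsler_ge0. Qed.

Lemma speed_chart c i (t : R) : smooth_curve c -> dom i (c t) ->
  speed c t = chart_finsler i (coord i (c t)) (derive1 (coord i \o c) t).
Proof.
move=> sc it; rewrite /chart_finsler coordK//.
by rewrite -velocity_chart.
Qed.

Lemma continuous_speed c : smooth_curve c -> continuous (speed c).
Proof.
move=> sc t; pose i := chart_at (c t).
have it : dom i (c t) by exact: chart_atP.
pose g : R^o -> 'rV[R]_n := coord i \o c.
have oU := open_curve_dom (j := i) sc.1.
have Ut : nbhs (t : R^o) ((c : R^o -> M) @^-1` dom i) by exact: open_nbhs_nbhs.
have E : \forall s \near t, chart_finsler i (g s) (derive1 g s) = speed c s.
  by apply: filterS Ut => s is'; rewrite (speed_chart sc is').
rewrite /continuous_at -(nbhs_singleton E).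
have cg : {for (t : R^o), continuous g}.
  by apply: differentiable_continuous; exact: smooth_curve_diff.
have cdg : {for (t : R^o), continuous (derive1 g)}.
  have [_ /(_ 1) cd] := sc.2 i 1%N.
  have E' : \forall s \near (t : R^o), 'd g s 1 = derive1 g s.
    apply: filterS Ut => s is'; rewrite -derive1E'//.
    exact: smooth_curve_diff.
  have cdt : 'd g s 1 @[s --> (t : R^o)] --> derive1 g t.
    by rewrite -(nbhs_singleton E'); exact: (cd t it).
  apply: cvg_trans cdt; apply: near_eq_cvg.
  by apply: filterS E' => s.
have cp : (fun s : R^o => (g s, derive1 g s)) @ (t : R^o) --> (g t, derive1 g t).
  exact: (cvg_pair cg cdg).
have cF := @continuous_chart_finsler i (g t, derive1 g t) (img_coord it).
apply: cvg_trans (cvg_comp _ _ cp cF).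
by apply: near_eq_cvg; apply: filterS E => s.
Qed.

Lemma speed_near c c' (t : R) : (\forall s \near t, c s = c' s) ->
  speed c t = speed c' t.
Proof.
by move=> cc; rewrite /speed (velocity_near cc) (nbhs_singleton cc).
Qed.

Lemma speed_comp c (h : R -> R) (t dh : R) : smooth_curve c -> 0 <= dh ->
  is_derive t 1 h dh -> speed (c \o h) t = dh * speed c (h t).
Proof.
by move=> sc dh0 h'; rewrite /speed (velocity_comp sc h') finsler_homo.
Qed.

(** From here on lengths are increments of a primitive [S] of the speed, which also measures the
    length of every piece of the curve. *)
Lemma flength_primitive c : smooth_curve c -> exists S : R -> R,
  (forall t : R, -1 < t -> is_derive t 1 S (speed c t)) /\
  flength c = (S 1 - S 0)%:E.
Proof.
move=> sc; have [S dS] := primitive (continuous_speed sc).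
exists S; split=> //; apply: FTC2_unit; first exact: continuous_speed.
by move=> t /andP[t0 _]; apply: dS; apply: lt_le_trans t0; rewrite ltrN10.
Qed.

Lemma flength_ge0 c : (0 <= flength c)%E.
Proof.
by apply: integral_ge0 => t _; rewrite lee_fin; exact: speed_ge0.
Qed.

Lemma fdist_ge0 x y : (0 <= fdist x y)%E.
Proof. by apply: le_ereal_inf_tmp => _ [c _ <-]; exact: flength_ge0. Qed.

Lemma fdist_le c : smooth_curve c -> (fdist (c 0%R) (c 1%R) <= flength c)%E.
Proof. by move=> sc; apply: ereal_inf_lbound; exists c. Qed.

Lemma fdistxx x : fdist x x = 0%E.
Proof.
apply/eqP; rewrite eq_le fdist_ge0 andbT.
apply: le_trans (fdist_le (smooth_curve_cst x)) _.
rewrite /flength integral0_eq// => t _; congr EFin.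
have -> : velocity (fun=> x) t = 0; last exact: finsler0.
exact: (@derive1_cst R 'rV[R]_n).
Qed.

(** The factor 3 leaves a pause: both reparametrized pieces are at rest on [1/3, 2/3], so at the
    switching time 1/2 either formula is valid on a whole neighbourhood and smoothness is a local
    matter. *)
Definition concat_curve c1 c2 (t : R) : M :=
  if t <= 2^-1 then c1 (step (3 * t)) else c2 (step (3 * t - 2)).

Lemma concat_curveE c1 c2 (t : R) : c1 1 = c2 0 ->
  (t < 2 / 3 -> concat_curve c1 c2 t = c1 (step (3 * t))) /\
  (1 / 3 < t -> concat_curve c1 c2 t = c2 (step (3 * t - 2))).
Proof.
move=> cE; rewrite /concat_curve; case: ifPn; rewrite -?ltNge => t2; split=> t3 //.
  by rewrite step_ge1 ?step_le0//; lra.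
by rewrite [in RHS]step_ge1 ?step_le0//; lra.
Qed.

Lemma smooth_affine_step (a b : R) :
  smooth_on setT ((fun t => step (a * t + b)) : R^o -> R^o).
Proof.
move=> k.
have kl := @Ck_comp_line R R^o R^o k setT (@step R : R^o -> R^o) b a openT
  (@smooth_step R k).
have kl' := @Ck_sub R R^o R^o k _ setT _ (fun _ _ => I) kl.
apply: (@Ck_eq R R^o R^o k setT _ _ openT _ kl') => t _.
by congr (step _); rewrite [LHS]addrC; congr (_ + _); exact: mulrC.
Qed.

Lemma is_derive_affine_step (a b t : R) :
  is_derive t 1 (fun t => step (a * t + b)) (dstep (a * t + b) * a).
Proof.
have dl : is_derive t 1 (fun t => a * t + b) a.
  have d1 : is_derive t 1 (a \*: (id : R -> R)) (a *: 1) by exact: is_deriveZ.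
  have d2 : is_derive t 1 (cst b : R -> R) 0 by exact: is_derive_cst.
  apply: is_derive_eq (is_deriveD d1 d2) _.
  by rewrite addr0 /GRing.scale /= mulr1.
exact: (is_derive1_comp (is_derive_step _) dl).
Qed.

Lemma concat_curve_cases c1 c2 (t : R) : c1 1 = c2 0 ->
  (t < 2 / 3 /\ \forall s \near t, concat_curve c1 c2 s = (c1 \o (fun s => step (3 * s + 0))) s) \/
  (1 / 3 < t /\ \forall s \near t, concat_curve c1 c2 s = (c2 \o (fun s => step (3 * s + - 2))) s).
Proof.
move=> cE; have [t2|t2] := ltP t (1 / 2); [left|right].
  split; first by lra.
  have : t < 2 / 3 by lra.
  move/lt_nbhsl; apply: filterS => s s3.
  have [E _] := concat_curveE s cE.
  by rewrite (E s3) /comp addr0.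
split; first by lra.
have : 1 / 3 < t by lra.
move/lt_nbhsr; apply: filterS => s s3.
by have [_ E] := concat_curveE s cE; rewrite (E s3).
Qed.

Lemma smooth_concat c1 c2 : smooth_curve c1 -> smooth_curve c2 -> c1 1 = c2 0 ->
  smooth_curve (concat_curve c1 c2).
Proof.
move=> s1 s2 cE; apply: smooth_curve_local => t.
have [[_ E]|[_ E]] := concat_curve_cases t cE; eexists; split; try exact: E.
  exact: smooth_curve_comp s1 (@smooth_affine_step 3 0).
exact: smooth_curve_comp s2 (@smooth_affine_step 3 (- 2)).
Qed.

Lemma dstep_out (t : R) : t <= 0 \/ 1 <= t -> dstep t = 0.
Proof.
rewrite /dstep => -[t0|t1].
  by rewrite [in X in _ * X]/flat ltNge t0/= mulr0 mulr0.
have -> : flat 2 (1 - expR 1 * flat 0 t) = 0; last by rewrite mulr0 mul0r.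
rewrite {1}/flat ltNge; suff -> : 1 - expR 1 * flat 0 t <= 0 by [].
rewrite subr_le0; apply: le_trans (_ : expR 1 * flat 0 1 <= _).
  by rewrite (e1_flat1 R).
by rewrite ler_wpM2l ?expR_ge0// flat0_le.
Qed.

(** Each of [S1 \o h1] and [S2 \o h2] has derivative zero while the other piece is being run
    through, so their sum is a primitive of the speed of the concatenation. *)
Lemma flength_concat c1 c2 : smooth_curve c1 -> smooth_curve c2 -> c1 1 = c2 0 ->
  flength (concat_curve c1 c2) = (flength c1 + flength c2)%E.
Proof.
move=> s1 s2 cE; have [S1 [dS1 ->]] := flength_primitive s1.
have [S2 [dS2 ->]] := flength_primitive s2.
pose h1 (t : R) := step (3 * t + 0); pose h2 (t : R) := step (3 * t + - 2).
have gt1 (t : R) : -1 < step t.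
  by have /andP[+ _] := step_itv t; apply: lt_le_trans; rewrite ltrN10.
have d1 (t : R) : is_derive t 1 (S1 \o h1) (speed c1 (h1 t) * (dstep (3 * t + 0) * 3)).
  exact: (@is_derive1_comp R S1 h1 t _ _ (dS1 (h1 t) (gt1 _)) (is_derive_affine_step 3 0 t)).
have d2 (t : R) : is_derive t 1 (S2 \o h2) (speed c2 (h2 t) * (dstep (3 * t + - 2) * 3)).
  exact: (@is_derive1_comp R S2 h2 t _ _ (dS2 (h2 t) (gt1 _)) (is_derive_affine_step 3 (- 2) t)).
have d12 (t : R) : 0 <= t <= 1 ->
    is_derive t 1 ((S1 \o h1) \+ (S2 \o h2)) (speed (concat_curve c1 c2) t).
  move=> _; apply: is_derive_eq (is_deriveD (d1 t) (d2 t)) _.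
  have pos (s : R) : 0 <= dstep s * 3 by rewrite mulr_ge0// dstep_ge0.
  have [[t3 E]|[t3 E]] := concat_curve_cases t cE.
    have sp : speed (concat_curve c1 c2) t = dstep (3 * t + 0) * 3 * speed c1 (h1 t).
      exact: etrans (speed_near E) (speed_comp s1 (pos _) (is_derive_affine_step _ _ _)).
    rewrite sp (@dstep_out (3 * t + - 2)); last by left; lra.
    move: (dstep _) (speed c1 _) (speed c2 _) => d u v.
    by rewrite mul0r mulr0 addr0 mulrC.
  have sp : speed (concat_curve c1 c2) t = dstep (3 * t + - 2) * 3 * speed c2 (h2 t).
    exact: etrans (speed_near E) (speed_comp s2 (pos _) (is_derive_affine_step _ _ _)).
  rewrite sp (@dstep_out (3 * t + 0)); last by right; lra.
  move: (dstep _) (speed c1 _) (speed c2 _) => d u v.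
  by rewrite mul0r mulr0 add0r mulrC.
have cs := continuous_speed (smooth_concat s1 s2 cE).
rewrite /flength (FTC2_unit cs d12) -EFinD; congr EFin.
change (S1 (h1 1) + S2 (h2 1) - (S1 (h1 0) + S2 (h2 0)) =
  S1 1 - S1 0 + (S2 1 - S2 0)).
have -> : h1 1 = 1 by apply: step_ge1; lra.
have -> : h1 0 = 0 by apply: step_le0; lra.
have -> : h2 1 = 1 by apply: step_ge1; lra.
have -> : h2 0 = 0 by apply: step_le0; lra.
by ring.
Qed.

Lemma fdist_triangle y x z : (fdist x z <= fdist x y + fdist y z)%E.
Proof.
apply/lee_addgt0Pr => e e0; have e2 : 0 < e / 2 by rewrite divr_gt0.
have [->|fy] := eqVneq (fdist x y) +oo%E.
  by rewrite addye ?leey// gt_eqF// (lt_le_trans _ (fdist_ge0 _ _)).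
have [->|fz] := eqVneq (fdist y z) +oo%E.
  by rewrite addey ?leey// gt_eqF// (lt_le_trans _ (fdist_ge0 _ _)).
have fin (u v : M) : fdist u v != +oo%E -> fdist u v \is a fin_num.
  by move=> h; rewrite ge0_fin_numE ?fdist_ge0// ltey.
have [_ [c1 [s1 c10 c11] <-] l1] := lb_ereal_inf_adherent e2 (fin _ _ fy).
have [_ [c2 [s2 c20 c21] <-] l2] := lb_ereal_inf_adherent e2 (fin _ _ fz).
have cE : c1 1 = c2 0 by rewrite c11 c20.
have sc := smooth_concat s1 s2 cE.
have := fdist_le sc; rewrite flength_concat//.
have lt23 : 0 < 2 / 3 :> R by rewrite divr_gt0.
have lt13 : 1 / 3 < 1 :> R by rewrite ltr_pdivrMr// mul1r ltr1n.
have [-> // _] := concat_curveE 0 cE; have [_ -> //] := concat_curveE 1 cE.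
have -> : step (3 * 0 : R) = 0 by apply: step_le0; rewrite mulr0.
have -> : step (3 * 1 - 2 : R) = 1 by apply: step_ge1; lra.
rewrite c10 c21.
move/le_trans; apply; rewrite [in leRHS](splitr e) EFinD (addeACA (fdist x y)).
exact: leeD (ltW l1) (ltW l2).
Qed.

End Speed.

(** * Local comparison of the distance with a tangent norm *)

Lemma continuous_subr (R : realType) (V : normedModType R) (u : V) :
  continuous (fun v => v - u).
Proof. by move=> v; apply: cvgB; [exact: cvg_id|exact: cvg_cst]. Qed.

Lemma continuous_dist (R : realType) (V : normedModType R) (u : V) :
  continuous (fun v => `|v - u|).
Proof. by move=> v; apply: cvg_norm; exact: continuous_subr. Qed.

Section FinslerNorm.
Context (R : realType) (n : nat) (M : finslerManifold R n) (x : M).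
Notation V := 'rV[R]_n.
Implicit Types (u v w : V).

Lemma compact_rV_closed_ball (u : V) (r : R) : compact [set v : V | `|v - u| <= r].
Proof.
apply: bounded_closed_compact.
  exists (r + `|u|); split; first exact: num_real.
  move=> s rs v /= vr; apply: le_trans (ltW rs).
  by rewrite -lerBlDr; apply: le_trans (lerB_dist _ _) vr.
apply: (@closed_comp _ _ (fun v : V => `|v - u|) [set s | s <= r]).
  by move=> v _; exact: continuous_dist.
exact: closed_le.
Qed.

Lemma compact_rV_sphere : compact [set v : V | `|v| = 1].
Proof.
apply: bounded_closed_compact.
  by exists 1; split; [exact: num_real|move=> s s1 v /= ->; exact: ltW].
apply: (@closed_comp _ _ (fun v : V => `|v|) [set 1]); last exact: closed_eq.
by move=> v _; exact: norm_continuous.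
Qed.

Lemma unit_vector w : w != 0 -> w = `|w| *: (`|w|^-1 *: w) /\ `| `|w|^-1 *: w| = 1.
Proof.
move=> w0; have nw : `|w| != 0 by rewrite normr_eq0.
by split; [rewrite scalerA divff// scale1r|rewrite normrZ normfV normr_id mulVf].
Qed.

Lemma finsler_lower_bound : exists2 m : R, 0 < m & forall w, m * `|w| <= finsler x w.
Proof.
(* The unit sphere is empty exactly when n = 0; then every vector is 0 and any constant will do. *)
have [S0|/set0P S0] := eqVneq [set v : V | `|v| = 1] set0.
  exists 1 => // w; have [->|/unit_vector[_ w1]] := eqVneq w 0.
    by rewrite normr0 mulr0 finsler_ge0.
  by have : [set v : V | `|v| = 1] (`|w|^-1 *: w) by []; rewrite S0.
have cF : {within [set v : V | `|v| = 1], continuous (finsler x)}.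
  exact/continuous_subspaceT/finsler_fibre_continuous.
have [v /[!inE] v1 minv] := EVT_min_rV S0 compact_rV_sphere cF.
exists (finsler x v).
  rewrite lt_neqAle finsler_ge0 andbT eq_sym; apply/eqP => /finsler_eq0 v0.
  by move: v1; rewrite /= v0 normr0 => /esym/eqP; rewrite oner_eq0.
move=> w; have [->|/unit_vector[wE w1]] := eqVneq w 0.
  by rewrite normr0 mulr0 finsler_ge0.
rewrite [in leRHS]wE finsler_homo// mulrC ler_wpM2l// minv//.
by rewrite inE.
Qed.

Lemma finsler_upper_bound : exists2 C : R, 0 < C & forall w, finsler x w <= C * `|w|.
Proof.
have [S0|/set0P S0] := eqVneq [set v : V | `|v| = 1] set0.
  exists 1 => // w; have [->|/unit_vector[_ w1]] := eqVneq w 0.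
    by rewrite normr0 mulr0 finsler0.
  by have : [set v : V | `|v| = 1] (`|w|^-1 *: w) by []; rewrite S0.
have cF : {within [set v : V | `|v| = 1], continuous (finsler x)}.
  exact/continuous_subspaceT/finsler_fibre_continuous.
have [v /[!inE] v1 maxv] := EVT_max_rV S0 compact_rV_sphere cF.
exists (finsler x v).
  rewrite lt_neqAle finsler_ge0 andbT eq_sym; apply/eqP => /finsler_eq0 v0.
  by move: v1; rewrite /= v0 normr0 => /esym/eqP; rewrite oner_eq0.
move=> w; have [->|/unit_vector[wE w1]] := eqVneq w 0.
  by rewrite normr0 mulr0 finsler0.
rewrite [in leLHS]wE finsler_homo// mulrC ler_wpM2r// maxv//.
by rewrite inE.
Qed.

(** Continuity on the tangent bundle gives the estimate near each unit vector, compactness of the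
    sphere makes it uniform in the direction, and homogeneity extends it to all vectors. *)
Lemma chart_finsler_near (e : R) : 0 < e ->
  \forall u \near coord (chart_at x) x, forall w,
    `|chart_finsler (chart_at x) u w - finsler x w| <= e * `|w|.
Proof.
move=> e0; set i := chart_at x; set u0 := coord i x.
have ix : dom i x by exact: chart_atP.
have Uu0 := img_coord ix.
pose P (u w : V) := `|chart_finsler i u w - finsler x w| <= e.
have : \forall u \near u0, [set v : V | `|v| = 1] `<=` P u.
  apply: ((compact_near_coveringP _).1 compact_rV_sphere _ (nbhs u0) P) => v v1.
  have e2 : 0 < e / 2 by rewrite divr_gt0.
  have c1 := @continuous_chart_finsler _ _ _ i (u0, v) Uu0.
  have c2 := @finsler_fibre_continuous _ _ _ x v.
  have /cvgrPdist_lt/(_ _ e2)[[A B] /= [nA nB] AB] := c1.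
  near=> w u.
  rewrite /P; have := AB (u, w) _ => /=.
  have Au : A u by near: u.
  have Bw : B w by near: w.
  move=> /(_ (conj Au Bw)); rewrite chart_finsler_at => d1.
  have d2 : `|finsler x v - finsler x w| < e / 2.
    by near: w; move/cvgrPdist_lt: c2; exact.
  move: d1 d2; rewrite !ltr_norml ler_norml => /andP[? ?] /andP[? ?].
  by apply/andP; split; lra.
apply: filterS => u Pu w; have [->|/unit_vector[wE w1]] := eqVneq w 0.
  rewrite normr0 mulr0 finsler0 subr0 -(scale0r (0 : V)) chart_finslerZ// mul0r.
  by rewrite normr0.
rewrite [in leLHS]wE chart_finslerZ// finsler_homo// -mulrBr normrM normr_id.
by rewrite mulrC ler_wpM2r//; exact: Pu.
Unshelve. all: by end_near. Qed.

(** The triangle inequality bounds the growth of F_x along [g] by F_x of the increment, so only [g]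
    has to be differentiable, not the norm. *)
Lemma finsler_curve_dini (g : R^o -> V) (t : R) (u : V) (e : R) :
  differentiable g t -> 0 < e ->
  \forall h \near 0^'+,
    finsler x (g (t + h) - u) <= finsler x (g t - u) + (finsler x (derive1 g t) + e) * h.
Proof.
move=> dg e0; have [C C0 ub] := finsler_upper_bound.
have eC : 0 < e / C by rewrite divr_gt0.
have H := diff_eps dg eC.
have H1 : \forall h \near 0^'+, `|g (h + t) - g t - 'd g t h| <= e / C * `|h|.
  by move: H; apply: filterS => h + _.
near=> h; have h0 : 0 < h by [].
have : `|g (h + t) - g t - 'd g t h| <= e / C * `|h| by near: h.
have -> : 'd g t h = h *: derive1 g t.
  by rewrite derive1E'// -linearZ /= /GRing.scale /= mulr1.
rewrite (addrC h) (gtr0_norm h0); set r := (X in `|X|) => hr.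
have -> : g (t + h) - u = (g t - u) + (h *: derive1 g t + r).
  by rewrite /r; apply/rowP => k; rewrite !mxE; ring.
apply: (le_trans (finsler_triangle _ _ _)); rewrite lerD2l.
apply: (le_trans (finsler_triangle _ _ _)).
rewrite (finsler_homo _ _ (ltW h0)) mulrDl mulrC lerD2l.
apply: (le_trans (ub _)); rewrite -ler_pdivlMl//.
by apply: (le_trans hr); rewrite mulrA (mulrC C^-1).
Unshelve. all: by end_near. Qed.

End FinslerNorm.

Section LocalEstimates.
Context (R : realType) (n : nat) (M : finslerManifold R n).
Notation V := 'rV[R]_n.
Implicit Types (u v w : V) (i : atlas M).

(** The chart segment is run through by [step], so that the curve is defined on the whole line
    without ever leaving the segment. Its speed is at most [B * dstep t], which integrates to
    [B]. *)
Lemma fdist_segment i u v (B : R) :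
  (forall t : R, 0 <= t <= 1 -> (coord i @` dom i) (u + t *: (v - u))) ->
  (forall t : R, 0 <= t <= 1 -> chart_finsler i (u + t *: (v - u)) (v - u) <= B) ->
  (fdist (param i u) (param i v) <= B%:E)%E.
Proof.
move=> Ui FB; set w := v - u.
pose l (t : R^o) : V := u + t *: w.
have lU t : (coord i @` dom i) (l (step t)) by apply: Ui; exact: step_itv.
have ds (t : R) := is_derive_step t.
have cs : continuous (@step R) by move=> t; exact: is_derive_continuous (ds t).
pose c (t : R) : M := param i (l (step t)).
have cc : continuous c.
  move=> t; apply: (@continuous_comp _ _ _ (fun t => l (step t)) (param i)).
    apply: (@continuous_comp _ _ _ (@step R) l); first exact: cs.
    exact: continuous_line.
  exact: param_continuous.
have sc : smooth_curve c.
  split=> // j k.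
  have oD : open (coord i @` (dom i `&` dom j)).
    by apply: open_coord_image; exact: dom_open.
  have kl := Ck_comp_line u w oD (@transition_smooth _ _ M i j k).
  apply: (Ck_comp_scalar _ _ kl (Ck_sub _ (@smooth_step R k))).
  - exact: open_curve_dom.
  - move=> t jt; exists (c t); last exact: paramK.
    by split=> //; exact: param_dom.
  - by [].
have spE (t : R) : speed c t = dstep t * chart_finsler i (l (step t)) w.
  rewrite (speed_chart sc (param_dom (lU t))) paramK//.
  have -> : coord i \o c = l \o (@step R : R^o -> R^o).
    by apply/funext => s; rewrite /= paramK.
  have [dls dlE] := diff_line u w (step t).
  have [dst dstE] := is_derive_diff (ds t).
  have -> : derive1 (l \o (@step R : R^o -> R^o)) t = dstep t *: w.
    have E1 := derive1E' (differentiable_comp dst dls).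
    have E2 := congr1 (@^~ (1 : R^o)) (diff_comp dst dls).
    by rewrite [LHS]E1 [LHS]E2 /= dstE mul1r dlE.
  by rewrite chart_finslerZ ?dstep_ge0.
have [S [dS lE]] := flength_primitive sc.
have S01 : S 1 - S 0 <= B.
  pose G : R -> R := S \- (B \*: @step R).
  have dG (t : R) : 0 <= t -> is_derive t 1 G (speed c t - B * dstep t).
    move=> t0; have dz : is_derive t 1 (B \*: @step R) (B *: dstep t).
      exact: is_deriveZ.
    have dSt : is_derive t 1 S (speed c t).
      by apply: dS; apply: lt_le_trans t0; rewrite ltrN10.
    exact: (is_deriveB dSt dz).
  have : G 1 <= G 0.
    apply: (@ler0_derive1_nincr R G 0 1); rewrite ?ler01 ?lexx//.
    - by move=> t; rewrite in_itv/= => /andP[/ltW/dG[]].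
    - move=> t; rewrite in_itv/= derive1E => /andP[/ltW/dG[_ -> _]].
      rewrite spE subr_le0 mulrC ler_wpM2r ?dstep_ge0//.
      by apply: FB; exact: step_itv.
    - apply: derivable_within_continuous => t; rewrite in_itv/= => /andP[/dG[]//].
  rewrite /G /= step_ge1// step_le0// /GRing.scale /= mulr1 mulr0; lra.
apply: (@le_trans _ _ (flength c)); last by rewrite lE lee_fin.
have := fdist_le sc; rewrite /c /l step_le0// step_ge1// scale0r addr0 scale1r.
by rewrite /w addrC subrK.
Qed.

(** A calibration argument: along any smooth curve [G] grows at most [k] times as fast as the
    length. This is the only source of lower bounds for the distance. *)
Lemma fdist_ge (G : M -> R) (k : R) (x y : M) : 0 < k -> continuous G ->
  (forall (c : R -> M) (t e : R), smooth_curve c -> 0 < e ->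
     \forall h \near 0^'+, G (c (t + h)) <= G (c t) + (k * speed c t + e) * h) ->
  (((G y - G x) / k)%:E <= fdist x y)%E.
Proof.
move=> k0 cG dG; apply: le_ereal_inf_tmp => _ [c [sc <- <-] <-].
have [S [dS lE]] := flength_primitive sc.
have ck : continuous (fun t => k * speed c t).
  by move=> t; apply: cvgM; [exact: cvg_cst|exact: continuous_speed].
have dS01 (t : R) : 0 <= t <= 1 -> is_derive t 1 (k \*: S) (k * speed c t).
  case/andP=> t0 _; apply: is_deriveZ; apply: dS.
  by apply: lt_le_trans t0; rewrite ltrN10.
have := @dini_le_int R (G \o c) (fun t => k * speed c t) ck.
rewrite (FTC2_unit ck dS01) lE !lee_fin ler_pdivrMr//.
rewrite /= /GRing.scale /= -mulrBr (mulrC k); apply.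
- move=> t _ e e0.
  have cGc : (G \o c) r @[r --> t^'-] --> (G \o c) t.
    apply: cvg_at_left_filter; apply: continuous_comp; first exact: sc.1.
    exact: cG.
  have /cvgrPdist_lt/(_ _ e0) := cGc; apply: filterS => r.
  by rewrite ltr_norml => /andP[_ h]; apply: ltW; rewrite -ltrBlDl.
- by move=> t _ e e0; exact: dG.
Qed.

End LocalEstimates.

Section LowerEstimate.
Context (R : realType) (n : nat) (M : finslerManifold R n) (x : M).
Notation V := 'rV[R]_n.
Implicit Types (u v w : V) (y z : M).

Let i := chart_at x.
Let u0 := coord i x.

Definition chart_ball (r : R) : set M :=
  [set y | dom i y /\ `|coord i y - u0| < r].

(* Thanks to the truncation this is continuous on the whole of [M], so that curves
   leaving the chart need no separate treatment. *)
Definition truncated (r m : R) (u : V) (y : M) : R :=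
  if `[< chart_ball r y >] then Num.min (finsler x (coord i y - u)) m else m.

Let dom_x : dom i x. Proof. exact: chart_atP. Qed.

Lemma near_coord y (r : R) (v : V) : dom i y -> `|coord i y - v| < r ->
  \forall z \near y, dom i z /\ `|coord i z - v| < r.
Proof.
move=> iy yr; apply: filterI; first exact: nbhs_dom.
have cy : {for y, continuous (fun z => `|coord i z - v|)}.
  apply: (@continuous_comp _ _ _ (coord i) (fun w => `|w - v|)).
    exact: coord_continuous.
  exact: continuous_dist.
by apply: (cy [set s | s < r]); exact: lt_nbhsl.
Qed.

Lemma chart_ball_nbhs (r : R) : 0 < r -> nbhs x (chart_ball r).
Proof. by move=> r0; apply: near_coord; rewrite ?subrr ?normr0. Qed.

Lemma compact_chart_ball (r : R) :
  (forall u, `|u - u0| <= r -> (coord i @` dom i) u) ->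
  compact (param i @` [set u | `|u - u0| <= r]).
Proof.
move=> rU; apply: continuous_compact; last exact: compact_rV_closed_ball.
apply: continuous_in_subspaceT => u /[!inE] ur.
by apply: param_continuous; exact: rU.
Qed.

(** At a point outside the chart ball one may avoid the closed ball of radius r/2: it is compact,
    hence closed because the manifold is Hausdorff, and off it the function is constantly [m]. *)
Lemma truncated_continuous (r m : R) u :
  (forall v, `|v - u0| < r -> (coord i @` dom i) v) ->
  (forall v, r / 2 < `|v - u0| -> m <= finsler x (v - u)) -> 0 < r ->
  continuous (truncated r m u).
Proof.
move=> rU Fm r0 y; have [Dy|nDy] := pselect (chart_ball r y).
  have cy : {for y, continuous (fun z => Num.min (finsler x (coord i z - u)) m)}.
    apply: continuous_min; last exact: cst_continuous.
    apply: (@continuous_comp _ _ _ (fun z => coord i z - u)).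
      apply: (@continuous_comp _ _ _ (coord i) (fun v => v - u)).
        by apply: coord_continuous; case: Dy.
      exact: continuous_subr.
    exact: finsler_fibre_continuous.
  have E : \forall z \near y, Num.min (finsler x (coord i z - u)) m = truncated r m u z.
    by apply: filterS (near_coord Dy.1 Dy.2) => z Dz; rewrite /truncated asboolT.
  rewrite /continuous_at -(nbhs_singleton E); apply: cvg_trans cy.
  by apply: near_eq_cvg; apply: filterS E => z ->.
have r2 : r / 2 < r by rewrite ltr_pdivrMr// ltr_pMr// ltr1n.
pose K := param i @` [set v | `|v - u0| <= r / 2].
have cK : closed K.
  apply: compact_closed; first exact: manifold_hausdorff.
  by apply: compact_chart_ball => v vr; apply: rU; exact: le_lt_trans r2.
have nKy : (~` K) y.
  move=> [v vr vy]; apply: nDy; have vr' := le_lt_trans vr r2.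
  by split; rewrite -vy ?paramK//; [exact: param_dom (rU _ _)|exact: rU].
have E : \forall z \near y, m = truncated r m u z.
  have : nbhs y (~` K) by apply: open_nbhs_nbhs; split=> //; exact: closed_openC.
  apply: filterS => z nKz; rewrite /truncated; case: asboolP => // -[iz zr].
  rewrite min_r//; apply: Fm; rewrite ltNge; apply/negP => zr2.
  by apply: nKz; exists (coord i z) => //; rewrite coordK.
rewrite /continuous_at -(nbhs_singleton E).
by apply: cvg_near_cst; apply: filterS E => z <-.
Qed.

(** The calibration is the truncated F_x-distance from [u]. The end point [y] is arbitrary, so the
    bound controls near points and at the same time keeps far points away; [r] and [m] serve all
    base points [u] near [u0]. *)
Lemma fdist_truncated (k : R) : 1 < k -> exists r m : R, [/\ 0 < r, 0 < m,
  (forall u, `|u - u0| < r -> (coord i @` dom i) u) &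
  forall u, `|u - u0| < r / 4 -> forall y,
    ((truncated r m u y / k)%:E <= fdist (param i u) y)%E].
Proof.
move=> k1; have k0 : 0 < k by exact: lt_trans k1.
have [m1 m0 lb] := finsler_lower_bound x.
(* This error is absorbed by the norm itself: as m1 * |w| <= F_x(w), it leaves at least F_x(w) / k
   of the norm in the chart. *)
have e0 : 0 < m1 * (1 - k^-1) by rewrite mulr_gt0// subr_gt0 invf_lt1.
have /nbhs_ballP[r /= r0 Hr] : \forall u \near u0,
    (coord i @` dom i) u /\
    forall w, `|chart_finsler i u w - finsler x w| <= m1 * (1 - k^-1) * `|w|.
  by apply: filterI; [apply: nbhs_img; exact: img_coord|exact: chart_finsler_near].
have {}Hr u : `|u - u0| < r -> (coord i @` dom i) u /\
    forall w, finsler x w <= k * chart_finsler i u w.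
  rewrite distrC => ur; have [|Ui H] := Hr u; first by rewrite -ball_normE.
  split=> // w; have := H w; have := lb w.
  rewrite ler_norml => lw /andP[h _].
  have h2 : (1 - k^-1) * (m1 * `|w|) <= (1 - k^-1) * finsler x w.
    by rewrite ler_wpM2l// subr_ge0 invf_le1// ltW.
  have : finsler x w * k^-1 <= chart_finsler i u w by lra.
  by rewrite ler_pdivrMr// mulrC.
(* If [u] is within r/4 of [u0] and [v] is farther than r/2 from it, then |v - u| > r/4, so F_x(v -
   u) has reached the level of truncation. *)
exists r, (m1 * (r / 4)); have m40 : 0 < m1 * (r / 4) by rewrite mulr_gt0// divr_gt0.
split=> // [u ur|u ur y]; first by have [] := Hr u ur.
have ur' : `|u - u0| < r by apply: lt_le_trans ur _; rewrite ler_pdivrMr// ler_peMr ?ler1n// ltW.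
have iu : dom i (param i u) by apply: param_dom; have [] := Hr u ur'.
have coordu : coord i (param i u) = u by apply: paramK; have [] := Hr u ur'.
have G0 : truncated r (m1 * (r / 4)) u (param i u) = 0.
  rewrite /truncated asboolT; last by split; rewrite ?coordu.
  by rewrite coordu subrr finsler0 min_l// ltW.
rewrite -[truncated _ _ _ y]subr0 -G0; apply: fdist_ge => //.
  apply: truncated_continuous => // v; first by move/Hr => [].
  move=> vr; apply: le_trans (lb _); rewrite ler_wpM2l ?ltW//.
  have := ler_distD u v u0.
  have : r / 2 = r / 4 + r / 4 by field.
  lra.
move=> c t e sc e00.
have pos (h : R) : 0 < h -> 0 <= (k * speed c t + e) * h.
  by move=> h0; rewrite mulr_ge0 ?addr_ge0 ?mulr_ge0 ?speed_ge0// ltW.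
have le_m z : truncated r (m1 * (r / 4)) u z <= m1 * (r / 4).
  by rewrite /truncated; case: ifPn => // _; rewrite ge_min lexx orbT.
(* The level of truncation is the maximum of the function, so there is nothing to prove where it is
   attained: outside the chart ball, or where the norm exceeds the level. *)
have triv : truncated r (m1 * (r / 4)) u (c t) = m1 * (r / 4) ->
    \forall h \near 0^'+, truncated r (m1 * (r / 4)) u (c (t + h)) <=
      truncated r (m1 * (r / 4)) u (c t) + (k * speed c t + e) * h.
  move=> ->; near=> h; apply: le_trans (le_m _) _.
  by rewrite lerDl pos.
have [Dt|nDt] := pselect (chart_ball r (c t)); last first.
  by apply: triv; rewrite /truncated asboolF.
have [Fm|Fm] := leP (m1 * (r / 4)) (finsler x (coord i (c t) - u)).
  by apply: triv; rewrite /truncated asboolT// min_r.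
have Tt : truncated r (m1 * (r / 4)) u (c t) = finsler x (coord i (c t) - u).
  by rewrite /truncated asboolT// min_l// ltW.
have dg := smooth_curve_diff sc Dt.1.
have D1 := finsler_curve_dini x u dg e00.
have D2 : \forall h \near 0^'+, chart_ball r (c (t + h)).
  have ct : c s @[s --> t] --> c t by exact: sc.1.
  have : \forall s \near t, chart_ball r (c s) by exact: ct (near_coord Dt.1 Dt.2).
  rewrite (near_shift 0 t) => H; have : \forall h \near (0 : R), chart_ball r (c (t + h)).
    by apply: filterS H => h /=; rewrite subr0 addrC.
  by apply: filterS => h + _.
near=> h; have h0 : 0 < h by [].
have Dh : chart_ball r (c (t + h)) by near: h.
rewrite Tt /truncated asboolT//.
apply: (@le_trans _ _ (finsler x (coord i (c (t + h)) - u))); first by rewrite ge_min lexx.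
have : finsler x ((coord i \o c) (t + h) - u) <=
  finsler x ((coord i \o c) t - u) + (finsler x (derive1 (coord i \o c) t) + e) * h.
  by near: h; exact: D1.
move/le_trans; apply; rewrite lerD2l; apply: ler_wpM2r; first exact: ltW.
rewrite lerD2r (speed_chart sc Dt.1).
by have [_] := Hr _ Dt.2; exact.
Unshelve. all: by end_near. Qed.

Lemma fdist_lower (e : R) : 0 < e ->
  \forall u \near u0 & v \near u0,
    ((finsler x (v - u) - e * `|v - u|)%:E <= fdist (param i u) (param i v))%E.
Proof.
move=> e0; have [C C0 ub] := finsler_upper_bound x.
(* With F_x <= C * |.|, this choice gives F_x(w) / k >= F_x(w) - e * |w|. *)
pose k := 1 + e / C; have k1 : 1 < k by rewrite ltrDl divr_gt0.
have k0 : 0 < k by exact: lt_trans k1.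
have [r [m [r0 m0 rU H]]] := fdist_truncated k1.
(* The second bound keeps |v - u| below m / C, so that F_x(v - u) stays below the truncation. *)
pose s := Num.min (r / 4) (m / C / 2).
have s0 : 0 < s by rewrite lt_min !divr_gt0.
have nS : \forall u \near u0, `|u - u0| < s.
  apply/nbhs_ballP; exists s => //= u; rewrite -ball_normE /=.
  by rewrite distrC.
exists ([set u | `|u - u0| < s], [set u | `|u - u0| < s]) => //.
move=> [u v] /= [us vs].
have ur4 : `|u - u0| < r / 4 by apply: (lt_le_trans us); rewrite ge_min lexx.
have vr4 : `|v - u0| < r / 4 by apply: (lt_le_trans vs); rewrite ge_min lexx.
have vr : `|v - u0| < r by apply: lt_le_trans vr4 _; rewrite ler_pdivrMr// ler_peMr ?ler1n// ltW.
apply: le_trans (H u ur4 (param i v)); rewrite lee_fin /truncated asboolT; last first.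
  by split; [exact: param_dom (rU _ vr)|rewrite paramK//; exact: rU].
rewrite paramK; last exact: rU.
have Fvu := ub (v - u).
have vu : `|v - u| < m / C.
  have := ler_distD u0 v u; rewrite (distrC u0 u).
  have us' : `|u - u0| < m / C / 2 by apply: (lt_le_trans us); rewrite ge_min lexx orbT.
  have vs' : `|v - u0| < m / C / 2 by apply: (lt_le_trans vs); rewrite ge_min lexx orbT.
  lra.
rewrite ltr_pdivlMr// in vu.
rewrite min_l; last by apply: (le_trans Fvu); rewrite mulrC ltW.
rewrite ler_pdivlMr//.
have F0 := finsler_ge0 x (v - u).
have : e / C * finsler x (v - u) <= e * `|v - u|.
  rewrite -mulrA; apply: ler_wpM2l; first exact: ltW.
  by rewrite ler_pdivrMl.
have : 0 <= e * `|v - u| * (e / C).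
  by apply: mulr_ge0; [apply: mulr_ge0 => //|apply: divr_ge0]; exact: ltW.
by rewrite /k; lra.
Qed.

Lemma fdist_upper (e : R) : 0 < e ->
  \forall u \near u0 & v \near u0,
    (fdist (param i u) (param i v) <= (finsler x (v - u) + e * `|v - u|)%:E)%E.
Proof.
move=> e0.
have /nbhs_ballP[r /= r0 Hr] : \forall u \near u0,
    (coord i @` dom i) u /\
    forall w, `|chart_finsler i u w - finsler x w| <= e * `|w|.
  by apply: filterI; [apply: nbhs_img; exact: img_coord|exact: chart_finsler_near].
exists (ball u0 r, ball u0 r); first by split; exact: nbhsx_ballx.
move=> [u v] /= [ur vr].
have Hs (s : R) : 0 <= s <= 1 -> ball u0 r (u + s *: (v - u)).
  move=> /andP[s0 s1]; move: ur vr; rewrite -!ball_normE /= => ur vr.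
  have -> : u0 - (u + s *: (v - u)) = (1 - s) *: (u0 - u) + s *: (u0 - v).
    by apply/rowP => j; rewrite !mxE; ring.
  apply: le_lt_trans (ler_normD _ _) _; rewrite !normrZ ger0_norm ?subr_ge0// ger0_norm//.
  have [->|sn0] := eqVneq s 0; first by rewrite mul0r subr0 mul1r addr0.
  have sp : 0 < s by rewrite lt_neqAle eq_sym sn0.
  have h1 : (1 - s) * `|u0 - u| <= (1 - s) * r by rewrite ler_wpM2l ?subr_ge0// ltW.
  have h2 : s * `|u0 - v| < s * r by rewrite ltr_pM2l.
  lra.
apply: fdist_segment => s s01; first by have [] := Hr _ (Hs s s01).
have [_ /(_ (v - u))] := Hr _ (Hs s s01).
by rewrite ler_norml => /andP[_]; rewrite lerBlDl.
Qed.

(** Forward balls are arbitrarily small in the manifold topology: below the level [m] of truncation,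
    [y] must lie in the chart ball and its coordinates are controlled by F_x. This is how estimates
    of the distance become convergence in the manifold. *)
Lemma fdist_separated (A : set M) : nbhs x A ->
  exists2 r : R, 0 < r & forall y, (fdist x y < r%:E)%E -> A y.
Proof.
move=> nA; have [m1 m0 lb] := finsler_lower_bound x.
have [r [m [r0 mp rU H]]] := @fdist_truncated 2 (ltr1n _ 2).
have xE : param i u0 = x by rewrite /u0 coordK.
have : nbhs u0 (param i @^-1` A).
  by apply: (param_continuous (img_coord dom_x)); rewrite -/u0 xE.
move=> /nbhs_ballP[s /= s0 sA].
exists (Num.min (m / 2) (m1 * s / 2)); first by rewrite lt_min !divr_gt0// mulr_gt0.
move=> y; have := H u0; rewrite subrr normr0 divr_gt0// => /(_ isT y).
rewrite xE => h /(le_lt_trans h); rewrite lte_fin lt_min !ltr_pM2r ?invr_gt0//.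
rewrite /truncated; case: asboolP => [[iy yr]|_]; last by rewrite ltxx.
rewrite gt_min ltxx orbF => /andP[Fm]; rewrite min_l ?ltW// => Fs.
rewrite -(coordK iy); apply: (sA (coord i y)); rewrite -ball_normE /= distrC.
by rewrite -(ltr_pM2l m0); apply: le_lt_trans Fs.
Qed.

End LowerEstimate.

(** * The distance as a real-valued function, and its topology *)

Section RealDistance.
Context (R : realType) (n : nat) (M : finslerManifold R n).
Notation V := 'rV[R]_n.
Implicit Types (u v w : V) (x y z : M).

Lemma near_chart x (P : V -> V -> Prop) :
  (\forall u \near coord (chart_at x) x & v \near coord (chart_at x) x, P u v) ->
  \forall y \near x & z \near x,
    [/\ param (chart_at x) (coord (chart_at x) y) = y,
        param (chart_at x) (coord (chart_at x) z) = z &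
        P (coord (chart_at x) y) (coord (chart_at x) z)].
Proof.
set i := chart_at x => -[[A B] [/= nA nB] AB].
have ix : dom i x by exact: chart_atP.
have near_c (D : set V) : nbhs (coord i x) D ->
    \forall y \near x, dom i y /\ D (coord i y).
  by move=> nD; apply: filterI; [exact: nbhs_dom|exact: (coord_continuous ix nD)].
exists ([set y | dom i y /\ A (coord i y)], [set y | dom i y /\ B (coord i y)]).
  by split; exact: near_c.
move=> [y z] [/= [iy Ay] [iz Bz]]; split; rewrite ?coordK//.
exact: (AB (_, _)).
Qed.

Lemma near_diag (T : topologicalType) (x : T) (P : T -> T -> Prop) :
  (\forall y \near x & z \near x, P y z) ->
  (\forall y \near x, P x y) /\ (\forall y \near x, P y x).
Proof.
move=> [[A B] [/= nA nB] AB]; split.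
  by apply: filterS nB => y By; apply: (AB (_, _)); split=> //; exact: nbhs_singleton nA.
by apply: filterS nA => y Ay; apply: (AB (_, _)); split=> //; exact: nbhs_singleton nB.
Qed.

Lemma fdist_lip x : exists2 C : R, 0 < C & \forall y \near x & z \near x,
  (fdist y z <= (C * `|coord (chart_at x) z - coord (chart_at x) y|)%:E)%E.
Proof.
have [C C0 ub] := finsler_upper_bound x.
exists (C + 1); first by rewrite addr_gt0.
have := near_chart (fdist_upper x ltr01); apply: filterS => -[y z] [/= -> ->].
move/le_trans; apply; rewrite lee_fin mulrDl lerD2r.
exact: ub.
Qed.

Lemma fdist_near0 x (r : R) : 0 < r ->
  \forall y \near x, (fdist x y < r%:E)%E /\ (fdist y x < r%:E)%E.
Proof.
move=> r0; have [C C0 H] := fdist_lip x.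
have [H1 H2] := near_diag H.
have ix : dom (chart_at x) x by exact: chart_atP.
have cx : \forall y \near x, dom (chart_at x) y /\
    `|coord (chart_at x) y - coord (chart_at x) x| < r / C.
  by apply: near_coord; rewrite // subrr normr0 divr_gt0.
apply: filterS3 cx H1 H2 => y [_ yr] h1 h2.
rewrite ltr_pdivlMr// mulrC in yr; split; first exact: le_lt_trans h1 _.
by apply: le_lt_trans h2 _; rewrite lte_fin distrC.
Qed.

Definition dist x y : R := fine (fdist x y).

Hypothesis conn : connected [set: M].

(** The points at finite distance from [x] form a nonempty set that is open and closed, because near
    every point the distances in both directions are finite. *)
Lemma fdist_lty x y : (fdist x y < +oo)%E.
Proof.
pose B := [set z | (fdist x z < +oo)%E].
suff : B = setT by move=> BT; have : [set: M] y by []; rewrite -BT.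
have near_fin z := fdist_near0 z (@ltr01 R).
apply: conn; first by exists x; rewrite /B /= fdistxx ltry.
- exists B; last by rewrite setTI.
  rewrite openE => z Bz; apply: filterS (near_fin z) => z' [h _].
  apply: le_lt_trans (fdist_triangle z _ _) _; rewrite lte_add_pinfty//.
  exact: lt_trans h (ltry _).
- exists B; last by rewrite setTI.
  rewrite -[B]setCK; apply: open_closedC; rewrite openE => z nBz.
  apply: filterS (near_fin z) => z' [_ h] Bz'; apply: nBz.
  apply: le_lt_trans (fdist_triangle z' _ _) _; rewrite lte_add_pinfty//.
  exact: lt_trans h (ltry _).
Qed.

Lemma distE x y : fdist x y = (dist x y)%:E.
Proof. by rewrite fineK// ge0_fin_numE ?fdist_ge0// fdist_lty. Qed.

Lemma dist_ge0 x y : 0 <= dist x y.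
Proof. by apply: fine_ge0; exact: fdist_ge0. Qed.

Lemma distxx x : dist x x = 0.
Proof. by rewrite /dist fdistxx. Qed.

Lemma dist_triangle y x z : dist x z <= dist x y + dist y z.
Proof. by rewrite -lee_fin EFinD -!distE fdist_triangle. Qed.

Lemma dist_near0 x (r : R) : 0 < r ->
  \forall y \near x, dist x y < r /\ dist y x < r.
Proof.
by move=> r0; apply: filterS (fdist_near0 x r0) => y; rewrite !distE !lte_fin.
Qed.

Lemma dist_separated x (A : set M) : nbhs x A ->
  exists2 r : R, 0 < r & forall y, dist x y < r -> A y.
Proof.
move=> /fdist_separated[r r0 rA]; exists r => // y yr; apply: rA.
by rewrite distE lte_fin.
Qed.

Lemma dist_eq0 x y : dist x y = 0 -> x = y.
Proof.
move=> d0; apply: contrapT => xy.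
have : nbhs x (~` [set y]).
  apply: open_nbhs_nbhs; split=> //; apply: closed_openC.
  apply: accessible_closed_set1; apply: hausdorff_accessible.
  exact: manifold_hausdorff.
by move=> /dist_separated[r r0 /(_ y)]; rewrite d0 => /(_ r0); apply.
Qed.

Lemma dist_chart x (e : R) : 0 < e ->
  \forall y \near x & z \near x,
    `|dist y z - finsler x (coord (chart_at x) z - coord (chart_at x) y)| <=
    e * `|coord (chart_at x) z - coord (chart_at x) y|.
Proof.
move=> e0.
apply: filterS2 (near_chart (fdist_upper x e0)) (near_chart (fdist_lower x e0)).
move=> [y z] /= [-> ->] + [_ _ +]; rewrite distE !lee_fin => h1 h2.
by rewrite ler_norml; apply/andP; split; lra.
Qed.

Lemma dist_ge_coord x : exists2 C : R, 0 < C &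
  \forall y \near x & z \near x,
    `|coord (chart_at x) z - coord (chart_at x) y| <= C * dist y z.
Proof.
have [m m0 lb] := finsler_lower_bound x.
have m2 : 0 < m / 2 by rewrite divr_gt0.
exists (m / 2)^-1; first by rewrite invr_gt0.
apply: filterS (dist_chart x m2) => -[y z] /=; rewrite ler_norml => /andP[h1 _].
rewrite mulrC ler_pdivlMr//; have := lb (coord (chart_at x) z - coord (chart_at x) y).
lra.
Qed.

Lemma dist_le_coord x : exists2 C : R, 0 < C &
  \forall y \near x & z \near x,
    dist y z <= C * `|coord (chart_at x) z - coord (chart_at x) y|.
Proof.
have [C C0 H] := fdist_lip x; exists C => //.
by apply: filterS H => -[y z] /=; rewrite distE lee_fin.
Qed.

Lemma continuous_dist2 (x y : M) :
  (fun p : M * M => dist p.1 p.2) @ (x, y) --> dist x y.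
Proof.
apply/cvgrPdist_lt => e e0; have e2 : 0 < e / 2 by rewrite divr_gt0.
exists ([set x' | dist x x' < e / 2 /\ dist x' x < e / 2],
        [set y' | dist y y' < e / 2 /\ dist y' y < e / 2]).
  by split; exact: dist_near0.
move=> [x' y'] /= [[h1 h2] [h3 h4]].
have t1 := dist_triangle x x' y'; have t2 := dist_triangle y x y'.
have t3 := dist_triangle x' x y; have t4 := dist_triangle y' x' y.
by rewrite ltr_norml; apply/andP; split; lra.
Qed.

Lemma cvg_dist2 (T : Type) (F : set_system T) {FF : Filter F} (g h : T -> M) x y :
  g @ F --> x -> h @ F --> y -> dist (g t) (h t) @[t --> F] --> dist x y.
Proof.
move=> gx hy; have gh : (fun t => (g t, h t)) @ F --> (x, y) by exact: cvg_pair.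
exact: (cvg_comp _ _ gh (@continuous_dist2 x y)).
Qed.

Lemma dist_cvg (T : Type) (F : set_system T) {FF : Filter F} (g : T -> M) x :
  (forall r : R, 0 < r -> \forall t \near F, dist x (g t) < r) -> g @ F --> x.
Proof.
move=> H A /dist_separated[r r0 rA]; apply: filterS (H r r0) => t.
exact: rA.
Qed.

End RealDistance.

(** * The inverse function theorem *)

Section MeanValueInequality.
Context (R : realType) (V W : normedModType R).

(** The norm of f (u + t *: w) - f u - t *: z has right Dini derivative at most [c], so [dini_le]
    applies after subtracting [c * t]. *)
Lemma mean_value_ineq (f : V -> W) (u w : V) (z : W) (c : R) :
  (forall t : R, 0 <= t <= 1 -> differentiable f (u + t *: w)) ->
  (forall t : R, 0 <= t <= 1 -> `|'d f (u + t *: w) w - z| <= c) ->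
  `|f (u + w) - f u - z| <= c.
Proof.
move=> df dfc.
have zmodE (A A' B y s d : W) :
    A' - B - (y + s) = (A - B - y) + ((d - s) + (A' - A - d)).
  have -> : d - s + (A' - A - d) = A' - A - s by rewrite addrC addrA subrK.
  by rewrite [RHS]addrC addrACA subrKA opprD [- s - y]addrC.
pose g (t : R) := `|f (u + t *: w) - f u - t *: z| - c * t.
have cg (t : R) : 0 <= t <= 1 -> {for (t : R^o), continuous g}.
  move=> t01; apply: cvgB; last by apply: cvgM; [exact: cvg_cst|exact: cvg_id].
  apply: cvg_norm; apply: cvgB; last by apply: cvgZr_tmp; exact: cvg_id.
  apply: cvgB; last exact: cvg_cst.
  apply: (@continuous_comp _ _ _ (fun t : R^o => u + t *: w) f).
    exact: continuous_line.
  by apply: differentiable_continuous; exact: df.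
suff : g 1 <= g 0.
  by rewrite /g !scale1r !scale0r addr0 subrr subr0 normr0 mulr1 mulr0 subrr subr_le0.
apply: dini_le => t t01 e e0.
  have {}t01 : 0 <= t <= 1 by case/andP: t01 => /ltW -> ->.
  have cl : g r @[r --> t^'-] --> g t by apply: cvg_at_left_filter; exact: cg.
  have /cvgrPdist_lt/(_ _ e0) := cl; apply: filterS => r.
  by rewrite ltr_norml => /andP[_ h]; apply: ltW; rewrite -ltrBlDl.
have {}t01 : 0 <= t <= 1 by case/andP: t01 => -> /ltW ->.
pose h (s : R^o) := f (u + s *: w).
have [dl dlE] := diff_line u w (t : R^o).
have dh : differentiable h t by exact: differentiable_comp dl (df t t01).
have dhE r : 'd h t r = r *: 'd f (u + t *: w) w.
  have := congr1 (@^~ r) (diff_comp dl (df t t01)).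
  by rewrite /h => -> /=; rewrite dlE linearZ.
have H : \forall r \near 0^'+, `|h (r + t) - h t - 'd h t r| <= e * `|r|.
  by apply: filterS (diff_eps dh e0) => r + _.
near=> r; have r0 : 0 < r by [].
have : `|h (r + t) - h t - 'd h t r| <= e * `|r| by near: r.
rewrite dhE (gtr0_norm r0) (addrC r) => Hr; rewrite /g.
have -> : f (u + (t + r) *: w) - f u - (t + r) *: z =
    (f (u + t *: w) - f u - t *: z) + (r *: ('d f (u + t *: w) w - z)
     + (h (t + r) - h t - r *: 'd f (u + t *: w) w)).
  rewrite (scalerDl z t r) scalerBr; exact: zmodE.
have T1 := ler_normD (f (u + t *: w) - f u - t *: z) (r *: ('d f (u + t *: w) w - z)
     + (h (t + r) - h t - r *: 'd f (u + t *: w) w)).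
have T2 := ler_normD (r *: ('d f (u + t *: w) w - z))
  (h (t + r) - h t - r *: 'd f (u + t *: w) w).
have T3 : `|r *: ('d f (u + t *: w) w - z)| <= r * c.
  by rewrite normrZ (gtr0_norm r0) ler_wpM2l ?dfc// ltW.
lra.
Unshelve. all: by end_near. Qed.

End MeanValueInequality.

Lemma bounded_linear_continuous (R : realType) (V W : normedModType R)
  (L : {linear V -> W}) (C : R) : 0 < C -> (forall w, `|L w| <= C * `|w|) ->
  continuous L.
Proof.
move=> C0 bL u; apply/cvgrPdist_lt => e e0; apply/nbhs_ballP.
exists (e / C) => /=; first by rewrite divr_gt0.
move=> v; rewrite -ball_normE /= ltr_pdivlMr// => uv.
by rewrite -linearB; apply: le_lt_trans (bL _) _; rewrite mulrC.
Qed.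

Section InverseFunction.
Context (R : realType) (n : nat).
Notation V := 'rV[R]_n.
Implicit Types (u v w : V).

Lemma coord_le_norm (w : V) (j : 'I_n) : `|w 0 j| <= `|w|.
Proof.
rewrite [leRHS]/Num.norm /= mx_normrE; apply/bigmax_geP; right => /=.
by exists (ord0, j).
Qed.

Lemma linear_coord (L : {linear V -> V}) w :
  L w = \sum_(j < n) w 0 j *: L (delta_mx 0 j).
Proof.
rewrite {1}(row_sum_delta w) linear_sum; apply: eq_bigr => j _.
by rewrite linearZ.
Qed.

(** In finite dimension it suffices to control the basis vectors: n of them, each up to e / (n+1),
    the +1 covering n = 0. *)
Lemma linear_near_bound (T : Type) (F : set_system T) {FF : Filter F}
    (L : T -> {linear V -> V}) (L0 : {linear V -> V}) :
  (forall w, L t w @[t --> F] --> L0 w) -> forall e : R, 0 < e ->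
  \forall t \near F, forall w, `|L t w - L0 w| <= e * `|w|.
Proof.
move=> cL e e0; pose d := e / n.+1%:R; have d0 : 0 < d by rewrite divr_gt0.
have : \forall t \near F, forall j : 'I_n,
    `|L0 (delta_mx 0 j) - L t (delta_mx 0 j)| < d.
  apply: filter_forall => j; have /cvgrPdist_lt/(_ _ d0) := cL (delta_mx 0 j).
  by [].
apply: filterS => t Ht w.
have -> : L t w - L0 w = \sum_(j < n) w 0 j *: (L t (delta_mx 0 j) - L0 (delta_mx 0 j)).
  rewrite (linear_coord (L t)) (linear_coord L0) -sumrB.
  by apply: eq_bigr => j _; rewrite scalerBr.
apply: le_trans (ler_norm_sum _ _ _) _.
apply: (@le_trans _ _ (\sum_(j < n) `|w| * d)).
  apply: ler_sum => j _; rewrite normrZ ler_pM ?coord_le_norm//.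
  by rewrite distrC ltW.
rewrite sumr_const card_ord -mulr_natl /d.
have -> : n%:R * (`|w| * (e / n.+1%:R)) = e * `|w| * (n%:R / n.+1%:R) by ring.
apply: ler_piMr; first by apply: mulr_ge0 => //; exact: ltW.
by rewrite ler_pdivrMr// mul1r ler_nat.
Qed.

Lemma linear_bound (L : {linear V -> V}) :
  exists2 C : R, 0 < C & forall w, `|L w| <= C * `|w|.
Proof.
pose C := \sum_(j < n) `|L (delta_mx 0 j)| + 1.
have C0 : 0 < C by rewrite ltr_wpDl// sumr_ge0.
exists C => // w; rewrite linear_coord.
apply: le_trans (ler_norm_sum _ _ _) _; rewrite mulrDl mul1r ler_wpDr//.
rewrite mulr_suml; apply: ler_sum => j _.
by rewrite normrZ mulrC ler_wpM2l// coord_le_norm.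
Qed.

Lemma linear_rV_continuous (L : {linear V -> V}) : continuous L.
Proof. by have [C C0] := linear_bound L; exact: bounded_linear_continuous. Qed.

Lemma linear_inverse (L : {linear V -> V}) : (forall w, L w = 0 -> w = 0) ->
  exists B : {linear V -> V}, cancel L B /\ cancel B L.
Proof.
move=> L0; have LE w : L w = w *m lin1_mx L by rewrite mul_rV_lin1.
have LU : lin1_mx L \in unitmx.
  rewrite -row_free_unit; apply: inj_row_free => w; rewrite -LE.
  exact: L0.
exists (mulmxr (invmx (lin1_mx L))); split=> w; rewrite LE /=.
  by rewrite mulmxK.
by rewrite mulmxKV.
Qed.

Variables (f : V -> V) (u0 : V) (N : set V).
Hypothesis nN : nbhs u0 N.
Hypothesis df : forall u, N u -> differentiable f u.
Hypothesis cdf : forall v, {for u0, continuous (fun u => 'd f u v)}.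
Hypothesis df0 : forall v, 'd f u0 v = 0 -> v = 0.

Lemma strict_diff (e : R) : 0 < e -> exists2 r : R, 0 < r &
  (forall u, `|u - u0| <= r -> N u) /\
  forall u v, `|u - u0| <= r -> `|v - u0| <= r ->
  `|f u - f v - 'd f u0 (u - v)| <= e * `|u - v|.
Proof.
move=> e0; have cL := @linear_near_bound _ _ (nbhs_filter u0) (fun u => 'd f u) ('d f u0) cdf e e0.
have /nbhs_ballP[r /= r0 Hr] : \forall u \near u0, N u /\
    forall w, `|'d f u w - 'd f u0 w| <= e * `|w| by exact: filterI.
have r20 : 0 < r / 2 by rewrite divr_gt0.
exists (r / 2); first exact: r20.
split=> [u ur|u v ur vr].
  have [|//] := Hr u; rewrite -ball_normE /= distrC.
  by apply: le_lt_trans ur _; rewrite ltr_pdivrMr// ltr_pMr// ltr1n.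
have Hs (s : R) : 0 <= s <= 1 -> ball u0 r (v + s *: (u - v)).
  move=> /andP[s0 s1]; rewrite -ball_normE /=.
  have -> : u0 - (v + s *: (u - v)) = (1 - s) *: (u0 - v) + s *: (u0 - u).
    by apply/rowP => j; rewrite !mxE; ring.
  apply: le_lt_trans (ler_normD _ _) _.
  rewrite !normrZ ger0_norm ?subr_ge0// ger0_norm// !(distrC u0).
  have h1 : (1 - s) * `|v - u0| <= (1 - s) * (r / 2) by rewrite ler_wpM2l ?subr_ge0.
  have h2 : s * `|u - u0| <= s * (r / 2) by rewrite ler_wpM2l.
  lra.
have -> : f u = f (v + (u - v)) by rewrite addrC subrK.
by apply: mean_value_ineq => s s01; have [/df dfs Ls] := Hr _ (Hs s s01).
Qed.

(** Newton's iteration with the derivative frozen at [u0]: [T u := u - B (f u - w)] is a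
    1/2-contraction whose fixed points solve f u = w. For [w] within r / K of [f u0] it moves the
    centre by at most r/2, so it preserves the ball of radius [r]. *)
Lemma inverse_function : exists r K : R, [/\ 0 < r, 0 < K,
  forall u, `|u - u0| <= r -> N u,
  forall u v, `|u - u0| <= r -> `|v - u0| <= r -> `|u - v| <= K * `|f u - f v| &
  forall w, `|w - f u0| <= r / K ->
    exists2 u, `|u - u0| <= r & f u = w].
Proof.
have [B [LB BL]] := linear_inverse df0.
have [C C0 bB] := linear_bound B.
(* After applying [B], whose norm is at most [C], this error becomes half of |u - v|. *)
have e0 : 0 < (2 * C)^-1 by rewrite invr_gt0 mulr_gt0.
have [r r0 [dfr Hr]] := strict_diff e0.
have Cr : C * (2 * C)^-1 = 2^-1 by rewrite invfM mulrCA mulfV ?mulr1// gt_eqF.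
have contr u v : `|u - u0| <= r -> `|v - u0| <= r ->
    `|B (f u - f v - 'd f u0 (u - v))| <= 2^-1 * `|u - v|.
  move=> ur vr; apply: le_trans (bB _) _; rewrite -Cr -mulrA.
  by apply: ler_wpM2l; [exact: ltW|exact: Hr].
exists r, (2 * C); split=> //; first by rewrite mulr_gt0.
  move=> u v ur vr; have := contr u v ur vr; rewrite linearB /= LB => h.
  have := bB (f u - f v); have := ler_distD (B (f u - f v)) (u - v) 0.
  rewrite !subr0 distrC; lra.
move=> w wr; pose T u := u - B (f u - w).
have TT u v : `|u - u0| <= r -> `|v - u0| <= r -> `|T u - T v| <= 2^-1 * `|u - v|.
  move=> ur vr; have := contr u v ur vr; rewrite linearB /= LB.
  rewrite /T -normrN; suff -> : - (B (f u - f v) - (u - v)) = T u - T v by [].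
  have -> : f u - f v = (f u - w) - (f v - w) by rewrite opprB addrA subrK.
  have BE : B (f u - w - (f v - w)) = B (f u - w) - B (f v - w) by rewrite linearB.
  rewrite /T BE; move: (B (f u - w)) (B (f v - w)) => p q.
  by apply/rowP => j; rewrite !mxE; ring.
have Tr u : `|u - u0| <= r -> `|T u - u0| <= r.
  move=> ur; have u0r : `|u0 - u0| <= r by rewrite subrr normr0 ltW.
  have h1 := TT u u0 ur u0r.
  have h2 : `|T u0 - u0| <= r / 2.
    rewrite /T addrC addKr normrN; apply: le_trans (bB _) _.
    by rewrite distrC; move: wr; rewrite ler_pdivlMr ?mulr_gt0//; lra.
  have := ler_distD (T u0) (T u) u0.
  have : 2^-1 * `|u - u0| <= 2^-1 * r by rewrite ler_wpM2l.
  lra.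
(* [T] halves [psi] and maps the ball into itself, so the minimum of [psi] is 0. *)
pose psi u := `|T u - u|.
have psiB u : psi u = `|B (f u - w)| by rewrite /psi /T addrC addKr normrN.
have D0 : [set u | `|u - u0| <= r] !=set0 by exists u0; rewrite /= subrr normr0 ltW.
have cpsi : {within [set u | `|u - u0| <= r], continuous psi}.
  rewrite (_ : psi = fun u => `|B (f u - w)|); last exact/funext.
  apply: continuous_in_subspaceT => u /[!inE] ur.
  apply: (@continuous_comp _ _ _ (fun u => f u - w) (fun v => `|B v|)).
    apply: (@continuous_comp _ _ _ f (fun v => v - w)); last exact: continuous_subr.
    by apply: differentiable_continuous; apply: df; exact: dfr.
  apply: (@continuous_comp _ _ _ B); first exact: linear_rV_continuous.
  exact: norm_continuous.
have [u /[!inE] /= ur minu] := EVT_min_rV D0 (@compact_rV_closed_ball _ _ u0 r) cpsi.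
have psiT : psi (T u) <= 2^-1 * psi u by exact: TT (Tr _ ur) ur.
have : psi u = 0.
  apply/eqP; rewrite eq_le normr_ge0 andbT.
  have := minu (T u); rewrite inE => /(_ (Tr _ ur)); lra.
rewrite psiB => /normr0_eq0 Bu; exists u => //; apply/subr0_eq.
by rewrite -[LHS]BL Bu linear0.
Qed.

End InverseFunction.

(** * Maps with bounded infinitesimal dilation *)

Section CurveDilation.
Context (R : realType) (n : nat) (M : finslerManifold R n).
Implicit Types (x y z : M) (c : R -> M).

Lemma fdist_subcurve c (S : R -> R) (s t : R) : smooth_curve c ->
  (forall r : R, -1 < r -> is_derive r 1 S (speed c r)) -> 0 <= s -> s <= t ->
  (fdist (c s) (c t) <= (S t - S s)%:E)%E.
Proof.
move=> sc dS s0 st; pose k := t - s; have k0 : 0 <= k by rewrite subr_ge0.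
pose h (r : R) := s + r * k.
have dh (r : R) : is_derive r 1 h k.
  have [dl dlE] := @diff_line R R^o (s : R^o) (k : R^o) (r : R^o).
  by apply: diff_is_derive.
have sh : smooth_on setT (h : R^o -> R^o).
  move=> m; have kl := @Ck_comp_line R R^o R^o m setT id (s : R^o) (k : R^o)
    openT (@smooth_on_id R R^o setT m).
  exact: (@Ck_sub R R^o R^o m _ setT _ (fun _ _ => I) kl).
have sch := smooth_curve_comp sc sh.
have dSh (r : R) : 0 <= r <= 1 -> is_derive r 1 (S \o h) (speed (c \o h) r).
  move=> /andP[r0 _]; rewrite (speed_comp sc k0 (dh r)) mulrC.
  apply: is_derive1_comp; apply: dS.
  by apply: (@lt_le_trans _ _ 0); rewrite ?ltrN10// addr_ge0// mulr_ge0.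
have := fdist_le sch; rewrite /flength (FTC2_unit (continuous_speed sch) dSh).
by rewrite /h /comp mul0r addr0 mul1r /k addrC subrK.
Qed.

Hypothesis conn : connected [set: M].

Lemma near_optimal_curve x y (e : R) : 0 < e -> exists c (S : R -> R),
  [/\ smooth_curve c, c 0 = x, c 1 = y,
      (forall r : R, -1 < r -> is_derive r 1 S (speed c r)) &
      S 1 - S 0 < dist x y + e].
Proof.
move=> e0; have fd : fdist x y \is a fin_num.
  by rewrite ge0_fin_numE ?fdist_ge0// fdist_lty.
have [_ [c [sc c0 c1] <-] lc] := lb_ereal_inf_adherent e0 fd.
have [S [dS lE]] := flength_primitive sc; exists c, S; split=> //.
by rewrite -lte_fin -lE EFinD -distE.
Qed.

Lemma dist_subcurve c (S : R -> R) (s t : R) : smooth_curve c ->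
  (forall r : R, -1 < r -> is_derive r 1 S (speed c r)) -> 0 <= s -> s <= t ->
  dist (c s) (c t) <= S t - S s.
Proof.
by move=> sc dS s0 st; rewrite -lee_fin -distE//; exact: fdist_subcurve.
Qed.

(* [h] multiplies infinitesimal distances at [x] by at most [b]. *)
Definition dilation_le (h : M -> M) (b : R) (x : M) : Prop :=
  forall e : R, 0 < e -> \forall y \near x, dist (h x) (h y) <= (b + e) * dist x y.

Lemma dilation_le_continuous (h : M -> M) (b : R) x :
  dilation_le h b x -> {for x, continuous h}.
Proof.
move=> dl; apply: dist_cvg => // r r0.
pose k := `|b| + 1; have k0 : 0 < k by rewrite ltr_wpDl.
have rk : 0 < r / k by rewrite divr_gt0.
apply: filterS2 (dl 1 ltr01) (dist_near0 conn x rk) => y h1 [h2 _].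
apply: le_lt_trans h1 _; apply: (@le_lt_trans _ _ (k * dist x y)).
  by rewrite ler_wpM2r ?dist_ge0// lerD2r ler_norm.
by rewrite mulrC -ltr_pdivlMr.
Qed.

Lemma dist_dilation (h : M -> M) (b : R) c (S : R -> R) : 0 <= b ->
  smooth_curve c -> (forall r : R, -1 < r -> is_derive r 1 S (speed c r)) ->
  (forall t : R, 0 <= t <= 1 -> dilation_le h b (c t)) ->
  dist (h (c 0)) (h (c 1)) <= b * (S 1 - S 0).
Proof.
move=> b0 sc dS dl; pose g (t : R) := dist (h (c 0)) (h (c t)) - b * S t.
have gt1 (r : R) : 0 <= r -> -1 < r by apply: lt_le_trans; rewrite ltrN10.
have cS (t : R) : 0 <= t -> {for t, continuous S}.
  by move=> t0; exact: is_derive_continuous (dS t (gt1 t t0)).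
have cg (t : R) : 0 <= t <= 1 -> {for t, continuous g}.
  move=> t01; apply: cvgB.
    apply: cvg_dist2 => //; first exact: cvg_cst.
    apply: (@continuous_comp _ _ _ c h); first exact: sc.1.
    exact: dilation_le_continuous (dl t t01).
  by apply: cvgM; [exact: cvg_cst|apply: cS; case/andP: t01].
suff : g 1 <= g 0 by rewrite /g distxx; lra.
apply: dini_le => t t01 e e0.
  have {}t01 : 0 <= t <= 1 by case/andP: t01 => /ltW -> ->.
  have cl : g r @[r --> t^'-] --> g t by apply: cvg_at_left_filter; exact: cg.
  have /cvgrPdist_lt/(_ _ e0) := cl; apply: filterS => r.
  by rewrite ltr_norml => /andP[_ l]; apply: ltW; rewrite -ltrBlDl.
have {}t01 : 0 <= t <= 1 by case/andP: t01 => -> /ltW ->.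
have t0 : 0 <= t by case/andP: t01.
(* For small [r] the increment of [S] is at most [sp * r]. The added 1 absorbs the error of the
   linearization and keeps the divisor positive. *)
pose sp := speed c t + 1; have sp0 : 0 < sp by rewrite ltr_wpDl ?speed_ge0.
have esp : 0 < e / sp by rewrite divr_gt0.
have near_t (P : R -> Prop) : (\forall s \near t, P s) -> \forall r \near 0^'+, P (t + r).
  rewrite (near_shift 0 t) => H; have : \forall r \near (0 : R), P (t + r).
    by apply: filterS H => r /=; rewrite subr0 addrC.
  by apply: filterS => r + _.
have N1 : \forall r \near 0^'+,
    dist (h (c t)) (h (c (t + r))) <= (b + e / sp) * dist (c t) (c (t + r)).
  apply: (near_t (fun s => dist (h (c t)) (h (c s)) <= (b + e / sp) * dist (c t) (c s))).
  exact: (sc.1 t _ (dl t t01 _ esp)).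
have [dSt dStE] := is_derive_diff (dS t (gt1 t t0)).
have N2 : \forall r \near 0^'+, `|S (r + t) - S t - 'd (S : R^o -> R^o) t r| <= 1 * `|r|.
  by apply: filterS (diff_eps dSt ltr01) => r + _.
near=> r; have r0 : 0 < r by [].
have h1 : dist (h (c t)) (h (c (t + r))) <= (b + e / sp) * dist (c t) (c (t + r)).
  by near: r.
have : `|S (r + t) - S t - 'd (S : R^o -> R^o) t r| <= 1 * `|r| by near: r.
rewrite dStE (gtr0_norm r0) (addrC r) mul1r ler_norml => /andP[_ h2].
have h3 : dist (c t) (c (t + r)) <= S (t + r) - S t.
  by apply: dist_subcurve => //; rewrite lerDl ltW.
have h4 := dist_triangle conn (h (c t)) (h (c 0)) (h (c (t + r))).
have h5 : e / sp * dist (c t) (c (t + r)) <= e / sp * (sp * r).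
  apply: ler_wpM2l; first exact: ltW.
  by apply: le_trans h3 _; rewrite /sp; lra.
have h6 : b * dist (c t) (c (t + r)) <= b * (S (t + r) - S t) by rewrite ler_wpM2l.
have h7 : e / sp * (sp * r) = e * r by field; rewrite gt_eqF.
rewrite /g; lra.
Unshelve. all: by end_near. Qed.

Lemma dist_dilation_global (h : M -> M) (b : R) x y : 0 <= b ->
  (forall z, dilation_le h b z) -> dist (h x) (h y) <= b * dist x y.
Proof.
move=> b0 dl; apply/ler_addgt0Pr => e e0.
pose k := b + 1; have k0 : 0 < k by rewrite ltr_wpDl.
have [c [S [sc <- <- dS lS]]] := near_optimal_curve x y (divr_gt0 e0 k0).
apply: le_trans (dist_dilation b0 sc dS (fun t _ => dl _)) _.
apply: (@le_trans _ _ (b * (dist (c 0) (c 1) + e / k))).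
  by apply: ler_wpM2l => //; exact: ltW.
rewrite mulrDr lerD2l mulrCA ler_piMr ?ltW//.
by rewrite -/(b / k) ltr_pdivrMr// mul1r /k ltrDl.
Qed.

End CurveDilation.

(** * Similarities at small scale *)

Section SimilarityLocal.
Context (R : realType) (n : nat) (M : finslerManifold R n).
Hypothesis conn : connected [set: M].
Variables (a : R) (f : M -> M).
Hypothesis fS : similarity a f.
Implicit Types (x y z : M).

Let a0 : 0 < a. Proof. by case: fS. Qed.

Let cf : continuous f. Proof. by case: fS => _ []. Qed.

Let chart_map x := coord (chart_at (f x)) \o f \o param (chart_at x).

Let chart_dom x : set 'rV[R]_n :=
  coord (chart_at x) @` (dom (chart_at x) `&` f @^-1` dom (chart_at (f x))).

Let chart_dom_at x : chart_dom x (coord (chart_at x) x).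
Proof. by exists x => //; split; exact: chart_atP. Qed.

Let chart_dom_nbhs x : nbhs (coord (chart_at x) x) (chart_dom x).
Proof.
apply: open_nbhs_nbhs; split; last exact: chart_dom_at.
apply: open_coord_image; apply: open_comp; last exact: dom_open.
by move=> y _; exact: cf.
Qed.

Let chart_map_diff x u : chart_dom x u -> differentiable (chart_map x) u.
Proof.
by move=> xu; have [_ [_ /(_ (chart_at x) (chart_at (f x)))[+ _] _]] := fS; apply.
Qed.

Let chart_map_diff_cvg x v : {for coord (chart_at x) x,
  continuous (fun u => 'd (chart_map x) u v)}.
Proof.
have [_ [_ /(_ (chart_at x) (chart_at (f x)))[_ /(_ v) H]] _] := fS.
exact: (H _ (chart_dom_at x)).
Qed.

Let finsler_diff x v :
  finsler (f x) ('d (chart_map x) (coord (chart_at x) x) v) = a * finsler x v.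
Proof. by have [_ _] := fS; exact. Qed.

Lemma similarity_near x (e : R) : 0 < e ->
  \forall y \near x, `|dist (f x) (f y) - a * dist x y| <= e * dist x y.
Proof.
move=> e0; set i := chart_at x; set j := chart_at (f x).
set u0 := coord i x; set w0 := coord j (f x).
have dF := chart_map_diff (chart_dom_at x).
have [CA CA0 bA] := linear_bound ('d (chart_map x) u0).
have [C C0 bF] := finsler_upper_bound (f x).
have [K K0 HK] := dist_ge_coord conn x.
(* Three errors are collected, each a multiple of [d * |v|]: comparing distance and norm at [f x]
   costs CA + 1, linearizing [f] costs [C], comparing at [x] costs [a]. The factor [K] then turns
   |v| into the distance. *)
pose T := CA + 1 + C + a; have T0 : 0 < T by rewrite !addr_gt0.
pose d := Num.min 1 (e / (T * K)).
have d0 : 0 < d by rewrite lt_min ltr01 divr_gt0// mulr_gt0.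
have d1 : d <= 1 by rewrite ge_min lexx.
have dTK : d * (T * K) <= e.
  by rewrite -ler_pdivlMr ?mulr_gt0// ge_min lexx orbT.
have [N1 _] := near_diag (dist_chart conn x d0).
have [N2 _] := near_diag (dist_chart conn (f x) d0).
have [N3 _] := near_diag HK.
have N4 : \forall y \near x, `|chart_map x (coord i y) - chart_map x u0 -
    'd (chart_map x) u0 (coord i y - u0)| <= d * `|coord i y - u0|.
  have cx : {for x, continuous (coord i)} := coord_continuous (chart_atP x).
  have : \forall u \near u0, `|chart_map x u - chart_map x u0 -
    'd (chart_map x) u0 (u - u0)| <= d * `|u - u0|.
    rewrite (near_shift 0 u0); apply: filterS (diff_eps dF d0) => h.
    by rewrite /= subr0 addrK.
  exact: cx.
have N5 := cf N2.
have N6 := nbhs_dom (chart_atP x).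
near=> y.
have iy : dom i y by near: y.
have h1 : `|dist x y - finsler x (coord i y - u0)| <= d * `|coord i y - u0| by near: y.
have h2 : `|dist (f x) (f y) - finsler (f x) (coord j (f y) - w0)| <=
  d * `|coord j (f y) - w0| by near: y.
have h3 : `|coord i y - u0| <= K * dist x y by near: y.
have : `|chart_map x (coord i y) - chart_map x u0 -
    'd (chart_map x) u0 (coord i y - u0)| <= d * `|coord i y - u0| by near: y.
have -> : chart_map x (coord i y) = coord j (f y) by rewrite /chart_map /= coordK.
have -> : chart_map x u0 = w0.
  by rewrite /chart_map /= coordK//; exact: chart_atP.
set v := coord i y - u0; set w := coord j (f y) - w0.
rewrite -/v -/w in h1 h2 h3.
set Av := 'd (chart_map x) u0 v => h4.
have FA : finsler (f x) Av = a * finsler x v by exact: finsler_diff.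
have h5 : finsler (f x) w <= finsler (f x) Av + C * (d * `|v|).
  have := finsler_triangle (f x) Av (w - Av); rewrite addrC subrK => /le_trans; apply.
  by rewrite lerD2l; apply: le_trans (bF _) _; rewrite ler_pM2l.
have h6 : finsler (f x) Av <= finsler (f x) w + C * (d * `|v|).
  have := finsler_triangle (f x) w (Av - w); rewrite addrC subrK => /le_trans; apply.
  by rewrite lerD2l; apply: le_trans (bF _) _; rewrite ler_pM2l// distrC.
have h7 : `|w| <= CA * `|v| + d * `|v|.
  have := ler_normD Av (w - Av); rewrite addrC subrK => /le_trans; apply.
  by apply: lerD => //; exact: bA.
have h8 : d * `|w| <= d * ((CA + 1) * `|v|).
  rewrite ler_pM2l//; apply: le_trans h7 _; rewrite mulrDl lerD2l.
  by rewrite ler_wpM2r.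
have h9 : a * `|dist x y - finsler x v| <= a * (d * `|v|) by rewrite ler_pM2l.
have h10 : d * T * `|v| <= e * dist x y.
  apply: (@le_trans _ _ (d * T * (K * dist x y))).
    by rewrite ler_pM2l// mulr_gt0.
  by rewrite mulrA -(mulrA d) ler_wpM2r// dist_ge0.
have h11 : a * `|dist x y - finsler x v| = `|a * dist x y - a * finsler x v|.
  by rewrite -mulrBr normrM gtr0_norm.
rewrite h11 in h9; move: h2 h9; rewrite !ler_norml => /andP[p1 p2] /andP[p3 p4].
rewrite /T in h10; apply/andP; split; lra.
Unshelve. all: by end_near. Qed.

(** F (df v) = a * F (v) makes the differential injective, hence invertible as source and target
    have the same dimension, and the inverse function theorem applies in charts. [g] is total by
    choice; its values away from [f x] are arbitrary. *)
Lemma similarity_local_inverse x : exists g : M -> M,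
  (\forall y \near f x, f (g y) = y /\ {for y, continuous g}) /\
  (\forall z \near x, g (f z) = z).
Proof.
set i := chart_at x; set j := chart_at (f x).
set u0 := coord i x; set w0 := coord j (f x).
have dF0 v : 'd (chart_map x) u0 v = 0 -> v = 0.
  move=> v0; have := finsler_diff x v; rewrite v0 finsler0 => /esym/eqP.
  by rewrite mulf_eq0 gt_eqF//= => /eqP; exact: finsler_eq0.
have [r [K [r0 K0 rN inj surj]]] := inverse_function (chart_dom_nbhs x)
  (@chart_map_diff x) (@chart_map_diff_cvg x) dF0.
have w0E : chart_map x u0 = w0 by rewrite /chart_map /= coordK//; exact: chart_atP.
rewrite w0E in surj.
pose P y z := [/\ dom i z, dom j (f z), `|coord i z - u0| <= r & f z = y].
have /choice[g gP] : forall y, exists z, (exists z, P y z) -> P y z.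
  by move=> y; have [[z Pz]|nz] := pselect (exists z, P y z); [exists z|exists x].
have mapE z : dom i z -> chart_map x (coord i z) = coord j (f z).
  by move=> iz; rewrite /chart_map /= coordK.
have Pinj y y' z z' : P y z -> P y' z' ->
    `|coord i z - coord i z'| <= K * `|coord j y - coord j y'|.
  move=> [iz jz zr <-] [iz' jz' zr' <-].
  by have := inj _ _ zr zr'; rewrite !mapE.
pose D := [set y | dom j y /\ `|coord j y - w0| < r / K].
have rK : 0 < r / K by rewrite divr_gt0.
have nD y : D y -> \forall y' \near y, D y'.
  by move=> [jy yr]; exact: near_coord.
have DP y : D y -> P y (g y).
  move=> [jy yr]; apply: gP; have [u ur uE] := surj _ (ltW yr).
  have [z [iz jz] zu] := rN u ur.
  exists z; rewrite -zu in ur uE; split=> //.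
  rewrite -(coordK jy) -uE; rewrite mapE// coordK//.
have cg y : D y -> {for y, continuous g}.
  move=> Dy; have Py := DP y Dy; have [igy _ _ _] := Py.
  have cc : (fun y' => coord i (g y')) @ y --> coord i (g y).
    apply/cvgrPdist_lt => e e0; have eK : 0 < e / K by rewrite divr_gt0.
    have cy : {for y, continuous (coord j)} := coord_continuous Dy.1.
    have /cvgrPdist_lt/(_ _ eK) := cy; apply: filterS2 (nD y Dy) => y' Dy' yy.
    apply: le_lt_trans (Pinj _ _ _ _ Py (DP y' Dy')) _.
    by rewrite mulrC -ltr_pdivlMr.
  have cp := param_continuous (img_coord igy).
  have cpg := cvg_comp _ _ cc cp; rewrite coordK// in cpg.
  apply: cvg_trans cpg; apply: near_eq_cvg; apply: filterS (nD y Dy) => y' Dy'.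
  by have [igy' _ _ _] := DP y' Dy'; rewrite /= coordK.
exists g; split.
  have := nD (f x); have Dfx : D (f x).
    by split; [exact: chart_atP|rewrite subrr normr0].
  move=> /(_ Dfx); apply: filterS => y Dy; split; last exact: cg.
  by have [_ _ _] := DP y Dy.
have N1 : \forall z \near x, dom i z /\ `|coord i z - u0| < r.
  by apply: near_coord; rewrite ?subrr ?normr0//; exact: chart_atP.
have N2 : \forall z \near x, dom j (f z).
  exact: (cf (nbhs_dom (chart_atP (f x)))).
apply: filterS2 N1 N2 => z [iz zr] jz.
have Pz : P (f z) z by split=> //; exact: ltW.
have Pg : P (f z) (g (f z)) by apply: gP; exists z.
have := Pinj _ _ _ _ Pg Pz; rewrite subrr normr0 mulr0 normr_le0 subr_eq0 => /eqP gz.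
by have [igz _ _ _] := Pg; rewrite -(coordK igz) gz coordK.
Qed.

Lemma similarity_dilation x : dilation_le f a x.
Proof.
move=> e e0; apply: filterS (similarity_near x e0) => y.
by rewrite ler_norml => /andP[_ h]; lra.
Qed.

End SimilarityLocal.

(** * Lifting along a local similarity *)

Section LocalSection.
Context (R : realType) (n : nat) (M : finslerManifold R n).
Hypothesis conn : connected [set: M].
Implicit Types (x y z : M) (f g : M -> M).

(** Together with continuity this is all that lifting requires of [f]: local inverses that are
    Lipschitz with constant [b]. It passes to iterates, with [b ^+ k]. *)
Definition local_section f (b : R) : Prop := forall x, exists g,
  [/\ \forall y \near f x, f (g y) = y, \forall z \near x, g (f z) = z &
      \forall y \near f x & z \near f x, dist (g y) (g z) <= b * dist y z].

Lemma local_section_cvg f (b : R) x g : 0 <= b -> (\forall z \near x, g (f z) = z) ->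
  (\forall y \near f x & z \near f x, dist (g y) (g z) <= b * dist y z) ->
  g @ f x --> x.
Proof.
move=> b0 /nbhs_singleton gx /near_diag[L _]; apply: dist_cvg => // r r0.
have r1 : 0 < r / (b + 1) by rewrite divr_gt0// ltr_wpDl.
apply: filterS2 L (dist_near0 conn (f x) r1) => y; rewrite gx => h [h1 _].
apply: le_lt_trans h _; apply: (@le_lt_trans _ _ ((b + 1) * dist (f x) y)).
  by rewrite ler_wpM2r ?dist_ge0// lerDl.
by rewrite mulrC -ltr_pdivlMr// ltr_wpDl.
Qed.

Lemma local_section_inj f (b : R) x : local_section f b ->
  \forall z \near x & z' \near x, f z = f z' -> z = z'.
Proof.
move=> /(_ x)[g [_ gf _]]; exists ([set z | g (f z) = z], [set z | g (f z) = z]) => //.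
by move=> [z z'] /= [h h'] ff; rewrite -h -h' ff.
Qed.

Lemma local_section_comp f1 f2 (b1 b2 : R) : 0 <= b1 -> 0 <= b2 ->
  continuous f2 ->
  local_section f1 b1 -> local_section f2 b2 -> local_section (f1 \o f2) (b2 * b1).
Proof.
move=> b10 b20 cf2 L1 L2 x; have [g1 [fg1 gf1 l1]] := L1 (f2 x).
have [g2 [fg2 gf2 l2]] := L2 x.
have cg1 := local_section_cvg b10 gf1 l1.
exists (g2 \o g1); split.
- have H : \forall y \near f1 (f2 x), f2 (g2 (g1 y)) = g1 y by exact: (cg1 _ fg2).
  by apply: filterS2 H fg1 => y /= ->.
- have H : \forall z \near x, g1 (f1 (f2 z)) = f2 z by exact: (cf2 x _ gf1).
  by apply: filterS2 H gf2 => z /= ->.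
- have [[A B] [/= nA nB] AB] := l2; have [[A' B'] [/= nA' nB'] AB'] := l1.
  exists (A' `&` g1 @^-1` A, B' `&` g1 @^-1` B).
    by split; apply: filterI => //; exact: cg1.
  move=> [y z] /= [[Ay gAy] [Bz gBz]].
  apply: le_trans (AB (g1 y, g1 z) _) _ => //=.
  by rewrite -mulrA ler_wpM2l//; exact: (AB' (y, z)).
Qed.

Lemma local_section_iter f (b : R) k : 0 <= b -> continuous f ->
  local_section f b -> local_section (iter k f) (b ^+ k).
Proof.
move=> b0 cf Lf; elim: k => [|k IH].
  move=> x; exists id; split; try exact: nearW.
  by exists (setT, setT) => [|[y z] _] /=; rewrite ?expr0 ?mul1r//; split; exact: filterT.
have cfk : continuous (iter k f).
  by elim: (k) => [|m cm] y; [exact: cvg_id|exact: (continuous_comp (cm y) (cf _))].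
by rewrite exprSr; exact: (local_section_comp b0 (exprn_ge0 k b0) cfk Lf IH).
Qed.

(** The local inverse has infinitesimal dilation 1/a near [f x]. Integrating this along a nearly
    shortest curve gives the Lipschitz bound, provided that the curve remains where the dilation is
    controlled. *)
Lemma similarity_local_section (a : R) f : similarity a f -> local_section f a^-1.
Proof.
move=> fS x; have a0 : 0 < a by case: fS.
have ia0 : 0 <= a^-1 by rewrite invr_ge0 ltW.
have [g [fg gf]] := similarity_local_inverse fS x.
have dl : \forall y \near f x, dilation_le g a^-1 y.
  have := nbhs_interior fg; apply: filterS => y ny e e0.
  have [fgy cgy] := nbhs_singleton ny.
  have ae : 0 < a^-1 + e by rewrite ltr_wpDl.
  (* The solution of (a - d) * (a^-1 + e) = 1: expansion by at least a - d near [g y] is contraction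
     by a^-1 + e for the inverse. *)
  pose d := a * e / (a^-1 + e); have d0 : 0 < d by rewrite divr_gt0// mulr_gt0.
  have dE : (a - d) * (a^-1 + e) = 1.
    by rewrite mulrBl /d mulfVK ?gt_eqF// mulrDr mulfV ?gt_eqF//; lra.
  have S1 := cgy _ (similarity_near conn fS (g y) d0).
  apply: filterS2 ny S1 => y' [fgy' _] /=; rewrite fgy fgy' ler_norml => /andP[h _].
  have h1 : (a - d) * dist (g y) (g y') <= dist y y' by lra.
  have := ler_wpM2l (ltW ae) h1; rewrite mulrA [(a^-1 + e) * (a - d)]mulrC dE mul1r.
  by [].
have [r r0 Hr] := dist_separated conn dl.
(* Two points of [B] are less than r/2 apart, so a curve joining them with excess at most r/4 has
   length below 3r/4 and stays in the forward ball of radius [r]. *)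
have r4 : 0 < r / 4 by rewrite divr_gt0.
exists g; split => //; first by apply: filterS fg => y [].
pose B := [set y | dist (f x) y < r / 4 /\ dist y (f x) < r / 4].
exists (B, B); first by split; exact: dist_near0.
move=> [y z] /= [[y1 y2] [z1 z2]]; apply/ler_addgt0Pr => e e0.
pose k := a^-1 + 1; have k0 : 0 < k by rewrite ltr_wpDl.
pose d := Num.min (e / k) (r / 4).
have d0 : 0 < d by rewrite lt_min r4 divr_gt0.
have [c [S [sc c0 c1 dS lS]]] := near_optimal_curve conn y z d0.
have dr : d <= r / 4 by rewrite ge_min lexx orbT.
have dk : d <= e / k by rewrite ge_min lexx.
have tri := dist_triangle conn (f x) y z.
have : dist (g (c 0)) (g (c 1)) <= a^-1 * (S 1 - S 0).
  apply: dist_dilation => // t /andP[t0 t1]; apply: Hr.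
  have h1 := dist_subcurve conn sc dS (lexx 0) t0.
  have h2 := dist_subcurve conn sc dS t0 t1.
  have h3 := dist_ge0 (c t) (c 1).
  have h4 := dist_triangle conn y (f x) (c t).
  rewrite c0 in h1; lra.
rewrite c0 c1 => /le_trans; apply.
have h : a^-1 * (S 1 - S 0) <= a^-1 * (dist y z + d).
  by apply: ler_wpM2l => //; exact: ltW.
apply: le_trans h _; rewrite mulrDr lerD2l.
apply: (@le_trans _ _ (k * d)); first by rewrite ler_wpM2r ?lerDl// ltW.
by rewrite mulrC -ler_pdivlMr.
Qed.

End LocalSection.

(** * Homotopy lifting over a compact parameter space *)

Section Lifting.
Context (R : realType) (n : nat) (M : finslerManifold R n).
Hypothesis conn : connected [set: M].
Hypothesis complete : forward_complete M.
Variables (f : M -> M) (b : R).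
Hypothesis b0 : 0 <= b.
Hypothesis cf : continuous f.
Hypothesis Lf : local_section f b.
Variables (T : topologicalType) (A : set T) (H : R -> T -> M) (K : T -> R) (Kmax : R).
Hypothesis cA : compact A.
Hypothesis K0 : forall t, A t -> 0 <= K t.
Hypothesis KM : forall t, A t -> K t <= Kmax.
Hypothesis cH : forall s, 0 <= s <= 1 -> forall t, A t ->
  H s @ within A (nbhs t) --> H s t.
Hypothesis HK : forall (s s' : R) t, A t -> 0 <= s -> s <= s' -> s' <= 1 ->
  dist (H s t) (H s' t) <= K t * (s' - s).

Let Kmax1 : 0 < `|Kmax| + 1. Proof. by rewrite ltr_wpDl. Qed.

Let b1 : 0 < b + 1. Proof. by rewrite ltr_wpDl. Qed.

Let KM1 t : A t -> K t <= `|Kmax| + 1.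
Proof.
by move=> At; apply: le_trans (KM At) _; apply: le_trans (ler_norm _) _; rewrite lerDl.
Qed.

Definition partial_lift (s : R) (g : T -> M) : Prop :=
  [/\ 0 <= s <= 1, forall t, A t -> g @ within A (nbhs t) --> g t &
      forall t, A t -> f (g t) = H s t].

(** The displacement bound replaces the record of the intermediate slices: it makes a chain of
    extensions forward Cauchy at each parameter, and it survives composition and limits. *)
Definition extends (p q : R * (T -> M)) : Prop :=
  p.1 <= q.1 /\ forall t, A t -> dist (p.2 t) (q.2 t) <= b * (K t * (q.1 - p.1)).

Lemma extends_refl p : extends p p.
Proof. by split=> // t At; rewrite distxx subrr !mulr0. Qed.

Lemma extends_trans p q r : extends p q -> extends q r -> extends p r.
Proof.
move=> [pq Dpq] [qr Dqr]; split; first exact: le_trans qr.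
move=> t At; have := dist_triangle conn (q.2 t) (p.2 t) (r.2 t).
by have := Dpq t At; have := Dqr t At; lra.
Qed.

Lemma lift_extend_local s (g : T -> M) t0 : partial_lift s g -> A t0 ->
  exists (O : set T) (tau : R) (G : R -> T -> M), [/\ open O, O t0, 0 < tau &
    forall s', s <= s' <= s + tau -> s' <= 1 ->
      (forall t, O t -> A t -> f (G s' t) = H s' t /\
        dist (g t) (G s' t) <= b * (K t * (s' - s))) /\
      (forall t t', O t -> A t -> O t' -> A t' ->
        dist (G s' t) (G s' t') <= b * dist (H s' t) (H s' t'))].
Proof.
move=> [/andP[s0 s1] cg fg] At0; have [h [fh hf lh]] := Lf (g t0).
rewrite (fg t0 At0) in fh lh.
have [[B C] [/= nB nC] BC] := lh.
have [r r0 Hr] := dist_separated conn (filterI fh (filterI nB nC)).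
have r2 : 0 < r / 2 by rewrite divr_gt0.
have N1 : within A (nbhs t0) [set t | h (f (g t)) = g t] by exact: (cg t0 At0 _ hf).
have N2 : within A (nbhs t0) [set t | dist (H s t0) (H s t) < r / 2].
  have s01 : 0 <= s <= 1 by rewrite s0.
  have nb : \forall y \near H s t0, dist (H s t0) y < r / 2.
    by apply: filterS (dist_near0 conn (H s t0) r2) => y [].
  exact: (cH s01 At0 nb).
have NO : \forall t \near t0, A t -> h (f (g t)) = g t /\ dist (H s t0) (H s t) < r / 2.
  exact: (filterI N1 N2).
(* During a time [tau] the homotopy moves by at most r/2, whatever the parameter. *)
pose tau := r / 2 / (`|Kmax| + 1).
exists [set t | A t -> h (f (g t)) = g t /\ dist (H s t0) (H s t) < r / 2]^°, tau,
  (fun s' t => h (H s' t)); split.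
- exact: open_interior.
- exact: NO.
- by rewrite divr_gt0.
move=> s' /andP[ss' s't] s'1.
have inW t : [set t | A t -> h (f (g t)) = g t /\ dist (H s t0) (H s t) < r / 2]^° t ->
    A t -> dist (H s t0) (H s' t) < r /\ dist (H s t0) (H s t) < r.
  move=> /interior_subset /= Ht At; have [_ d1] := Ht At.
  have d2 := HK At s0 ss' s'1.
  have d3 : K t * (s' - s) <= r / 2.
    apply: (@le_trans _ _ ((`|Kmax| + 1) * tau)).
      by apply: ler_pM; rewrite ?K0 ?subr_ge0 ?KM1//; lra.
    by rewrite /tau mulrC divfK// gt_eqF.
  have := dist_triangle conn (H s t) (H s t0) (H s' t).
  lra.
split=> [t Ot At|t t' Ot At Ot' At'].
  have [w1 w2] := inW t Ot At; have [fhy _] := Hr _ w1.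
  have [_ [Bt Ct]] := Hr _ w1; have [_ [Bt' Ct']] := Hr _ w2.
  split=> //; have [hgt _] := interior_subset Ot At.
  rewrite -{1}hgt fg//; apply: le_trans (BC (H s t, H s' t) _) _ => //=.
  by rewrite ler_wpM2l// HK.
have [w1 _] := inW t Ot At; have [w2 _] := inW t' Ot' At'.
have [_ [Bt _]] := Hr _ w1; have [_ [_ Ct']] := Hr _ w2.
exact: (BC (H s' t, H s' t')).
Qed.

(** A Lebesgue number argument: by compactness [f] is injective on forward balls of one common
    radius around the points g t. This yields the uniqueness by which local extensions are glued. *)
Lemma lift_inj_uniform (g : T -> M) :
  (forall t, A t -> g @ within A (nbhs t) --> g t) ->
  exists2 d : R, 0 < d & forall t, A t -> forall z z',
    dist (g t) z < d -> dist (g t) z' < d -> f z = f z' -> z = z'.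
Proof.
move=> cg.
pose Q (d : R) t := forall z z', dist (g t) z < d -> dist (g t) z' < d ->
  f z = f z' -> z = z'.
have : \forall d \near 0^'+, A `<=` Q d.
  apply: ((near_covering_withinP A).2 ((compact_near_coveringP A).1 cA)) => t0 At0.
  have [[B C] [/= nB nC] BC] := local_section_inj (g t0) Lf.
  have [r r0 Hr] := dist_separated conn (filterI nB nC).
  have r2 : 0 < r / 2 by rewrite divr_gt0.
  have nb : \forall y \near g t0, dist (g t0) y < r / 2.
    by apply: filterS (dist_near0 conn (g t0) r2) => y [].
  have N1 := cg t0 At0 _ nb.
  exists ([set t | A t -> dist (g t0) (g t) < r / 2], [set d : R | d < r / 2]).
    by split => //=; exact: nbhs_right_lt.
  move=> [t d] /= [Nt dr] At z z' zd z'd.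
  have tr1 := dist_triangle conn (g t) (g t0) z.
  have tr2 := dist_triangle conn (g t) (g t0) z'.
  have gt := Nt At.
  have [Bz _] : (B `&` C) z by apply: Hr; lra.
  have [_ Cz'] : (B `&` C) z' by apply: Hr; lra.
  exact: (BC (z, z')).
move=> Q0; have Q1 : \forall d \near (0 : R)^'+, A `<=` Q d /\ 0 < d.
  by apply: filterI => //; exact: nbhs_right_gt.
have [d [Qd d0]] := @filter_ex _ _ (at_right_proper_filter (0 : R)) _ Q1; by exists d.
Qed.

(** The extension is chosen pointwise, close to g t. By uniform injectivity it coincides with every
    local extension given by a continuous local inverse, and so it is continuous. *)
Lemma lift_extend s (g : T -> M) : partial_lift s g -> s < 1 ->
  exists (s' : R) (g' : T -> M), [/\ s < s', partial_lift s' g' & extends (s, g) (s', g')].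
Proof.
move=> pl s1; have [/andP[s0 _] cg fg] := pl.
have [d d0 inj] := lift_inj_uniform cg.
pose Q (tau : R) t1 := forall s', s <= s' <= s + tau -> s' <= 1 ->
  exists (O : set T) (G : T -> M), [/\ open O, O t1,
    (forall t, O t -> A t -> f (G t) = H s' t /\
      dist (g t) (G t) <= b * (K t * (s' - s))) &
    (forall t t', O t -> A t -> O t' -> A t' ->
      dist (G t) (G t') <= b * dist (H s' t) (H s' t'))].
have NQ : \forall tau \near 0^'+, A `<=` Q tau.
  apply: ((near_covering_withinP A).2 ((compact_near_coveringP A).1 cA)) => t0 At0.
  have [U [tau [G [oO Ot0 tau0 HG]]]] := lift_extend_local pl At0.
  exists (U, [set r : R | r < tau]).
    by split => /=; [exact: open_nbhs_nbhs|exact: nbhs_right_lt].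
  move=> [t1 r] /= [Ot1 rt] At1 s' /andP[ss' s'r] s'1.
  have s'in : s <= s' <= s + tau by rewrite ss'/=; move: rt => /=; lra.
  have [G1 G2] := HG s' s'in s'1.
  by exists U, (G s').
(* For [tau < e] all displacements stay below [d], within the range where [f] is injective. *)
pose e := d / ((b + 1) * (`|Kmax| + 1)).
have e0 : 0 < e by rewrite divr_gt0// mulr_gt0.
have Ntau : \forall tau \near (0 : R)^'+, [/\ A `<=` Q tau, 0 < tau & tau < e].
  near=> tau; split; [by near: tau|by []|by near: tau; exact: nbhs_right_lt].
have [tau [Qtau tau0 taue]] := @filter_ex _ _ (at_right_proper_filter (0 : R)) _ Ntau.
pose s' := Num.min (s + tau) 1.
have ss' : s < s' by rewrite lt_min s1 andbT ltrDl.
have s's : s' <= s + tau by rewrite ge_min lexx.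
have s'1 : s' <= 1 by rewrite ge_min lexx orbT.
have s'in : s <= s' <= s + tau by rewrite (ltW ss').
have small t : A t -> b * (K t * (s' - s)) < d.
  move=> At; apply: (@le_lt_trans _ _ ((b + 1) * ((`|Kmax| + 1) * tau))).
    apply: ler_pM => //; first by rewrite mulr_ge0 ?K0// subr_ge0 ltW.
      by rewrite lerDl.
    by apply: ler_pM; rewrite ?K0 ?KM1 ?subr_ge0 ?(ltW ss')//; lra.
  by rewrite mulrA mulrC -ltr_pdivlMr// mulr_gt0.
have /choice[g' Hg'] : forall t, exists z, A t ->
    f z = H s' t /\ dist (g t) z <= b * (K t * (s' - s)).
  move=> t; have [At|nAt] := pselect (A t); last by exists (g t).
  have [U [G [_ Ot HG _]]] := Qtau t At s' s'in s'1.
  by exists (G t) => _; exact: HG.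
exists s', g'; split=> //; last first.
  by split=> [|t At] /=; [exact: ltW|have [] := Hg' t At].
split; first by rewrite s'1 (le_trans s0)// ltW.
  move=> t1 At1; have [U [G [oO Ot1 HG LG]]] := Qtau t1 At1 s' s'in s'1.
  have gG t : U t -> A t -> g' t = G t.
    move=> Ot At; have [f1 d1] := Hg' t At; have [f2 d2] := HG t Ot At.
    apply: (inj t At); [exact: le_lt_trans d1 (small t At)| |by rewrite f1 f2].
    exact: le_lt_trans d2 (small t At).
  apply: dist_cvg => // r r0; have rb : 0 < r / (b + 1) by rewrite divr_gt0.
  have s'01 : 0 <= s' <= 1 by rewrite s'1 (le_trans s0)// ltW.
  have nb : \forall y \near H s' t1, dist (H s' t1) y < r / (b + 1).
    by apply: filterS (dist_near0 conn (H s' t1) rb) => y [].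
  have N1 : within A (nbhs t1) [set t | dist (H s' t1) (H s' t) < r / (b + 1)].
    exact: (cH s'01 At1 nb).
  have N2 : within A (nbhs t1) U.
    have nU : nbhs t1 U by exact: open_nbhs_nbhs.
    by rewrite /within /=; apply: filterS nU => t + _.
  have N3 : within A (nbhs t1) A by exact: withinT.
  apply: filterS3 N1 N2 N3 => t Ht Ot At; rewrite !gG//.
  apply: le_lt_trans (LG _ _ Ot1 At1 Ot At) _.
  apply: (@le_lt_trans _ _ ((b + 1) * dist (H s' t1) (H s' t))).
    by rewrite ler_wpM2r ?dist_ge0// lerDl.
  by rewrite mulrC -ltr_pdivlMr.
by move=> t At; have [] := Hg' t At.
Unshelve. all: by end_near. Qed.

(** The displacements still to come at stage i are at most b * Kmax times the remaining time,
    uniformly in the parameter. Pointwise limits therefore exist by forward completeness, and they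
    are continuous by uniformity. *)
Lemma lift_limit (p : nat -> R * (T -> M)) :
  (forall i, partial_lift (p i).1 (p i).2) -> (forall i, extends (p i) (p i.+1)) ->
  exists q, [/\ partial_lift q.1 q.2, forall i, extends (p i) q &
    (fun i => (p i).1) @ \oo --> q.1].
Proof.
move=> pl ex.
have ex_add i k : extends (p i) (p (i + k)%N).
  elim: k => [|k IH]; first by rewrite addn0; exact: extends_refl.
  by rewrite addnS; exact: extends_trans IH (ex _).
have nd : nondecreasing_seq (fun i => (p i).1).
  by apply/nondecreasing_seqP => i; case: (ex i).
have ub1 i : (p i).1 <= 1 by case: (pl i) => /andP[].
have cs : cvgn (fun i => (p i).1).
  by apply: nondecreasing_is_cvgn => //; exists 1 => _ [i _ <-].
pose s := limn (fun i => (p i).1).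
have sle i : (p i).1 <= s by exact: nondecreasing_cvgn_le.
have s1 : s <= 1 by apply: limr_le => //; exact: nearW.
have s0 : 0 <= s by apply: le_trans (sle 0%N); case: (pl 0%N) => /andP[].
have near_s (e : R) : 0 < e -> \forall i \near \oo, s - (p i).1 < e.
  move=> e0; have /cvgrPdist_lt/(_ _ e0) := cs; apply: filterS => i.
  by apply: le_lt_trans; exact: ler_norm.
pose k := b * (`|Kmax| + 1) + 1.
have k0 : 0 < k by rewrite ltr_wpDl// mulr_ge0// ltW.
have bK t (r : R) : A t -> 0 <= r -> b * (K t * r) <= k * r.
  move=> At r0; rewrite mulrA ler_wpM2r// /k.
  apply: (@le_trans _ _ (b * (`|Kmax| + 1))); last by rewrite lerDl.
  by rewrite ler_wpM2l// KM1.
have bound i j t : A t -> dist ((p i).2 t) ((p (i + j)%N).2 t) <= b * (K t * (s - (p i).1)).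
  move=> At; have [_ /(_ t At)/le_trans] := ex_add i j; apply.
  by rewrite ler_wpM2l// ler_wpM2l ?K0// lerD2r.
have /choice[g Hg] : forall t, exists l : M, A t -> (fun i => (p i).2 t) @ \oo --> l.
  move=> t; have [At|nAt] := pselect (A t); last by exists ((p 0%N).2 t).
  have [|l Hl] := complete (x := fun i => (p i).2 t); last by exists l.
  move=> e e0; have [N _ HN] := near_s _ (divr_gt0 e0 k0); exists N => i j Ni.
  rewrite distE// lte_fin; apply: le_lt_trans (bound i j t At) _.
  apply: le_lt_trans (bK t _ At _) _; first by rewrite subr_ge0.
  by rewrite mulrC -ltr_pdivlMr//; exact: HN.
have dg i t : A t -> dist ((p i).2 t) (g t) <= b * (K t * (s - (p i).1)).
  move=> At; apply/ler_addgt0Pr => e e0.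
  have N1 : \forall j \near \oo, dist (g t) ((p j).2 t) < e /\ dist ((p j).2 t) (g t) < e.
    exact: (Hg t At _ (dist_near0 conn (g t) e0)).
  have N2 : \forall j \near \oo, (i <= j)%N by exists i.
  have [j [[_ h1] ij]] := filter_ex (filterI N1 N2).
  have := dist_triangle conn ((p j).2 t) ((p i).2 t) (g t).
  have := bound i (j - i)%N t At; rewrite subnKC//=.
  by move: h1 => /=; lra.
exists (s, g); split=> //=; last first.
  by move=> i; split=> //= t At; exact: dg.
split; first by rewrite s0.
  move=> t0 At0; apply: dist_cvg => // r r0.
  have r3 : 0 < r / 3 by rewrite divr_gt0.
  have N1 : \forall i \near \oo,
      dist (g t0) ((p i).2 t0) < r / 3 /\ dist ((p i).2 t0) (g t0) < r / 3.
    exact: (Hg t0 At0 _ (dist_near0 conn (g t0) r3)).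
  have N2 := near_s _ (divr_gt0 r3 k0).
  have [i [[h1 _] h2]] := filter_ex (filterI N1 N2).
  have [_ ci _] := pl i.
  have nb : \forall y \near (p i).2 t0, dist ((p i).2 t0) y < r / 3.
    by apply: filterS (dist_near0 conn ((p i).2 t0) r3) => y [].
  have N3 : within A (nbhs t0) [set t | dist ((p i).2 t0) ((p i).2 t) < r / 3].
    exact: (ci t0 At0 _ nb).
  have N4 : within A (nbhs t0) A by exact: withinT.
  apply: filterS2 N3 N4 => t /= h3 At.
  have h4 : dist ((p i).2 t) (g t) < r / 3.
    apply: le_lt_trans (dg i t At) _; apply: le_lt_trans (bK t _ At _) _.
      by rewrite subr_ge0.
    by rewrite mulrC -ltr_pdivlMr.
  have := dist_triangle conn ((p i).2 t0) (g t0) (g t).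
  have := dist_triangle conn ((p i).2 t) ((p i).2 t0) (g t).
  by move: h1 => /=; lra.
move=> t At; apply: (dist_eq0 conn); apply/eqP; rewrite eq_le dist_ge0 andbT.
apply/ler_addgt0Pr => e e0; rewrite add0r.
have e2 : 0 < e / 2 by rewrite divr_gt0.
have cfg : (fun i => f ((p i).2 t)) @ \oo --> f (g t).
  by apply: (cvg_comp _ _ (Hg t At)); exact: cf.
have N1 : \forall i \near \oo, dist (f (g t)) (f ((p i).2 t)) < e / 2 /\
    dist (f ((p i).2 t)) (f (g t)) < e / 2.
  exact: (cfg _ (dist_near0 conn (f (g t)) e2)).
have N2 := near_s _ (divr_gt0 e2 Kmax1).
have [i [[h1 _] h2]] := filter_ex (filterI N1 N2).
have [/andP[pi0 _] _ fi] := pl i; rewrite /= fi// in h1.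
have h3 := HK At pi0 (sle i) s1.
have h4 : K t * (s - (p i).1) <= e / 2.
  apply: (@le_trans _ _ ((`|Kmax| + 1) * (s - (p i).1))).
    by rewrite ler_wpM2r ?KM1// subr_ge0.
  by rewrite mulrC -ler_pdivlMr//; exact: ltW.
have := dist_triangle conn (H (p i).1 t) (f (g t)) (H s t).
lra.
Qed.

(** The last bound also says that parameters with K t = 0 do not move, which is how a lift relative
    to the end points is obtained. *)
Lemma lift_homotopy (g0 : T -> M) :
  (forall t, A t -> g0 @ within A (nbhs t) --> g0 t) ->
  (forall t, A t -> f (g0 t) = H 0 t) ->
  exists g1 : T -> M, [/\ forall t, A t -> g1 @ within A (nbhs t) --> g1 t,
    forall t, A t -> f (g1 t) = H 1 t &
    forall t, A t -> dist (g0 t) (g1 t) <= b * K t].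
Proof.
move=> cg0 fg0; pose S := {p : R * (T -> M) | partial_lift p.1 p.2}.
have pl0 : partial_lift (0 : R, g0).1 (0 : R, g0).2 by split=> //=; rewrite lexx ler01.
pose p0 : S := exist _ (0 : R, g0) pl0.
(* Each extension goes at least half as far as possible, so that the limit of
   the extensions admits no further extension. *)
have /choice[nxt Hnxt] : forall p : S, exists q : S, extends (sval p) (sval q) /\
    forall q' : S, extends (sval p) (sval q') ->
      (sval q').1 <= 2 * (sval q).1 - (sval p).1.
  move=> p; pose E := [set r | exists2 q : S, extends (sval p) (sval q) & r = (sval q).1].
  have Ep : E (sval p).1 by exists p => //; exact: extends_refl.
  have E1 : ubound E 1 by move=> _ [q _ ->]; case: (svalP q) => /andP[].
  have hE : has_sup E by split; [exists (sval p).1|exists 1].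
  have [le|lt] := leP (sup E) (sval p).1.
    exists p; split=> [|q' pq']; first exact: extends_refl.
    have : (sval q').1 <= sup E by apply: sup_upper_bound => //; exists q'.
    lra.
  have e0 : 0 < (sup E - (sval p).1) / 2 by rewrite divr_gt0// subr_gt0.
  have [_ [q pq ->] qE] := sup_adherent e0 hE.
  exists q; split=> // q' pq'.
  have : (sval q').1 <= sup E by apply: sup_upper_bound => //; exists q'.
  lra.
pose p i := iter i nxt p0.
have ex i : extends (sval (p i)) (sval (p i.+1)) by case: (Hnxt (p i)).
have [q [plq exq cq]] := lift_limit (fun i => svalP (p i)) ex.
have q1 : q.1 = 1.
  have [/andP[_ le1] _ _] := plq.
  apply/eqP; rewrite eq_le le1/= leNgt; apply/negP => lt1.
  have [s' [g' [lt' pl' ex']]] := lift_extend plq lt1.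
  pose q' : S := exist _ (s', g') pl'.
  have le i : s' <= 2 * (sval (p i.+1)).1 - (sval (p i)).1.
    have [_ /(_ q')] := Hnxt (p i); apply.
    by apply: extends_trans (exq i) _; case: (q) ex'.
  have e0 : 0 < (s' - q.1) / 2 by rewrite divr_gt0// subr_gt0.
  have /cvgrPdist_lt/(_ _ e0)[N _ HN] := cq.
  have := HN N (leqnn N); have := le N; have [le2 _] := exq N.+1.
  rewrite /= ltr_norml => h /andP[h1 h2]; lra.
have [_ cq2 fq2] := plq; exists q.2; split=> //; first by rewrite -q1.
by have [_] := exq 0%N; rewrite /= q1 subr0 => + t At => /(_ t At); rewrite mulr1.
Qed.

End Lifting.

(** * Fixed points and bijectivity *)

Lemma continuous_towards (R : realType) (V : normedModType R) (s : R) (u : V) :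
  continuous (fun v => v + s *: (u - v)).
Proof.
move=> v; apply: cvgD; first exact: cvg_id.
by apply: cvgZl_tmp; apply: cvgB; [exact: cvg_cst|exact: cvg_id].
Qed.

Section Bijectivity.
Context (R : realType) (n : nat) (M : finslerManifold R n).
Hypothesis conn : connected [set: M].
Hypothesis complete : forward_complete M.
Implicit Types (x y z : M) (f h : M -> M).

(** Banach's argument involves only distances from earlier to later iterates, so forward
    completeness is enough. [D] is the sum of the geometric series that bounds these distances from
    [x]. *)
Lemma contraction_fixpoint h (q : R) x : 0 <= q < 1 ->
  (forall y z, dist (h y) (h z) <= q * dist y z) -> exists p, h p = p.
Proof.
move=> /andP[q0 q1] hq.
have ch : continuous h.
  move=> y; apply: (@dilation_le_continuous _ _ _ conn _ q) => e e0.
  apply: nearW => z; apply: le_trans (hq _ _) _.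
  by rewrite ler_wpM2r ?dist_ge0// lerDl ltW.
have q1' : 0 < 1 - q by rewrite subr_gt0.
pose D := dist x (h x) / (1 - q); have D0 : 0 <= D by rewrite divr_ge0 ?dist_ge0// ltW.
have Dk k : dist x (iter k h x) <= D.
  elim: k => [|k IH]; first by rewrite /= distxx.
  apply: le_trans (dist_triangle conn (h x) _ _) _.
  have h1 : dist (h x) (h (iter k h x)) <= q * D.
    by apply: le_trans (hq _ _) _; rewrite ler_wpM2l.
  have : dist x (h x) = (1 - q) * D by rewrite /D mulrC divfK// gt_eqF.
  rewrite iterS; lra.
have Di i k : dist (iter i h x) (iter (i + k) h x) <= q ^+ i * D.
  elim: i => [|i IH]; first by rewrite expr0 mul1r.
  rewrite addSn !iterS exprS -mulrA; apply: le_trans (hq _ _) _.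
  by rewrite ler_wpM2l.
have cq : (fun i => q ^+ i * D) @ \oo --> (0 : R).
  rewrite -(mul0r D); apply: cvgMr_tmp; apply: cvg_expr.
  by rewrite ger0_norm.
have [|p cp] := complete (x := fun i => iter i h x).
  move=> e e0; have /cvgrPdist_lt/(_ _ e0)[N _ HN] := cq.
  exists N => i k Ni; rewrite distE// lte_fin; apply: le_lt_trans (Di i k) _.
  have := HN i Ni; rewrite sub0r normrN => /(le_lt_trans _); apply.
  exact: ler_norm.
exists p; have chp : (fun i => h (iter i h x)) @ \oo --> h p.
  by apply: (cvg_comp _ _ cp); exact: ch.
apply: (dist_eq0 conn); apply/eqP; rewrite eq_le dist_ge0 andbT.
apply/ler_addgt0Pr => e e0; rewrite add0r.
have e2 : 0 < e / 2 by rewrite divr_gt0.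
have N1 : \forall i \near \oo, dist (h p) (h (iter i h x)) < e / 2 /\
    dist (h (iter i h x)) (h p) < e / 2 := chp _ (dist_near0 conn (h p) e2).
have N2 : \forall i \near \oo, dist p (iter i.+1 h x) < e / 2 /\
    dist (iter i.+1 h x) p < e / 2.
  have [N _ HN] := cp _ (dist_near0 conn p e2).
  by exists N => // i Ni; exact: (HN i.+1 (leqW Ni)).
have [i [[h1 _] [_ h2]]] := filter_ex (filterI N1 N2).
have := dist_triangle conn (h (iter i h x)) (h p) p; rewrite iterS in h2.
lra.
Qed.

Lemma curve_lipschitz (c : R -> M) : smooth_curve c -> exists2 K : R, 0 <= K &
  forall s s' : R, 0 <= s -> s <= s' -> s' <= 1 -> dist (c s) (c s') <= K * (s' - s).
Proof.
move=> sc; have [S [dS _]] := flength_primitive sc.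
have cs : {within `[0, 1], continuous (speed c)}.
  by apply: continuous_subspaceT; exact: continuous_speed.
have [m m01 Hm] := EVT_max ler01 cs.
exists (speed c m); first exact: speed_ge0.
move=> s s' s0 ss' s'1; apply: le_trans (dist_subcurve conn sc dS s0 ss') _.
pose G : R -> R := S \- (speed c m \*: (id : R -> R)).
have dG (t : R) : 0 <= t -> is_derive t 1 G (speed c t - speed c m * 1).
  move=> t0; have dz : is_derive t 1 (speed c m \*: (id : R -> R)) (speed c m *: (1 : R)).
    exact: is_deriveZ.
  have dSt : is_derive t 1 S (speed c t).
    by apply: dS; apply: lt_le_trans t0; rewrite ltrN10.
  exact: (is_deriveB dSt dz).
have : G s' <= G s.
  apply: (@ler0_derive1_nincr R G 0 1) => //.
  - by move=> t; rewrite in_itv/= => /andP[/ltW/dG[]].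
  - move=> t t01; rewrite derive1E; have /andP[t0 t1] : 0 < t < 1 by move: t01; rewrite in_itv.
    have [_ ->] := dG t (ltW t0); rewrite mulr1 subr_le0; apply: Hm.
    by rewrite in_itv/= !ltW.
  - by apply: derivable_within_continuous => t; rewrite in_itv/= => /andP[/dG[]].
by rewrite /G /= /GRing.scale /=; lra.
Qed.

(** With a single parameter, homotopy lifting is path lifting: a curve from [f y] to [y], lifted
    with starting point [y], ends at a preimage of [y]. *)
Lemma lift_surjective f (b : R) y : 0 <= b -> continuous f ->
  local_section f b -> exists x, f x = y.
Proof.
move=> b0 cf Lf.
have [c [S [sc c0 c1 _ _]]] := near_optimal_curve conn (f y) y ltr01.
have [K K0 HK] := curve_lipschitz sc.
have [||||||g [_ fg _]] := @lift_homotopy _ _ _ conn complete f b b0 cf Lf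
  M [set y] (fun s _ => c s) (fun=> K) K (@compact_set1 _ y) _ _ _ _ (fun=> y).
- by [].
- by [].
- by move=> s _ t _; exact: cvg_cst.
- by move=> s s' t _; exact: HK.
- by move=> t _; exact: cvg_cst.
- by move=> t _; rewrite c0.
by exists (g y); rewrite fg.
Qed.

Lemma similarity_distE f h (a : R) : similarity a f -> cancel f h -> cancel h f ->
  forall x y, dist (f x) (f y) = a * dist x y.
Proof.
move=> fS fK hK x y; have a0 : 0 < a by case: fS.
have Lf := similarity_local_section conn fS.
apply/eqP; rewrite eq_le; apply/andP; split.
  by apply: dist_dilation_global => //; [exact: ltW|exact: similarity_dilation].
have dh z : dilation_le h a^-1 z.
  move=> e e0; have [g [fg gf lg]] := Lf (h z); rewrite hK in fg lg.
  have [lg1 _] := near_diag lg.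
  apply: filterS2 fg lg1 => z' fgz' lz'.
  have gz : g z = h z by rewrite -{1}(hK z); exact: nbhs_singleton gf.
  have gz' : g z' = h z' by rewrite -{2}fgz' fK.
  rewrite -gz -gz'; apply: le_trans lz' _.
  by rewrite ler_wpM2r ?dist_ge0// lerDl ltW.
have ia0 : 0 <= a^-1 by rewrite invr_ge0 ltW.
have := dist_dilation_global conn (f x) (f y) ia0 dh.
by rewrite !fK ler_pdivlMl.
Qed.

Lemma iter_contraction f (q : R) k x y : 0 <= q ->
  (forall x y, dist (f x) (f y) <= q * dist x y) ->
  dist (iter k f x) (iter k f y) <= q ^+ k * dist x y.
Proof.
move=> q0 fq; elim: k => [|k IH]; first by rewrite expr0 mul1r.
by rewrite !iterS exprS -mulrA; apply: le_trans (fq _ _) _; rewrite ler_wpM2l.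
Qed.

(** Local injectivity of [f] makes [g] locally constant on [0, 1]; [dini_le] passes from local to
    global. *)
Lemma lift_constant f (b : R) (g : R -> M) z : local_section f b ->
  (forall t : R, `[0, 1]%classic t -> g @ within `[0, 1]%classic (nbhs t) --> g t) ->
  (forall t : R, `[0, 1]%classic t -> f (g t) = z) -> g 0 = g 1.
Proof.
move=> Lf cg fg; pose A : set R := `[0, 1]%classic.
have AE (t : R) : A t = (0 <= t <= 1) by rewrite /A /= in_itv.
have loc t : A t -> \forall s \near t, A s -> g s = g t.
  move=> At; have [[B C] [/= nB nC] BC] := local_section_inj (g t) Lf.
  have N1 : within A (nbhs t) [set s | B (g s)] by exact: (cg t At _ nB).
  have N2 : within A (nbhs t) [set s | A s] by exact: withinT.
  have N : within A (nbhs t) [set s | g s = g t].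
    apply: filterS2 N1 N2 => s Bs As; apply: (BC (g s, g t)) => /=.
      by split=> //; exact: nbhs_singleton nC.
    by rewrite !fg.
  exact: N.
apply: (dist_eq0 conn); apply/eqP; rewrite eq_le dist_ge0 andbT.
suff : dist (g 0) (g 1) <= dist (g 0) (g 0) by rewrite distxx.
apply: (@dini_le R (fun t => dist (g 0) (g t))) => t t01 e e0.
  have /andP[t0 t1] := t01.
  have At : A t by rewrite AE t1 ltW.
  have N1 : \forall s \near t^'-, A s -> g s = g t.
    by apply: filterS (loc t At) => s + _.
  near=> s; have s0 : 0 < s by near: s; exact: nbhs_left_gt.
  have st : s < t by near: s; exact: nbhs_left_lt.
  have gs : A s -> g s = g t by near: s.
  by rewrite gs ?lerDl ?ltW// AE (ltW s0) (le_trans (ltW st)).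
have /andP[t0 t1] := t01.
have At : A t by rewrite AE t0 ltW.
have N1 : \forall h \near 0^'+, A (t + h) -> g (t + h) = g t.
  move: (loc t At); rewrite (near_shift 0 t) => H.
  by apply: filterS H => h /=; rewrite subr0 addrC => + _.
have t1' : 0 < 1 - t by rewrite subr_gt0.
near=> h; have h0 : 0 < h by [].
have h1 : h < 1 - t by near: h; exact: nbhs_right_lt.
have gh : A (t + h) -> g (t + h) = g t by near: h.
rewrite gh ?lerDl ?mulr_ge0 ?ltW// AE; apply/andP; split; lra.
Unshelve. all: by end_near. Qed.

Lemma contracting_similarity_inj f (a : R) : similarity a f -> a < 1 -> injective f.
Proof.
move=> fS a1 x y fxy; have a0 : 0 < a by case: fS.
have cf : continuous f by case: fS => _ [].
have Lf := similarity_local_section conn fS.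
have fa y' z' : dist (f y') (f z') <= a * dist y' z'.
  by apply: dist_dilation_global => //; [exact: ltW|exact: similarity_dilation].
have a01 : 0 <= a < 1 by rewrite ltW.
have [p fp] := contraction_fixpoint x a01 fa.
have [c [S [sc c0 c1 dS _]]] := near_optimal_curve conn x y ltr01.
set i := chart_at p; set u0 := coord i p.
have ip : dom i p by exact: chart_atP.
have [C C0 ub] := finsler_upper_bound p.
have [[B1 B2] [/= nB1 nB2] B12] := fdist_upper p (@ltr01 R).
have nB : \forall u \near u0, [/\ B1 u, B2 u & (coord i @` dom i) u].
  have nI := nbhs_img (img_coord ip).
  by apply: filterS3 nB1 nB2 nI => u h1 h2 h3.
have /nbhs_ballP[r /= r0 Hr] := nB.
have [rho rho0 Hrho] := dist_separated conn (chart_ball_nbhs p r0).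
(* Bounds the distance from [p] to every point of the curve. *)
pose L := dist p x + (S 1 - S 0).
have ck : (fun k => a ^+ k * L) @ \oo --> (0 : R).
  by rewrite -(mul0r L); apply: cvgMr_tmp; apply: cvg_expr; rewrite gtr0_norm.
have /cvgrPdist_lt/(_ _ rho0)[k _ Hk] := ck.
(* At least one iteration, so that f x = f y makes the image of the curve a loop. *)
pose F := iter k.+1 f.
have FL : a ^+ k.+1 * L < rho.
  have := Hk k.+1 (leqnSn k); rewrite sub0r normrN => /(le_lt_trans _); apply.
  exact: ler_norm.
have cF : continuous F.
  by rewrite /F; elim: (k.+1) => [|m cm] z; [exact: cvg_id|exact: (continuous_comp (cm z) (cf _))].
have ia0 : 0 <= a^-1 by rewrite invr_ge0 ltW.
have LF : local_section F (a^-1 ^+ k.+1) by exact: local_section_iter.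
have Fp : F p = p by rewrite /F; elim: (k.+1) => // m; rewrite iterS => ->.
have Fxy : F x = F y by rewrite /F !iterSr fxy.
pose A : set R := `[0, 1]%classic.
have AE (t : R) : A t = (0 <= t <= 1) by rewrite /A /= in_itv.
have FB t : A t -> chart_ball p r (F (c t)).
  rewrite AE => /andP[t0 t1]; apply: Hrho; apply: le_lt_trans FL.
  rewrite -{1}Fp; apply: le_trans (iter_contraction _ _ _ (ltW a0) fa) _.
  apply: ler_wpM2l; first by apply: exprn_ge0; exact: ltW.
  rewrite /L.
  have h1 := dist_subcurve conn sc dS (lexx 0) t0.
  have h2 := dist_subcurve conn sc dS t0 t1.
  have h3 := dist_ge0 (c t) (c 1).
  have := dist_triangle conn (c 0) p (c t); rewrite c0 in h1 *; lra.
pose w t := coord i (F (c t)).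
have w01 : w 0 = w 1 by rewrite /w c0 c1 Fxy.
have A0 : A 0 by rewrite AE lexx ler01.
have A1 : A 1 by rewrite AE lexx ler01.
have wr t : A t -> `|w t - u0| < r by move=> /FB[].
(* The loop is contracted linearly to its base point; the chart ball is convex. *)
pose H (s t : R) := param i (w t + s *: (w 0 - w t)).
have inball (s t : R) : 0 <= s <= 1 -> A t -> ball u0 r (w t + s *: (w 0 - w t)).
  move=> /andP[s0 s1] At; rewrite -ball_normE /=.
  have -> : u0 - (w t + s *: (w 0 - w t)) = (1 - s) *: (u0 - w t) + s *: (u0 - w 0).
    by apply/rowP => j; rewrite !mxE; ring.
  apply: le_lt_trans (ler_normD _ _) _.
  rewrite !normrZ ger0_norm ?subr_ge0// ger0_norm// !(distrC u0).
  have [->|sn0] := eqVneq s 0; first by rewrite mul0r subr0 mul1r addr0 wr.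
  have sp : 0 < s by rewrite lt_neqAle eq_sym sn0.
  have h1 : (1 - s) * `|w t - u0| <= (1 - s) * r.
    by rewrite ler_wpM2l ?subr_ge0// ltW// wr.
  have h2 : s * `|w 0 - u0| < s * r by rewrite ltr_pM2l// wr.
  lra.
(* Vanishes at t = 0 and at t = 1 because [w] is a loop, so the lifted curve keeps its end points
   [x] and [y]. *)
pose K t := (C + 1) * `|w 0 - w t|.
have C1 : 0 < C + 1 by rewrite addr_gt0.
have HK (s s' t : R) : A t -> 0 <= s -> s <= s' -> s' <= 1 ->
    dist (H s t) (H s' t) <= K t * (s' - s).
  move=> At s0 ss' s'1; have s01 : 0 <= s <= 1 by rewrite s0 (le_trans ss').
  have s'01 : 0 <= s' <= 1 by rewrite s'1 (le_trans s0).
  have [Bs _ _] := Hr _ (inball s t s01 At).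
  have [_ Bs' _] := Hr _ (inball s' t s'01 At).
  have := B12 (_, _) (conj Bs Bs'); rewrite /= distE// lee_fin => /le_trans; apply.
  have -> : w t + s' *: (w 0 - w t) - (w t + s *: (w 0 - w t)) = (s' - s) *: (w 0 - w t).
    by rewrite opprD addrACA subrr add0r -scalerBl.
  have nE : `|(s' - s) *: (w 0 - w t)| = (s' - s) * `|w 0 - w t|.
    by rewrite normrZ ger0_norm// subr_ge0.
  have := ub ((s' - s) *: (w 0 - w t)); rewrite nE /K; lra.
have cw t : A t -> {for t, continuous w}.
  move=> At; apply: (@continuous_comp _ _ _ (F \o c) (coord i)).
    by apply: continuous_comp; [exact: sc.1|exact: cF].
  by apply: coord_continuous; have [] := FB t At.
have cH (s : R) : 0 <= s <= 1 -> forall t, A t -> H s @ within A (nbhs t) --> H s t.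
  move=> s01 t At; apply: cvg_within_filter.
  apply: (@continuous_comp _ _ _ (fun t => w t + s *: (w 0 - w t)) (param i)); last first.
    by apply: param_continuous; have [] := Hr _ (inball s t s01 At).
  apply: (@continuous_comp _ _ _ w (fun v => v + s *: (w 0 - v))); first exact: cw.
  exact: continuous_towards.
have [|||||g [cg fg dg]] := @lift_homotopy _ _ _ conn complete F _ (exprn_ge0 k.+1 ia0) cF LF
  R A H K ((C + 1) * (r + r)) _ _ _ cH HK c.
- exact: segment_compact.
- by move=> t At; rewrite mulr_ge0// ltW.
- move=> t At; rewrite /K ler_pM2l//.
  have := ler_distD u0 (w 0) (w t); rewrite (distrC u0).
  have := wr t At; have := wr 0 A0; lra.
- by move=> t At; apply: cvg_within_filter; exact: sc.1.
- by move=> t At; rewrite /H scale0r addr0 coordK//; have [] := FB t At.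
have g0 : g 0 = x.
  apply/esym/(dist_eq0 conn)/eqP; rewrite eq_le dist_ge0 andbT -c0.
  by apply: le_trans (dg 0 A0) _; rewrite /K subrr normr0 !mulr0.
have g1 : g 1 = y.
  apply/esym/(dist_eq0 conn)/eqP; rewrite eq_le dist_ge0 andbT -c1.
  by apply: le_trans (dg 1 A1) _; rewrite /K w01 subrr normr0 !mulr0.
(* At time 1 the homotopy is a constant curve, so its lift from [x] to [y] is constant. *)
rewrite -g0 -g1; apply: (lift_constant LF cg (z := param i (w 0))) => t At.
by rewrite fg// /H scale1r addrC subrK.
Qed.

Lemma similarity_bijective f (a : R) : similarity a f -> a != 1 ->
  (1 < a -> injective f) ->
  exists h, [/\ cancel f h, cancel h f & forall x y, dist (f x) (f y) = a * dist x y].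
Proof.
move=> fS an1 inj; have a0 : 0 < a by case: fS.
have cf : continuous f by case: fS => _ [].
have Lf := similarity_local_section conn fS.
have ia0 : 0 <= a^-1 by rewrite invr_ge0 ltW.
have fI : injective f.
  have [a1|a1|a1] := ltgtP a 1; first exact: contracting_similarity_inj fS a1.
    exact: inj.
  by rewrite a1 eqxx in an1.
have /choice[h hK] : forall y, exists x, f x = y.
  by move=> y; exact: lift_surjective ia0 cf Lf.
have fK : cancel f h by move=> x; apply: fI; rewrite hK.
by exists h; split=> //; exact: similarity_distE fS fK hK.
Qed.

End Bijectivity.

(** * The tangent cone *)

Lemma ultra_compact_cvg (I : Type) (T : topologicalType) (g : I -> T) (K : set T)
    (U : set_system I) : compact K -> UltraFilter U -> U (g @^-1` K) ->
  exists l, K l /\ g @ U --> l.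
Proof.
move=> cK UU UK; have [l [Kl cl]] := cK (g @ U) _ UK; exists l; split=> // B nB.
have [//|nUB] := in_ultra_setVsetC (g @^-1` B) UU.
by have [y [nBy By]] := cl (~` B) B nUB nB.
Qed.

Section TangentDistance.
Context (R : realType) (n : nat) (M : finslerManifold R n) (x : M).
Let N := tangent_finsler x.

Lemma chart_finsler_tangent (i : atlas N) (u v : 'rV[R]_n) :
  @chart_finsler _ _ N i u v = finsler x v.
Proof.
rewrite /chart_finsler /=; congr finsler.
by rewrite /tangent_of /=; case: (is_diff_id u) => _ ->.
Qed.

(** Straight segments give one inequality; the function F_x(. - u) is a calibration with constant 1
    for the other. *)
Lemma fdist_tangent (u v : N) : fdist u v = (finsler x (v - u))%:E.
Proof.
apply/eqP; rewrite eq_le; apply/andP; split.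
  apply: (@fdist_segment _ _ N tt u v) => t t01; first by exists (u + t *: (v - u)).
  by rewrite chart_finsler_tangent.
have cG : continuous (fun w : N => finsler x (w - u)).
  move=> w; exact: (continuous_comp (@continuous_subr R 'rV[R]_n u w)
    (@finsler_fibre_continuous _ _ M x (w - u))).
have := @fdist_ge _ _ N (fun w => finsler x (w - u)) 1 u v ltr01 cG.
rewrite subrr finsler0 subr0 divr1; apply=> c t e sc e0.
have dc : differentiable (c : R^o -> 'rV[R]_n) t by exact: (@smooth_curve_diff _ _ N c tt).
apply: filterS (finsler_curve_dini x u dc e0) => h.
by rewrite mul1r.
Qed.

End TangentDistance.

Section TangentCone.
Context (R : realType) (n : nat) (M : finslerManifold R n).
Hypothesis conn : connected [set: M].
Variables (x : M) (lam : nat -> R) (sg tau : nat -> M -> M).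
Hypothesis lam0 : forall k, 0 < lam k.
Hypothesis lam_infty : forall r : R, \forall k \near \oo, r < lam k.
Hypothesis sgK : forall k, cancel (tau k) (sg k).
Hypothesis sgx : forall k, sg k x = x.
Hypothesis sg_dist : forall k y z, dist (sg k y) (sg k z) = lam k * dist y z.
Notation V := 'rV[R]_n.

Let i := chart_at x.
Let u0 := coord i x.
Let ix : dom i x. Proof. exact: chart_atP. Qed.

Let small (u : V) (k : nat) : V := u0 + (lam k)^-1 *: u.
Let zoom (u : V) (k : nat) : M := sg k (param i (small u k)).

Let small_cvg (u : V) : small u @ \oo --> u0.
Proof.
have cl : (lam k)^-1 @[k --> \oo] --> (0 : R).
  apply/cvgrPdist_lt => e e0; apply: filterS (lam_infty e^-1) => k ke.
  rewrite sub0r normrN gtr0_norm ?invr_gt0//.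
  by rewrite -(invrK e) ltf_pV2 ?posrE ?invr_gt0.
have := cvg_comp _ _ cl (@continuous_line R V u0 u 0).
by rewrite scale0r addr0.
Qed.

Let small_img (u : V) : \forall k \near \oo, (coord i @` dom i) (small u k).
Proof. exact: (@small_cvg u _ (nbhs_img (img_coord ix))). Qed.

Let param_small_cvg (u : V) : (fun k => param i (small u k)) @ \oo --> x.
Proof.
have := cvg_comp _ _ (@small_cvg u) (param_continuous (img_coord ix)).
by rewrite coordK.
Qed.

Let tau_cvg (y : M) : (fun k => tau k y) @ \oo --> x.
Proof.
apply: dist_cvg => // r r0.
apply: filterS (lam_infty (dist x y / r)) => k kr.
have : lam k * dist x (tau k y) = dist x y by rewrite -sg_dist sgx sgK.
move=> dE; rewrite -(ltr_pM2l (lam0 k)) dE.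
by move: kr; rewrite ltr_pdivrMr.
Qed.

Let lam_scale k (w : V) : lam k * `|(lam k)^-1 *: w| = `|w|.
Proof. by rewrite normrZ gtr0_norm ?invr_gt0// mulVKf// gt_eqF. Qed.

Let small_sub (u v : V) k : small v k - small u k = (lam k)^-1 *: (v - u).
Proof. by rewrite /small opprD addrACA subrr add0r -scalerBr. Qed.

Let zoom_dist (u v : V) (e : R) : 0 < e -> \forall k \near \oo,
  `|dist (zoom u k) (zoom v k) - finsler x (v - u)| <= e * `|v - u|.
Proof.
move=> e0; have [[A B] [/= nA nB] AB] := dist_chart conn x e0.
have N1 : \forall k \near \oo, A (param i (small u k)) := @param_small_cvg _ _ nA.
have N2 : \forall k \near \oo, B (param i (small v k)) := @param_small_cvg _ _ nB.
near=> k; have Ak : A (param i (small u k)) by near: k.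
have Bk : B (param i (small v k)) by near: k.
have := AB (_, _) (conj Ak Bk); rewrite /= -/i !paramK; try by near: k.
rewrite small_sub /zoom sg_dist finsler_homo; last by rewrite invr_ge0 ltW.
rewrite -(ler_pM2l (lam0 k)) mulrCA lam_scale => /(le_trans _); apply.
rewrite -{2}(gtr0_norm (lam0 k)) -normrM mulrBr mulVKf ?gt_eqF//.
Unshelve. all: by end_near. Qed.

(** On a fixed pair of vectors the maps [zoom] become isometric as k grows. An ultrafilter gives
    limits for all vectors at once, and compactness is used twice: in the manifold for the limits to
    exist, in the vector space for surjectivity. *)
Lemma tangent_cone : exists h : V -> M,
  (forall u v, dist (h u) (h v) = finsler x (v - u)) /\ forall y, exists v, h v = y.
Proof.
have [U [UU sU]] := @ultraFilterLemma nat \oo _.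
have PU : ProperFilter U by exact: ultra_proper.
have FU : Filter U by exact: filter_filter.
have csg k : continuous (sg k).
  move=> y; apply: (@dilation_le_continuous _ _ _ conn _ (lam k)) => e e0.
  by apply: nearW => z; rewrite sg_dist ler_wpM2r ?dist_ge0// lerDl ltW.
have [r1 r10 rU] : exists2 r : R, 0 < r & forall u, `|u - u0| <= r -> (coord i @` dom i) u.
  have /nbhs_ballP[r /= r0 Hr] := nbhs_img (img_coord ix).
  exists (r / 2); first by rewrite divr_gt0.
  move=> u ur; apply: Hr; rewrite -ball_normE /= distrC.
  by apply: le_lt_trans ur _; rewrite ltr_pdivrMr// ltr_pMr// ltr1n.
have cK0 := compact_chart_ball rU.
have nK0 : nbhs x (param i @` [set u | `|u - u0| <= r1]).
  apply: filterS (chart_ball_nbhs x r10) => y [iy yr].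
  by exists (coord i y); [exact: ltW|rewrite coordK].
have [rho rho0 Hrho] := dist_separated conn nK0.
have zoom_lim v : exists l : M, zoom v @ U --> l.
  pose B := finsler x v + `|v|.
  have NB : \forall k \near \oo, dist x (zoom v k) <= B.
    apply: filterS (zoom_dist 0 v ltr01) => k.
    have -> : zoom 0 k = x by rewrite /zoom /small scaler0 addr0 coordK// sgx.
    by rewrite subr0 mul1r ler_norml => /andP[_]; rewrite lerBlDl.
  have [k0 k0B] := filter_ex (lam_infty (B / rho)).
  (* Bounded forward balls are relatively compact: one sufficiently strong dilation spreads a
     compact chart ball over the forward ball of radius [B]. *)
  pose K := sg k0 @` (param i @` [set u | `|u - u0| <= r1]).
  have cK : compact K.
    by apply: continuous_compact => //; apply: continuous_subspaceT; exact: csg.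
  have UK : U (zoom v @^-1` K).
    apply: sU; apply: filterS NB => k kB; exists (tau k0 (zoom v k)); last exact: sgK.
    apply: Hrho; have : lam k0 * dist x (tau k0 (zoom v k)) = dist x (zoom v k).
      by rewrite -sg_dist sgx sgK.
    move=> dE; rewrite -(ltr_pM2l (lam0 k0)) dE; apply: le_lt_trans kB _.
    by move: k0B; rewrite ltr_pdivrMr.
  by have [l [_ Hl]] := ultra_compact_cvg cK UU UK; exists l.
have /choice[h Hh] := zoom_lim.
have hd u v : dist (h u) (h v) = finsler x (v - u).
  have c1 : dist (zoom u k) (zoom v k) @[k --> U] --> dist (h u) (h v).
    exact: (@cvg_dist2 _ _ _ conn _ U FU _ _ _ _ (Hh u) (Hh v)).
  apply/eqP; rewrite -subr_eq0 -normr_le0; apply/ler_addgt0Pr => e e0; rewrite add0r.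
  pose w := `|v - u| + 1; have w0 : 0 < w by rewrite ltr_wpDl.
  have e2 : 0 < e / 2 by rewrite divr_gt0.
  have ew : 0 < e / 2 / w by rewrite divr_gt0.
  have N1 : U [set k | `|dist (zoom u k) (zoom v k) - finsler x (v - u)| <= e / 2 / w * `|v - u|].
    by apply: sU; exact: zoom_dist.
  have N2 : U [set k | `|dist (h u) (h v) - dist (zoom u k) (zoom v k)| < e / 2].
    exact: ((cvgrPdist_lt _ _).1 c1).
  have [k [/= h1 h2]] := filter_ex (filterI N1 N2).
  have h3 : e / 2 / w * `|v - u| <= e / 2.
    by rewrite mulrAC ler_pdivrMr// ler_pM2l// lerDl.
  have := ler_distD (dist (zoom u k) (zoom v k)) (dist (h u) (h v)) (finsler x (v - u)).
  lra.
exists h; split=> // y.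
have [C C0 HC] := dist_le_coord conn x; have [K K0 HK] := dist_ge_coord conn x.
(* The vector that [zoom] sends to [y] at stage k, once [tau k y] has entered the chart. These
   vectors stay bounded, and their limit is the preimage of [y]. *)
pose vk k : V := lam k *: (coord i (tau k y) - u0).
have smallvk k : small (vk k) k = coord i (tau k y).
  by rewrite /small /vk scalerA mulVf ?gt_eqF// scale1r addrC subrK.
have Nvk : \forall k \near \oo, `|vk k - 0| <= K * dist x y.
  have [HK1 _] := near_diag HK.
  have N1 : \forall k \near \oo, `|coord i (tau k y) - u0| <= K * dist x (tau k y) := @tau_cvg y _ HK1.
  apply: filterS N1 => k h1; rewrite subr0 /vk normrZ gtr0_norm//.
  have <- : lam k * dist x (tau k y) = dist x y by rewrite -sg_dist sgx sgK.
  by rewrite mulrCA ler_pM2l.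
have [v [_ Hv]] := ultra_compact_cvg
  (@compact_rV_closed_ball R n 0 (K * dist x y)) UU (sU _ Nvk).
exists v.
apply: (dist_eq0 conn); apply/eqP; rewrite eq_le dist_ge0 andbT.
apply/ler_addgt0Pr => e e0; rewrite add0r.
have e2 : 0 < e / 2 by rewrite divr_gt0.
have eC : 0 < e / 2 / C by rewrite divr_gt0.
have N1 : U [set k | dist (h v) (zoom v k) < e / 2 /\ dist (zoom v k) (h v) < e / 2].
  exact: (Hh v _ (dist_near0 conn (h v) e2)).
have N2 : U [set k | `|v - vk k| < e / 2 / C].
  exact: ((cvgrPdist_lt _ _).1 Hv).
have [[A B] [/= nA nB] AB] := HC.
have N3 : U [set k | [/\ A (param i (small v k)), B (tau k y) &
    (coord i @` dom i) (small v k)]].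
  apply: sU; have N4 : \forall k \near \oo, A (param i (small v k)) := @param_small_cvg _ _ nA.
  have N5 : \forall k \near \oo, B (tau k y) := @tau_cvg y _ nB.
  by apply: filterS3 N4 N5 (small_img v) => k h1 h2 h3.
have [k [[h1 h2] [Ak Bk Ik]]] := filter_ex (filterI (filterI N1 N2) N3).
have h3 := AB (_, _) (conj Ak Bk); rewrite /= -/i paramK// -smallvk small_sub in h3.
have h4 : dist (zoom v k) y <= C * `|vk k - v|.
  rewrite -{1}(sgK k y) /zoom sg_dist -(lam_scale k (vk k - v)) mulrCA.
  by rewrite ler_pM2l.
have h5 : C * `|vk k - v| < e / 2 by rewrite distrC mulrC -ltr_pdivlMr.
have := dist_triangle conn (zoom v k) (h v) y; case: h1; lra.
Qed.

End TangentCone.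

(** * From one contraction to a Minkowski space *)

Section MainTheorem.
Context (R : realType) (n : nat) (M : finslerManifold R n).
Hypothesis conn : connected [set: M].
Hypothesis complete : forward_complete M.
Notation V := 'rV[R]_n.

Lemma finsler_isometry_inverse (x : M) (h : V -> M) :
  (forall u v, dist (h u) (h v) = finsler x (v - u)) -> (forall y, exists v, h v = y) ->
  exists g : M -> V, cancel g h /\ cancel h g.
Proof.
move=> hd /choice[g gK]; exists g; split=> // u.
have := hd u (g (h u)); rewrite gK distxx => /esym/finsler_eq0.
exact: subr0_eq.
Qed.

Lemma contraction_isometric (g h : M -> M) (q : R) (x : M) : 0 < q < 1 ->
  cancel h g -> (forall y z, dist (g y) (g z) = q * dist y z) ->
  isometric M (tangent_finsler x).
Proof.
move=> /andP[q0 q1] hK gd; have q01 : 0 <= q < 1 by rewrite ltW.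
have gle y z : dist (g y) (g z) <= q * dist y z by rewrite gd.
have [p gp] := contraction_fixpoint conn complete x q01 gle.
have gI : injective g.
  move=> y z gyz; apply: (dist_eq0 conn); have := gd y z.
  by rewrite gyz distxx => /esym/eqP; rewrite mulf_eq0 gt_eqF//= => /eqP.
have gK : cancel g h by move=> y; apply: gI; rewrite hK.
have hd y z : dist (h y) (h z) = q^-1 * dist y z.
  by rewrite -{2}(hK y) -{2}(hK z) gd mulKf// gt_eqF.
have [H [Hd Hs]] : exists H : V -> M,
    (forall u v, dist (H u) (H v) = finsler p (v - u)) /\ forall y, exists v, H v = y.
  apply: (@tangent_cone _ _ _ conn p (fun k => q^-1 ^+ k) (fun k => iter k h) (fun k => iter k g)).
  - by move=> k; rewrite exprn_gt0// invr_gt0.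
  - move=> r; have r1 : 0 < (`|r| + 1)^-1 by rewrite invr_gt0 ltr_wpDl.
    have cq : q ^+ k @[k --> \oo] --> (0 : R) by apply: cvg_expr; rewrite gtr0_norm.
    apply: filterS ((cvgrPdist_lt _ _).1 cq _ r1) => k.
    rewrite sub0r normrN gtr0_norm ?exprn_gt0// exprVn => qk.
    apply: (@lt_trans _ _ (`|r| + 1)); first by rewrite ltr_pwDr ?ler_norm.
    by rewrite -(invrK (`|r| + 1)) ltf_pV2 ?posrE ?exprn_gt0.
  - by elim=> [|k IH] y //; rewrite iterSr (iterS k g) gK IH.
  - by elim=> // k IH; rewrite iterS IH -{1}gp gK.
  - elim=> [|k IH] y z; first by rewrite expr0 mul1r.
    by rewrite !iterS hd IH exprS mulrA.
have [E [HK EK]] := finsler_isometry_inverse Hd Hs.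
(* The homothety of T_pM with centre [E x], carried over to the manifold. It fixes [x] and scales
   distances because translations of T_pM preserve them. *)
pose dil (l : R) y := H (E x + l *: (E y - E x)).
have dilK (l : R) : l != 0 -> cancel (dil l^-1) (dil l).
  move=> l0 y; rewrite /dil EK (addrC (E x) (l^-1 *: _)) addrK scalerA mulfV// scale1r.
  by rewrite addrC subrK HK.
have [Hx [Hxd Hxs]] : exists H : V -> M,
    (forall u v, dist (H u) (H v) = finsler x (v - u)) /\ forall y, exists v, H v = y.
  apply: (@tangent_cone _ _ _ conn x (fun k => k.+1%:R) (fun k => dil k.+1%:R)
    (fun k => dil k.+1%:R^-1)).
  - by move=> k; rewrite ltr0n.
  - move=> r; apply: filterS (nbhs_infty_gtr r) => k /lt_trans; apply.
    by rewrite ltr_nat.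
  - by move=> k; apply: dilK; rewrite pnatr_eq0.
  - by move=> k; rewrite /dil subrr scaler0 addr0 HK.
  - move=> k y z; rewrite /dil Hd opprD addrACA subrr add0r -scalerBr.
    rewrite opprB addrA subrK finsler_homo//; congr (_ * _).
    by rewrite -{2}(HK y) -{2}(HK z) Hd.
have [Ex [HxK ExK]] := finsler_isometry_inverse Hxd Hxs.
exists Ex; split; first by exists Hx.
by move=> y z; rewrite fdist_tangent -Hxd !HxK distE.
Qed.

End MainTheorem.

Theorem theorem6p1 (R : realType) (n : nat) (M : finslerManifold R n)
    (M_connected : connected [set: M])
    (M_complete : forward_complete M)
    (f : M -> M) (a : R)
    (f_similarity : similarity a f)
    (f_injective : 1 < a -> injective f)
    (a_neq1 : a != 1) :
  forall x : M, isometric M (tangent_finsler x).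
Proof.
move=> x; have a0 : 0 < a by case: f_similarity.
have [h [fK hK fd]] :=
  similarity_bijective M_connected M_complete f_similarity a_neq1 f_injective.
have [a1|a1|a1] := ltgtP a 1; last by rewrite a1 eqxx in a_neq1.
  by apply: (contraction_isometric M_connected M_complete x _ hK fd); rewrite a0.
apply: (@contraction_isometric _ _ _ M_connected M_complete h f a^-1 x _ fK).
  by rewrite invr_gt0 a0 invf_lt1.
by move=> y z; rewrite -{2}(hK y) -{2}(hK z) fd mulKf// gt_eqF.
Qed.
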